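(* Let $a<b$ be real numbers. The spectrum of the quadratic operator pencil $\mathrm{L}_0$ coincides with the spectrum of the self-adjoint linear relation $\mathrm{T}_0$. If some $z\in\mathbb{C}$ belongs to the resolvent set of $\mathrm{L}_0$, then $$\mathrm{L}_0(z)^{-1}g(x)=\langle g,G(x,\cdot)^\ast\rangle_{H^1([a,b))},\qquad x\in[a,b),\ g\in H^1_0([a,b)),$$ where the Green's function $G$ is given by $$G(x,s)=\frac{1}{W(\psi,\phi)}\begin{cases}\psi(x)\phi(s),& s\le x,\\ \psi(s)\phi(x),& s>x,\end{cases}$$ and $\psi$, $\phi$ are linearly independent solutions of the homogeneous differential equation $-f''+\frac14 f=z\,\omega f+z^2\upsilon f$ which satisfy $\psi(b)=\phi(a)=0$.
   Context: Let $\omega$ be a real-valued Borel measure on $\mathbb{R}$ and $\upsilon$ a non-negative Borel measure on $\mathbb{R}$ (both locally finite; so $\omega$ is a signed measure assigning finite values to bounded Borel sets). The superscript $^\ast$ on numbers and functions denotes complex conjugation. For a Borel measure $\mu$, $\int_x^y f\,d\mu$ means $\int_{[x,y)}f\,d\mu$ if $y>x$, $0$ if $y=x$, and $-\int_{[y,x)}f\,d\mu$ if $y<x$. For $z\in\mathbb{C}$, a solution of $-f''+\frac14 f=z\,\omega f+z^2\upsilon f$ is a locally absolutely continuous function $f$ on $\mathbb{R}$ whose derivative has a left-continuous representative, always denoted $f'$, with $-f'(y)+f'(x)+\frac14\int_x^y f(s)\,ds=z\int_x^y f\,d\omega+z^2\int_x^y f\,d\upsilon$ for all $x,y\in\mathbb{R}$.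 For two solutions, the Wronskian $W(\theta,\phi)=\theta(x)\phi'(x)-\theta'(x)\phi(x)$ does not depend on $x$. Let $\mathcal{H}_{\mathrm{loc}}(\mathbb{R})=H^1_{\mathrm{loc}}(\mathbb{R})\times L^2_{\mathrm{loc}}(\mathbb{R};\upsilon)$, where $H^1_{\mathrm{loc}}(\mathbb{R})$ consists of locally absolutely continuous functions with locally square integrable derivative; components are denoted $f_1,f_2$. The linear relation $\mathrm{T}_{\mathrm{loc}}$ consists of all pairs $\mathbf f=(f,\tau f)\in\mathcal{H}_{\mathrm{loc}}(\mathbb{R})^2$ such that $-f_1''+\frac14 f_1=\omega\,\tau f_1+\upsilon\,\tau f_2$ in the sense of distributions and $f_2=\tau f_1$ almost everywhere with respect to $\upsilon$. $H^1([a,b))$ carries the scalar product $\langle f,g\rangle_{H^1([a,b))}=\frac14\int_a^b fg^\ast dx+\int_a^b f'(g')^\ast dx$, and $H^1_0([a,b))$ is its subspace of functions vanishing at $a$ and $b$. $\mathcal{H}_0([a,b))=H^1_0([a,b))\times L^2([a,b);\upsilon)$ is the Hilbert space with scalar product $\langle f_1,g_1\rangle_{H^1([a,b))}+\int_a^b f_2g_2^\ast d\upsilon$. The linear relation $\mathrm{T}_0$ in $\mathcal{H}_0([a,b))$ consists of all $\mathbf f=(f,\tau f)\in\mathcal{H}_0([a,b))\times\mathcal{H}_0([a,b))$ which are restrictions to $[a,b)$ of elements of $\mathrm{T}_{\mathrm{loc}}$; it is self-adjoint. The resolvent set of a closed linear relation $\mathrm{S}$ is the set of $z\in\mathbb{C}$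 for which $(\mathrm{S}-z)^{-1}$, with $\mathrm{S}-z=\{(f,g-zf):(f,g)\in \mathrm{S}\}$, is (the graph of) an everywhere defined bounded operator; the spectrum is its complement. The quadratic operator pencil $\mathrm{L}_0$ in $H^1_0([a,b))$ is $\mathrm{L}_0(z)=\mathrm{I}_0-z\,\Omega_0-z^2\Upsilon_0$, $z\in\mathbb{C}$, where $\mathrm{I}_0$ is the identity and $\Omega_0,\Upsilon_0$ are the bounded operators on $H^1_0([a,b))$ $$\Omega_0g(x)=\int_a^bK_0(x,s)g(s)\,d\omega(s),\qquad \Upsilon_0g(x)=\int_a^bK_0(x,s)g(s)\,d\upsilon(s),$$ $$K_0(x,s)=\frac{2}{\sinh\left(\frac{b-a}{2}\right)}\begin{cases}\sinh\left(\frac{b-x}{2}\right)\sinh\left(\frac{s-a}{2}\right),& s\le x,\\ \sinh\left(\frac{b-s}{2}\right)\sinh\left(\frac{x-a}{2}\right),& s>x.\end{cases}$$ The resolvent set of a pencil is the set of $z\in\mathbb{C}$ for which the operator at $z$ has an everywhere defined bounded inverse; the spectrum is the complement. *)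

(* Defs.v *)
From HB Require Import structures.
From mathcomp Require Import all_boot all_order all_algebra.
From mathcomp Require Import complex.
From mathcomp Require Import all_classical all_reals all_analysis.

Set Implicit Arguments.
Unset Strict Implicit.
Unset Printing Implicit Defensive.

Import Order.TTheory GRing.Theory Num.Theory.
Import numFieldNormedType.Exports.

Local Open Scope classical_set_scope.
Local Open Scope ring_scope.
Local Open Scope complex_scope.

(* The ^o makes the functions R -> C a left module over C. *)
Notation cfun R := (R -> (R[i])^o).

Definition locally_finite (R : realType)
    (mu : {measure set (measurableTypeR R) -> \bar R}) :=
  forall x y : R, (mu `[x, y[%classic < +oo)%E.

(* A real-valued, locally finite Borel measure.  It need not extend to all Borel
   sets of the line (the positive and the negative part may both be infinite):
   only the values on bounded Borel sets are meaningful, and the restriction to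
   any bounded interval is a finite signed measure. *)
Record signed_borel (R : realType) := SignedBorel {
  sb_fun :> set (measurableTypeR R) -> R;
  sb_set0 : sb_fun set0 = 0;
  sb_sigma_additive : forall x y : R,
    semi_sigma_additive (fun A => (sb_fun (A `&` `[x, y[%classic))%:E) }.

Definition sb_restr (R : realType) (omega : signed_borel R) (x y : R) :
    set (measurableTypeR R) -> \bar R :=
  fun A => (omega (A `&` `[x, y[%classic))%:E.

Section sb_restr_charge.
Context (R : realType) (omega : signed_borel R) (x y : R).

Let sb_restr0 : sb_restr omega x y set0 = 0%E.
Proof. by rewrite /sb_restr set0I sb_set0. Qed.

Let sb_restr_fin A : measurable A -> sb_restr omega x y A \is a fin_num.
Proof. by []. Qed.

HB.instance Definition _ := isCharge.Build _ _ _ (sb_restr omega x y)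
  sb_restr0 sb_restr_fin (@sb_sigma_additive R omega x y).

End sb_restr_charge.

Definition cint (R : realType)
    (mu : {measure set (measurableTypeR R) -> \bar R})
    (D : set (measurableTypeR R)) (f : cfun R) : R[i] :=
  (\int[mu]_(s in D) complex.Re (f s)) +i* (\int[mu]_(s in D) complex.Im (f s)).

Definition leb (R : realType) : {measure set (measurableTypeR R) -> \bar R} :=
  @lebesgue_measure R.

(* Integral against a signed measure through its Jordan decomposition, which
   does not depend on the chosen Hahn decomposition. *)
Definition charge_cint (R : realType)
    (nu : {charge set (measurableTypeR R) -> \bar R})
    (D : set (measurableTypeR R)) (f : cfun R) : R[i] :=
  let P := cid (Hahn_decomposition nu) in
  let N := cid (projT2 P) in
  cint (jordan_pos (projT2 N)) D f - cint (jordan_neg (projT2 N)) D f.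

Definition sb_cint (R : realType) (omega : signed_borel R) (x y : R)
    (f : cfun R) : R[i] :=
  charge_cint (sb_restr omega x y) `[x, y[%classic f.

Definition oriented (R : realType) (J : R -> R -> R[i]) (x y : R) : R[i] :=
  if x < y then J x y else if y < x then - J y x else 0.

Definition mint (R : realType)
    (mu : {measure set (measurableTypeR R) -> \bar R}) (x y : R) (f : cfun R) :=
  oriented (fun x y => cint mu `[x, y[%classic f) x y.

Definition sint (R : realType) (omega : signed_borel R) (x y : R) (f : cfun R) :=
  oriented (fun x y => sb_cint omega x y f) x y.

Definition cmeasurable (R : realType) (D : set (measurableTypeR R))
    (f : cfun R) :=
  measurable_fun D (fun s : measurableTypeR R => complex.Re (f s)) /\
  measurable_fun D (fun s : measurableTypeR R => complex.Im (f s)).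

Definition cintegrable (R : realType)
    (mu : {measure set (measurableTypeR R) -> \bar R})
    (D : set (measurableTypeR R)) (f : cfun R) :=
  mu.-integrable D (fun s => (complex.Re (f s))%:E) /\
  mu.-integrable D (fun s => (complex.Im (f s))%:E).

Definition square_integrable (R : realType)
    (mu : {measure set (measurableTypeR R) -> \bar R})
    (D : set (measurableTypeR R)) (f : cfun R) :=
  cmeasurable D f /\
  mu.-integrable D
    (fun s => (complex.Re (f s) ^+ 2 + complex.Im (f s) ^+ 2)%:E).

(* Absolute continuity on [a, b] in the form: f is the indefinite integral of an
   integrable function df, which then represents the derivative of f. *)
Definition abs_cont_with (R : realType) (a b : R) (f df : cfun R) :=
  cintegrable (@leb R) `[a, b[%classic df /\
  forall x y : R, a <= x -> x <= y -> y <= b ->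
    f y - f x = mint (@leb R) x y df.

Definition loc_abs_cont_with (R : realType) (f df : cfun R) :=
  forall a b : R, a < b -> abs_cont_with a b f df.

(* A representative of the derivative of an absolutely continuous function on
   [a, b]; it is unique up to null sets (and 0 for other functions). *)
Definition ac_deriv (R : realType) (a b : R) (f : cfun R) : cfun R :=
  xget 0 [set df | abs_cont_with a b f df].

(* Elements of spaces of functions on [a, b) are represented by functions on R
   whose values off [a, b] are irrelevant; the value at b of an absolutely
   continuous function on [a, b) is its continuous extension. *)
Definition H1 (R : realType) (a b : R) : set (cfun R) :=
  [set f | exists df, abs_cont_with a b f df /\
                      square_integrable (@leb R) `[a, b[%classic df].

Definition H10 (R : realType) (a b : R) : set (cfun R) :=
  [set f | [/\ H1 a b f, f a = 0 & f b = 0]].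

Definition H1_dot (R : realType) (a b : R) (f g : cfun R) : R[i] :=
  4%:R^-1 * mint (@leb R) a b (fun x => f x * conjc (g x)) +
  mint (@leb R) a b (fun x => ac_deriv a b f x * conjc (ac_deriv a b g x)).

Definition L2 (R : realType)
    (upsilon : {measure set (measurableTypeR R) -> \bar R}) (a b : R) :
    set (cfun R) :=
  [set f | square_integrable upsilon `[a, b[%classic f].

Definition H0 (R : realType)
    (upsilon : {measure set (measurableTypeR R) -> \bar R}) (a b : R) :
    set (cfun R * cfun R) :=
  [set f | H10 a b f.1 /\ L2 upsilon a b f.2].

Definition H0_dot (R : realType)
    (upsilon : {measure set (measurableTypeR R) -> \bar R}) (a b : R)
    (f g : cfun R * cfun R) : R[i] :=
  H1_dot a b f.1 g.1 + mint upsilon a b (fun x => f.2 x * conjc (g.2 x)).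

Definition H1_loc (R : realType) : set (cfun R) :=
  [set f | exists df, loc_abs_cont_with f df /\
    forall x y : R, square_integrable (@leb R) `[x, y[%classic df].

Definition L2_loc (R : realType)
    (upsilon : {measure set (measurableTypeR R) -> \bar R}) : set (cfun R) :=
  [set f | forall x y : R, L2 upsilon x y f].

Definition H_loc (R : realType)
    (upsilon : {measure set (measurableTypeR R) -> \bar R}) :
    set (cfun R * cfun R) :=
  [set f | H1_loc f.1 /\ L2_loc upsilon f.2].

Section spectra.
Context (R : realType) (V : lmodType R[i]).
(* A Hilbert space is given by a subspace H of V and a semi-inner product on H;
   vectors at distance zero from each other represent the same element. *)
Variables (H : set V) (dot : V -> V -> R[i]).

Definition norm_of (f : V) : R := Num.sqrt (complex.Re (dot f f)).

Definition same (f g : V) := norm_of (f - g) = 0.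

Definition bounded_inverse (A B : V -> V) :=
  [/\ forall g, H g -> H (B g),
      forall g, H g -> same (A (B g)) g,
      forall f, H f -> same (B (A f)) f &
      exists C : R, forall g, H g -> norm_of (B g) <= C * norm_of g].

Definition pencil_resolvent_set (L : R[i] -> V -> V) : set R[i] :=
  [set z | exists B, bounded_inverse (L z) B].

Definition pencil_spectrum (L : R[i] -> V -> V) : set R[i] :=
  ~` pencil_resolvent_set L.

Definition rel_shift (S : set (V * V)) (z : R[i]) : set (V * V) :=
  [set (p.1, p.2 - z *: p.1) | p in S].

Definition rel_inv (S : set (V * V)) : set (V * V) :=
  [set (p.2, p.1) | p in S].

Definition bounded_operator_graph (S : set (V * V)) :=
  [/\ forall f, H f -> exists g, S (f, g),
      forall f f' g g', S (f, g) -> S (f', g') -> same f f' -> same g g' &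
      exists C : R, forall f g, S (f, g) -> norm_of g <= C * norm_of f].

Definition rel_resolvent_set (S : set (V * V)) : set R[i] :=
  [set z | bounded_operator_graph (rel_inv (rel_shift S z))].

Definition rel_spectrum (S : set (V * V)) : set R[i] :=
  ~` rel_resolvent_set S.

End spectra.

Definition test_fun (R : realType) (c d : R) (h : R -> R) :=
  (forall n x, derivable (derive1n n h) x 1) /\
  (forall x, x \notin `[c, d[ -> h x = 0).

(* - f'' + f / 4 = omega g + upsilon k  in the sense of distributions; by
   linearity, real test functions suffice. *)
Definition distr_eq (R : realType) (omega : signed_borel R)
    (upsilon : {measure set (measurableTypeR R) -> \bar R}) (f g k : cfun R) :=
  forall (c d : R) (h : R -> R), c < d -> test_fun c d h ->
    mint (@leb R) c d (fun x => f x * (- derive1n 2 h x + 4%:R^-1 * h x)%:C) =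
    sint omega c d (fun x => g x * (h x)%:C) +
    mint upsilon c d (fun x => k x * (h x)%:C).

Definition T_loc (R : realType) (omega : signed_borel R)
    (upsilon : {measure set (measurableTypeR R) -> \bar R}) :
    set ((cfun R * cfun R) * (cfun R * cfun R)) :=
  [set p | let: (f, tf) := p in
    [/\ H_loc upsilon f, H_loc upsilon tf,
        distr_eq omega upsilon f.1 tf.1 tf.2 &
        {ae upsilon, forall x, f.2 x = tf.1 x}]].

Definition restricts (R : realType)
    (upsilon : {measure set (measurableTypeR R) -> \bar R}) (a b : R)
    (F f : cfun R * cfun R) :=
  (forall x, a <= x < b -> f.1 x = F.1 x) /\
  {ae upsilon, forall x : R, a <= x < b -> f.2 x = F.2 x}.

Definition T0 (R : realType) (omega : signed_borel R)
    (upsilon : {measure set (measurableTypeR R) -> \bar R}) (a b : R) :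
    set ((cfun R * cfun R) * (cfun R * cfun R)) :=
  [set p | [/\ H0 upsilon a b p.1, H0 upsilon a b p.2 &
    exists F TF, [/\ T_loc omega upsilon (F, TF),
      restricts upsilon a b F p.1 & restricts upsilon a b TF p.2]]].

Definition sinh (R : realType) (x : R) : R := (expR x - expR (- x)) / 2.

Definition K0 (R : realType) (a b x s : R) : R :=
  2 / sinh ((b - a) / 2) *
  (if s <= x then sinh ((b - x) / 2) * sinh ((s - a) / 2)
   else sinh ((b - s) / 2) * sinh ((x - a) / 2)).

Definition Omega0 (R : realType) (omega : signed_borel R) (a b : R)
    (g : cfun R) : cfun R :=
  fun x => sint omega a b (fun s => (K0 a b x s)%:C * g s).

Definition Upsilon0 (R : realType)
    (upsilon : {measure set (measurableTypeR R) -> \bar R}) (a b : R)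
    (g : cfun R) : cfun R :=
  fun x => mint upsilon a b (fun s => (K0 a b x s)%:C * g s).

Definition L0 (R : realType) (omega : signed_borel R)
    (upsilon : {measure set (measurableTypeR R) -> \bar R}) (a b : R)
    (z : R[i]) (g : cfun R) : cfun R :=
  g - z *: Omega0 omega a b g - (z ^+ 2) *: Upsilon0 upsilon a b g.

Definition left_continuous (R : realType) (f : cfun R) :=
  forall x : R,
    complex.Re (f t) @[t --> x^'-] --> complex.Re (f x) /\
    complex.Im (f t) @[t --> x^'-] --> complex.Im (f x).

(* The left-continuous representative df of the derivative of f is determined
   by f. *)
Definition solution (R : realType) (omega : signed_borel R)
    (upsilon : {measure set (measurableTypeR R) -> \bar R})
    (z : R[i]) (f df : cfun R) :=
  [/\ loc_abs_cont_with f df, left_continuous df &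
      forall x y : R,
        - df y + df x + 4%:R^-1 * mint (@leb R) x y f =
        z * sint omega x y f + z ^+ 2 * mint upsilon x y f].

Definition lin_indep (R : realType) (f g : cfun R) :=
  forall alpha beta : R[i],
    alpha *: f + beta *: g = 0 -> alpha = 0 /\ beta = 0.

Definition wronskian (R : realType) (f df g dg : cfun R) (x : R) : R[i] :=
  f x * dg x - df x * g x.

Definition boundary_solutions (R : realType) (omega : signed_borel R)
    (upsilon : {measure set (measurableTypeR R) -> \bar R}) (a b : R) (z : R[i])
    (psi dpsi phi dphi : cfun R) :=
  [/\ solution omega upsilon z psi dpsi, solution omega upsilon z phi dphi,
      lin_indep psi phi, psi b = 0 & phi a = 0].

Definition green (R : realType) (W : R[i]) (psi phi : cfun R) (x s : R) : R[i] :=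
  W^-1 * (if s <= x then psi x * phi s else psi s * phi x).

(* Main.v *)
Require Import Defs.
From mathcomp Require Import all_boot all_order all_algebra.
From mathcomp Require Import complex.
From mathcomp Require Import all_classical all_reals all_analysis.
From mathcomp Require Import measurable_realfun ring lra.
Import Order.TTheory GRing.Theory Num.Theory.
Import numFieldNormedType.Exports.
Local Open Scope classical_set_scope.
Local Open Scope ring_scope.
Local Open Scope complex_scope.
Set Implicit Arguments.
Unset Strict Implicit.
Unset Printing Implicit Defensive.

(** The pencil and the relation are connected by the Green kernel [K0].  For a
    source [G omega + K upsilon] the function [Omega0 G + Upsilon0 K] is the
    unique solution of [- F'' + F / 4 = G omega + K upsilon] that vanishes at [a]
    and [b] ([potential_exists], [K0_representation]).  Hence [T0] consists of all
    pairs with [f.1 = Omega0 tf.1 + Upsilon0 tf.2] on [[a, b]] and [f.2 = tf.1]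
    almost everywhere ([T0P]); that distributional solutions are given by the
    kernel is Weyl's lemma ([weyl_lemma]), proved with explicit test functions
    that are built from a mollified fundamental solution.

    With this description, the resolvent equation of [T0] at [z] for a right-hand
    side [f] gives the second component of the solution [g] as
    [f.1 + z * g.1], and what remains is the equation
    [L0 z g.1 = Omega0 f.1 + Upsilon0 (z * f.1 + f.2)]
    ([T0_resolventP]).  So an inverse of the pencil yields the resolvent of the
    relation, since the right-hand side is bounded in the energy norm by the norm
    of [f] ([resolvent_subset]).  Conversely, the resolvent of the relation at
    [(z *: h, 0)] has a first component [u] with [L0 z u = h - L0 z h], and then
    [h + u] is the inverse of the pencil at [h] ([resolvent_supset]).  The two
    spectra are therefore equal.

    If [z] is in the resolvent set then the pencil has no kernel, that is, the
    homogeneous equation has no nontrivial solution that vanishes at [a] and [b].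
    Solutions are determined by their initial values ([ivp_exists], [ivp_unique],
    by a Volterra operator that is a contraction for a weighted norm), so the
    solutions with [psi b = 0] and with [phi a = 0] exist and have a nonzero
    Wronskian.  For the formula itself, put [w] for the inverse of the pencil at
    [g] and [nu] for the measure [z omega + z ^+ 2 upsilon].  The Green function
    solves the homogeneous equation on both sides of [x] and its derivative drops
    there by one, so that the scalar product of [w] with it is [w x] plus the
    integral of [w] times the Green function against [nu] ([green_pairing]).  On
    the other hand [w - g] is the potential of [w nu], whose scalar product with
    any function vanishing at [a] and [b] is the integral of [w] times that
    function against [nu].  Subtracting, the scalar product of [g] with the Green
    function is [w x] ([green_formula]).

    All measures enter through families of oriented integrals ([mfam]) with
    Fubini's theorem on triangles, which amounts to integration by parts between
    absolutely continuous functions and distribution functions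
    ([integration_by_parts]).  This treats [omega], which is a signed measure on
    bounded intervals only, on the same footing as [upsilon] and the Lebesgue
    measure. *)

(** * Fubini's theorem on a triangle *)

Section real_integrals.
Context (R : realType).
Notation T := (measurableTypeR R).
Implicit Types (m : {measure set T -> \bar R}) (x y s t : R).

Lemma integrableM_bounded m (D : set T) (w f : R -> R) (K : R) :
  measurable D -> m.-integrable D (EFin \o w) -> measurable_fun D (f : T -> R) ->
  (forall s, D s -> `|f s| <= K) -> m.-integrable D (fun s => (w s * f s)%:E).
Proof.
move=> mD iw mf fK.
have mw : measurable_fun D (w : T -> R) by apply/measurable_EFinP; exact: measurable_int iw.
apply: (@le_integrable _ _ _ _ _ mD _ (fun s => (K * `|w s|)%:E)) => //.
- by apply/measurable_EFinP; apply: measurable_funM.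
- move=> s Ds /=; rewrite lee_fin !normrM normr_id.
  have K0 : 0 <= K by exact: le_trans (fK s Ds).
  by rewrite (ger0_norm K0) mulrC ler_wpM2r// fK.
- under eq_fun do rewrite EFinM.
  by apply: integrableZl => //; exact: integrable_norm.
Qed.

Lemma integrable_bounded m (D : set T) (f : R -> R) (K : R) :
  measurable D -> (m D < +oo)%E -> measurable_fun D (f : T -> R) ->
  (forall s, D s -> `|f s| <= K) -> m.-integrable D (EFin \o f).
Proof.
move=> mD fD mf fK; apply: measurable_bounded_integrable => //.
exists K; split; first exact: num_real.
by move=> M KM s Ds; exact: le_trans (fK _ Ds) (ltW KM).
Qed.

Lemma integral_mfrestr m (D : set T) (mD : measurable D) (mDoo : (m D < +oo)%E)
    (f : T -> \bar R) :
  (\int[mfrestr mD mDoo]_s (f \_ D) s = \int[m]_(s in D) f s)%E.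
Proof.
rewrite -integral_mkcond; apply: eq_measure_integral => A mA AD.
by rewrite /= /mfrestr /mrestr setIidl.
Qed.

Lemma measurable_le_indic :
  measurable_fun setT (fun p : T * T => (p.1 <= p.2)%R%:R : R).
Proof.
pose B := [set p : T * T | (p.1 <= p.2)%R].
have mB : measurable B.
  have -> : B = (fun p : T * T => (p.1 <= p.2)%R) @^-1` [set true].
    by apply/seteqP; split=> p.
  rewrite -[X in measurable X]setTI.
  have h : measurable_fun setT (fun p : T * T => (p.1 <= p.2)%R).
    by apply: measurable_fun_ler; [exact: measurable_fst|exact: measurable_snd].
  exact: h.
have -> : (fun p : T * T => (p.1 <= p.2)%R%:R : R) = \1_B.
  by apply/funext => p; rewrite indicE; congr (_ %:R); congr nat_of_bool;
    apply/idP/idP => [h|]; [exact: mem_set|move/set_mem].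
exact: measurable_indic.
Qed.

(** Only product measures of sigma-finite measures admit Fubini's theorem, so
    both measures are restricted to the bounded interval, where they are finite,
    and the triangle enters as an indicator function. *)
Lemma integral_triangle m x y (w v : R -> R) :
  m.-integrable `[x, y[ (EFin \o w) -> (@leb R).-integrable `[x, y[ (EFin \o v) ->
  (m `[x, y[%classic < +oo)%E ->
  \int[m]_(s in `[x, y[) (w s * \int[@leb R]_(t in `[x, s[) v t) =
  \int[@leb R]_(t in `[x, y[) (v t * \int[m]_(s in `[t, y[) w s).
Proof.
move=> iw iv mfin; set D := `[x, y[%classic.
have mD : measurable (D : set T) by exact: measurable_itv.
have lfin : (@leb R D < +oo)%E.
  by rewrite /leb /D /= lebesgue_measure_itv /=; case: ifP => // _; rewrite -EFinB ltry.
pose m1 := mfrestr mD lfin; pose m2 := mfrestr mD mfin.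
pose v0 t := if t \in D then v t else 0.
pose w0 s := if s \in D then w s else 0.
pose f (p : T * T) : \bar R := (v0 p.1 * w0 p.2 * (p.1 <= p.2)%R%:R)%:E.
have mv : measurable_fun setT (v0 : T -> R).
  by apply/(measurable_restrict (v : T -> R)) => //; rewrite setTI;
    apply/measurable_EFinP; exact: measurable_int iv.
have mw : measurable_fun setT (w0 : T -> R).
  by apply/(measurable_restrict (w : T -> R)) => //; rewrite setTI;
    apply/measurable_EFinP; exact: measurable_int iw.
have mf : measurable_fun setT f.
  apply/measurable_EFinP; apply: measurable_funM; last exact: measurable_le_indic.
  by apply: measurable_funM;
    [apply: measurableT_comp mv _; exact: measurable_fst
    |apply: measurableT_comp mw _; exact: measurable_snd].
have itvE (t s : R) : D s -> (`[t, y[%classic : set R) s = (t <= s)%R :> Prop.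
  by rewrite /D /= !in_itv /= => /andP[_ ->]; rewrite andbT.
have itvE' (t s : R) : D t -> (`[x, s]%classic : set R) t = (t <= s)%R :> Prop.
  by rewrite /D /= !in_itv /= => /andP[-> _].
have nv : (@leb R).-integrable D (fun t => `|v t|%:E) by exact: integrable_norm.
have nw : m.-integrable D (fun t => `|w t|%:E) by exact: integrable_norm.
have imf : (m1 \x m2)%E.-integrable setT f.
  apply/integrable12ltyP => //.
  pose cw := (\int[m]_(s in D) `|w s|%:E)%E.
  have cwE : cw = (fine cw)%:E by rewrite fineK//; exact: integrable_fin_num.
  apply: (@le_lt_trans _ _ (\int[m1]_t ((fun t => `|v t|%:E * cw) \_ D) t)%E).
    apply: ge0_le_integral => //.
    - by move=> t _; exact: integral_ge0.
    - apply: (measurable_fun_fubini_tonelli_F (m2 := m2) (abse \o f)) => //=.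
      exact: measurableT_comp.
    - apply/measurable_restrict => //; rewrite setTI cwE.
      apply: emeasurable_funM => //.
      exact: measurable_int nv.
    - move=> t _; rewrite /patch; case: ifPn => tD; last first.
        rewrite (eq_integral (cst 0%E)) ?integral0// => s _.
        by rewrite /f /= /v0 (negbTE tD) !mul0r normr0.
      rewrite -ge0_integralZl//; last exact: measurable_int nw.
      rewrite -(integral_mfrestr _ mfin); apply: ge0_le_integral => //.
      + apply: measurableT_comp => //.
        exact: (measurableT_comp mf (measurable_pair1 t)).
      + apply/measurable_restrict => //; rewrite setTI.
        by apply: emeasurable_funM => //; exact: measurable_int nw.
      + move=> s _; rewrite /f /= /v0 /w0 /patch tD; case: ifPn => sD.
          rewrite -EFinM lee_fin normrM normrM ler_piMr ?mulr_ge0//.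
          by case: (t <= s)%R; rewrite ?normr1 ?normr0.
        by rewrite mulr0 mul0r normr0.
  rewrite (integral_mfrestr mD lfin) cwE ge0_integralZr//.
  - by rewrite -(fineK (integrable_fin_num mD nv)) -EFinM ltry.
  - exact: measurable_int nv.
  - by rewrite lee_fin fine_ge0// integral_ge0.
have cut (n : {measure set T -> \bar R}) (h : R -> R) (A : set R) (c : T -> bool) :
    measurable (A : set T) -> n.-integrable D (EFin \o h) -> A `<=` D ->
    (forall s, D s -> A s = c s :> Prop) -> forall k : R,
    (\int[n]_(s in D) (k * h s * (c s)%:R)%R%:E =
     (k * \int[n]_(s in A) h s)%R%:E)%E.
  move=> mA ih AD Ac k.
  have iA : n.-integrable A (EFin \o h) by exact: integrableS ih.
  rewrite EFinM /Rintegral fineK; last exact: integrable_fin_num.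
  rewrite -integralZl//.
  rewrite -[in RHS](setIidr AD) integral_mkcondr; apply: eq_integral => s.
  move=> /set_mem Ds; rewrite /patch -EFinM /=.
  case: ifPn => [/set_mem|/negP sA].
    by rewrite (Ac _ Ds) => ->; rewrite mulr1.
  have -> : c s = false by apply/negP => cs; apply: sA; rewrite inE (Ac _ Ds).
  by rewrite mulr0.
have FE t : (\int[m2]_s f (t, s) =
    ((fun t => (v t * \int[m]_(s in `[t, y[) w s)%R%:E) \_ D) t)%E.
  rewrite /patch; case: ifPn => tD; last first.
    rewrite (eq_integral (cst 0%E)) ?integral0// => s _.
    by rewrite /f /= /v0 (negbTE tD) !mul0r.
  move: (set_mem tD); rewrite /D /= in_itv /= => /andP[xt ty].
  rewrite -(cut m w _ (fun s => t <= s)%R)//; last 2 first.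
    by move=> s; rewrite /D /= !in_itv /= => /andP[ts ->]; rewrite andbT (le_trans xt).
    by move=> s Ds; exact: itvE.
  rewrite -(integral_mfrestr _ mfin); apply: eq_integral => s _.
  by rewrite /f /= /v0 /w0 tD /patch; case: ifPn => // _; rewrite mulr0 mul0r.
have GE s : (\int[m1]_t f (t, s) =
    ((fun s => (w s * \int[@leb R]_(t in `[x, s[) v t)%R%:E) \_ D) s)%E.
  rewrite /patch; case: ifPn => sD; last first.
    rewrite (eq_integral (cst 0%E)) ?integral0// => t _.
    by rewrite /f /= /w0 (negbTE sD) mulr0 mul0r.
  move: (set_mem sD); rewrite /D /= in_itv /= => /andP[xs sy].
  have sub : `[x, s]%classic `<=` D.
    by move=> t; rewrite /D /= !in_itv /= => /andP[-> ts]; rewrite (le_lt_trans ts).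
  rewrite /leb Rintegral_itv_bndo_bndc; last first.
    apply: (integrableS mD) => //; apply: subset_trans sub.
    by move=> t /=; rewrite !in_itv /= => /andP[-> /ltW].
  rewrite -(cut (@leb R) v _ (fun t => t <= s)%R)//; last first.
    by move=> t Dt; exact: itvE'.
  rewrite -(integral_mfrestr _ lfin); apply: eq_integral => t _.
  rewrite /f /= /v0 /w0 sD /patch; case: ifPn => // _; last by rewrite !mul0r.
  by rewrite (mulrC (v t)).
have := Fubini imf.
under eq_integral do rewrite FE.
under [X in _ = X -> _]eq_integral do rewrite GE.
by rewrite !integral_mfrestr /Rintegral => ->.
Qed.
End real_integrals.

(** * Complex-valued integrals *)

Section complex_size.
Context (R : realType).
Notation C := R[i].
Implicit Types (z u : C).

Lemma Re_add z u : complex.Re (z + u) = complex.Re z + complex.Re u.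
Proof. by case: z u => [? ?] []. Qed.

Lemma Im_add z u : complex.Im (z + u) = complex.Im z + complex.Im u.
Proof. by case: z u => [? ?] []. Qed.

Lemma Re_opp z : complex.Re (- z) = - complex.Re z.
Proof. by case: z. Qed.

Lemma Im_opp z : complex.Im (- z) = - complex.Im z.
Proof. by case: z. Qed.

Lemma Re_mul z u :
  complex.Re (z * u) = complex.Re z * complex.Re u - complex.Im z * complex.Im u.
Proof. by case: z u => [? ?] []. Qed.

Lemma Im_mul z u :
  complex.Im (z * u) = complex.Re z * complex.Im u + complex.Im z * complex.Re u.
Proof. by case: z u => [? ?] []. Qed.

Lemma complex_ext z u :
  complex.Re z = complex.Re u -> complex.Im z = complex.Im u -> z = u.
Proof. by case: z u => [? ?] [? ?] /= -> ->. Qed.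

(** The size of a complex number is measured by this norm, equivalent to the
    modulus, because it interacts well with integrals that are defined
    componentwise. *)
Definition n1 z : R := `|complex.Re z| + `|complex.Im z|.

Lemma n1_ge0 z : 0 <= n1 z. Proof. by rewrite addr_ge0. Qed.

Lemma n1_0 : n1 0 = 0. Proof. by rewrite /n1 /= normr0 addr0. Qed.

Lemma n1N z : n1 (- z) = n1 z.
Proof. by rewrite /n1 Re_opp Im_opp !normrN. Qed.

Lemma n1D z u : n1 (z + u) <= n1 z + n1 u.
Proof. by rewrite /n1 Re_add Im_add addrACA lerD// ler_normD. Qed.

Lemma n1M z u : n1 (z * u) <= n1 z * n1 u.
Proof.
rewrite /n1 Re_mul Im_mul.
apply: (@le_trans _ _ ((`|complex.Re z * complex.Re u| + `|complex.Im z * complex.Im u|) +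
  (`|complex.Re z * complex.Im u| + `|complex.Im z * complex.Re u|))).
  by apply: lerD; [exact: ler_normB|exact: ler_normD].
by rewrite !normrM le_eqVlt; apply/orP; left; apply/eqP; ring.
Qed.

Lemma n1_real (x : R) : n1 x%:C = `|x|.
Proof. by rewrite /n1 /= normr0 addr0. Qed.

Lemma n1_Re z : `|complex.Re z| <= n1 z. Proof. by rewrite /n1 lerDl. Qed.
Lemma n1_Im z : `|complex.Im z| <= n1 z. Proof. by rewrite /n1 lerDr. Qed.

Lemma n1_eq0 z : n1 z = 0 -> z = 0.
Proof.
move=> h; apply: complex_ext => /=; apply/eqP; rewrite -normr_le0 -h.
  exact: n1_Re.
exact: n1_Im.
Qed.

Lemma n1_small z : (forall e : R, 0 < e -> n1 z <= e) -> z = 0.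
Proof.
move=> h; apply: n1_eq0; apply/eqP; rewrite eq_le n1_ge0 andbT.
by apply/ler_addgt0Pl => e e0; rewrite addr0 h.
Qed.

End complex_size.

Section complex_integrals.
Context (R : realType).
Notation C := R[i].
Notation T := (measurableTypeR R).
Implicit Types (m : {measure set T -> \bar R}) (x y s t : R) (D : set T)
  (f g w : R -> C).

Lemma itvcoE x y s : (`[x, y[%classic : set R) s = ((x <= s) && (s < y)) :> Prop.
Proof. by rewrite /= in_itv. Qed.

Lemma subset_itvco_cc x y : `[x, y[%classic `<=` (`[x, y]%classic : set R).
Proof. by move=> s /=; rewrite !in_itv /= => /andP[-> /ltW]. Qed.

Lemma cmeasurableD D f g : cmeasurable D f -> cmeasurable D g ->
  cmeasurable D (fun s => f s + g s).
Proof.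
move=> [f1 f2] [g1 g2]; split.
  by under eq_fun do rewrite Re_add; exact: measurable_funD.
by under eq_fun do rewrite Im_add; exact: measurable_funD.
Qed.

Lemma cmeasurableM D f g : cmeasurable D f -> cmeasurable D g ->
  cmeasurable D (fun s => f s * g s).
Proof.
move=> [f1 f2] [g1 g2]; split.
  by under eq_fun do rewrite Re_mul;
    apply: measurable_funB; exact: measurable_funM.
by under eq_fun do rewrite Im_mul; apply: measurable_funD; exact: measurable_funM.
Qed.

Lemma cmeasurable_cst D (k : C) : cmeasurable D (fun=> k).
Proof. by split; exact: measurable_cst. Qed.

Lemma cmeasurableS D E f : measurable D -> E `<=` D ->
  cmeasurable D f -> cmeasurable E f.
Proof. by move=> mD ED [f1 f2]; split; apply: (measurable_funS mD ED). Qed.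

Lemma cmeasurable_n1 D f : cmeasurable D f ->
  measurable_fun D (fun s => n1 (f s) : R).
Proof. by move=> [f1 f2]; apply: measurable_funD; exact: measurableT_comp. Qed.

Lemma eq_cmeasurable D f g : (forall s, D s -> f s = g s) ->
  cmeasurable D f -> cmeasurable D g.
Proof.
move=> fg [f1 f2]; split.
  by apply: eq_measurable_fun f1 => s /set_mem Ds; rewrite fg.
by apply: eq_measurable_fun f2 => s /set_mem Ds; rewrite fg.
Qed.

Lemma cintegrable_measurable m D f : cintegrable m D f -> cmeasurable D f.
Proof. by move=> [f1 f2]; split; apply/measurable_EFinP; [exact: measurable_int f1|exact: measurable_int f2]. Qed.

Lemma cintegrable_n1 m D f : measurable D -> cintegrable m D f ->
  m.-integrable D (fun s => (n1 (f s))%:E).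
Proof.
move=> mD [f1 f2]; rewrite /n1.
under eq_fun do rewrite EFinD.
by apply: integrableD => //; exact: integrable_norm.
Qed.

Lemma cintegrableP m D f (g : R -> R) : measurable D -> cmeasurable D f ->
  m.-integrable D (EFin \o g) -> (forall s, D s -> n1 (f s) <= g s) ->
  cintegrable m D f.
Proof.
move=> mD [f1 f2] ig fg; split.
  apply: (@le_integrable _ _ _ _ _ mD _ (EFin \o g)) => //; first exact/measurable_EFinP.
  move=> s Ds /=; rewrite lee_fin (le_trans (n1_Re _))//.
  by rewrite (le_trans (fg _ Ds))// ler_norm.
apply: (@le_integrable _ _ _ _ _ mD _ (EFin \o g)) => //; first exact/measurable_EFinP.
move=> s Ds /=; rewrite lee_fin (le_trans (n1_Im _))//.
by rewrite (le_trans (fg _ Ds))// ler_norm.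
Qed.

Lemma eq_cintegrable m D f g : measurable D -> (forall s, D s -> f s = g s) ->
  cintegrable m D f -> cintegrable m D g.
Proof.
move=> mD fg [f1 f2]; split.
  by apply: eq_integrable f1 => // s /set_mem Ds /=; rewrite fg.
by apply: eq_integrable f2 => // s /set_mem Ds /=; rewrite fg.
Qed.

Lemma cintegrableS m D E f : measurable D -> measurable E -> E `<=` D ->
  cintegrable m D f -> cintegrable m E f.
Proof. by move=> mD mE ED [f1 f2]; split; apply: (integrableS mD mE ED). Qed.

Lemma cintegrableD m D f g : measurable D -> cintegrable m D f ->
  cintegrable m D g -> cintegrable m D (fun s => f s + g s).
Proof.
move=> mD [f1 f2] [g1 g2]; split.
  by under eq_fun do rewrite Re_add EFinD; exact: integrableD.
by under eq_fun do rewrite Im_add EFinD; exact: integrableD.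
Qed.

Lemma cintegrableM m D f g (K : R) : measurable D -> cintegrable m D f ->
  cmeasurable D g -> (forall s, D s -> n1 (g s) <= K) ->
  cintegrable m D (fun s => f s * g s).
Proof.
move=> mD fi mg gK.
apply: (@cintegrableP m D _ (fun s => K * n1 (f s))) => //.
- by apply: cmeasurableM => //; exact: cintegrable_measurable fi.
- rewrite /comp; under eq_fun do rewrite EFinM.
  by apply: integrableZl => //; exact: cintegrable_n1.
- by move=> s Ds; rewrite (le_trans (n1M _ _))// mulrC ler_wpM2r ?n1_ge0// gK.
Qed.

Lemma cintegrableZ m D f (k : C) : measurable D -> cintegrable m D f ->
  cintegrable m D (fun s => k * f s).
Proof.
move=> mD fi; apply: (@eq_cintegrable _ _ (fun s => f s * k)) => //.
  by move=> s _; rewrite mulrC.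
by apply: (@cintegrableM _ _ _ _ (n1 k)) => //; exact: cmeasurable_cst.
Qed.

Lemma cintegrable_bounded m D f (K : R) : measurable D -> (m D < +oo)%E ->
  cmeasurable D f -> (forall s, D s -> n1 (f s) <= K) -> cintegrable m D f.
Proof.
move=> mD fD [f1 f2] fK; split.
  by apply: (@integrable_bounded _ _ _ _ K) => // s /fK; apply: le_trans; exact: n1_Re.
by apply: (@integrable_bounded _ _ _ _ K) => // s /fK; apply: le_trans; exact: n1_Im.
Qed.

Lemma eq_cint m D f g : (forall s, D s -> f s = g s) -> cint m D f = cint m D g.
Proof.
by move=> fg; congr (_ +i* _); apply: eq_Rintegral => s /set_mem Ds; rewrite fg.
Qed.

Lemma cintD m D f g : measurable D -> cintegrable m D f -> cintegrable m D g ->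
  cint m D (fun s => f s + g s) = cint m D f + cint m D g.
Proof.
move=> mD [f1 f2] [g1 g2]; apply: complex_ext; rewrite ?Re_add ?Im_add /=.
  by under eq_Rintegral do rewrite Re_add; rewrite RintegralD.
by under eq_Rintegral do rewrite Im_add; rewrite RintegralD.
Qed.

Lemma integrable_scale m D (c : R) (h : R -> R) : measurable D ->
  m.-integrable D (EFin \o h) -> m.-integrable D (EFin \o (fun s => c * h s)).
Proof. by move=> mD ih; have := integrableZl mD c ih; apply: eq_integrable. Qed.

Lemma cintZ m D f (k : C) : measurable D -> cintegrable m D f ->
  cint m D (fun s => k * f s) = k * cint m D f.
Proof.
move=> mD [f1 f2].
apply: complex_ext; rewrite ?Re_mul ?Im_mul /=.
  under eq_Rintegral do rewrite Re_mul.
  rewrite RintegralB ?RintegralZl//.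
  - exact: integrable_scale.
  - exact: integrable_scale.
under eq_Rintegral do rewrite Im_mul.
rewrite RintegralD ?RintegralZl//.
- exact: integrable_scale.
- exact: integrable_scale.
Qed.

Lemma n1_cint_le m D f (g : R -> R) : measurable D -> cintegrable m D f ->
  m.-integrable D (EFin \o g) -> (forall s, D s -> n1 (f s) <= g s) ->
  n1 (cint m D f) <= \int[m]_(s in D) g s.
Proof.
move=> mD fi ig fg; have [f1 f2] := fi.
apply: (@le_trans _ _ (\int[m]_(s in D) n1 (f s))).
  rewrite /n1 /= RintegralD//; try exact: integrable_norm.
  by apply: lerD; exact: le_normr_Rintegral.
by apply: le_Rintegral => //; exact: cintegrable_n1.
Qed.

Lemma cint_set0 m f : cint m set0 f = 0.
Proof. by rewrite /cint !Rintegral_set0. Qed.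

Lemma cint_cat m x y z f : x <= y -> y <= z -> cintegrable m `[x, z[ f ->
  cint m `[x, z[ f = cint m `[x, y[ f + cint m `[y, z[ f.
Proof.
move=> xy yz [f1 f2].
have E : `[x, z[%classic = `[x, y[%classic `|` `[y, z[%classic.
  apply/seteqP; split=> s /=; rewrite !in_itv /=.
    by move=> /andP[xs sz]; case: (ltP s y) => h; [left|right]; apply/andP.
  case=> /andP[h1 h2]; apply/andP; split => //.
    exact: lt_le_trans h2 yz.
  exact: le_trans xy h1.
have dj : [disjoint `[x, y[%classic & `[y, z[%classic].
  apply/disj_setPS => s [] /=; rewrite !in_itv /= => /andP[_ sy] /andP[ys _].
  by move: (lt_le_trans sy ys); rewrite ltxx.
rewrite /cint E in f1 f2 *.
by rewrite !Rintegral_setU.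
Qed.

End complex_integrals.

(** * Oriented integrals *)

Section oriented_integrals.
Context (R : realType).
Notation C := R[i].
Notation T := (measurableTypeR R).
Implicit Types (m : {measure set T -> \bar R}) (x y z s t c : R) (f g u w v : R -> C).

Lemma orientedN (J : R -> R -> C) x y : oriented J y x = - oriented J x y.
Proof. by rewrite /oriented; case: ltgtP => //= _; rewrite ?opprK ?oppr0. Qed.

(** Reduces additivity of an oriented integral, for which the endpoints come
    in six orders, to the case of increasing endpoints. *)
Lemma chasles_of_ordered (F : R -> R -> C) :
  (forall x y, F y x = - F x y) ->
  (forall x y z, x <= y -> y <= z -> F x z = F x y + F y z) ->
  forall x y z, F x z = F x y + F y z.
Proof.
move=> FN Fc x y z.
case: (leP x y) => [xy|/ltW yx]; case: (leP y z) => [yz|/ltW zy].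
- exact: Fc.
- case: (leP x z) => [xz|/ltW zx].
    by rewrite (FN z y) (Fc x z y)//; ring.
  by rewrite (FN z x) (FN z y) (Fc z x y)//; ring.
- case: (leP x z) => [xz|/ltW zx].
    by rewrite (FN y x) (Fc y x z)//; ring.
  by rewrite (FN z x) (FN y x) (Fc y z x)//; ring.
- by rewrite (FN z x) (FN y x) (FN z y) (Fc z y x)//; ring.
Qed.

Lemma mintE m x y f : x <= y -> mint m x y f = cint m `[x, y[ f.
Proof.
rewrite le_eqVlt /mint /oriented => /predU1P[->|->//].
by rewrite ltxx set_itvco0 cint_set0.
Qed.

Lemma mint_sym m x y f : mint m y x f = - mint m x y f.
Proof. exact: orientedN. Qed.

(** The requirement on densities with respect to a measure, in contrast to that
    on integrands below. *)
Definition lint m f := forall x y, cintegrable m `[x, y[ f.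

(** Local boundedness and measurability, the requirement on integrands under
    which integrals against locally finite, possibly signed, measures exist. *)
Definition bml f := forall x y, cmeasurable `[x, y] f /\
  exists K, forall s, x <= s <= y -> n1 (f s) <= K.

Lemma bmlD f g : bml f -> bml g -> bml (fun s => f s + g s).
Proof.
move=> bf bg x y; have [mf [K fK]] := bf x y; have [mg [L gL]] := bg x y.
split; first exact: cmeasurableD.
by exists (K + L) => s h; rewrite (le_trans (n1D _ _))// lerD// ?fK ?gL.
Qed.

Lemma bmlM f g : bml f -> bml g -> bml (fun s => f s * g s).
Proof.
move=> bf bg x y; have [mf [K fK]] := bf x y; have [mg [L gL]] := bg x y.
split; first exact: cmeasurableM.
exists (K * L) => s h; rewrite (le_trans (n1M _ _))//.
by rewrite ler_pM ?n1_ge0 ?fK ?gL.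
Qed.

Lemma bml_cst (k : C) : bml (fun=> k).
Proof. by move=> x y; split; [exact: cmeasurable_cst|exists (n1 k)]. Qed.

Lemma bmlN f : bml f -> bml (fun s => - f s).
Proof.
move=> bf; have := bmlM (bml_cst (- 1)) bf.
by under eq_fun do rewrite mulN1r.
Qed.

Lemma bmlZ (k : C) f : bml f -> bml (fun s => k * f s).
Proof. exact/bmlM/bml_cst. Qed.

Lemma bmlB f g : bml f -> bml g -> bml (fun s => f s - g s).
Proof. by move=> bf bg; apply: bmlD => //; exact: bmlN. Qed.

Lemma eq_bml f g : (forall s, f s = g s) -> bml f -> bml g.
Proof. by move=> fg; have -> : f = g by apply/funext. Qed.

Lemma bml_lintM m w f : lint m w -> bml f -> lint m (fun s => w s * f s).
Proof.
move=> iw bf x y; have [mf [K fK]] := bf x y.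
have sub := @subset_itvco_cc R x y.
apply: (@cintegrableM _ _ _ _ _ K) => //; first exact: cmeasurableS sub mf.
by move=> s /sub /=; rewrite in_itv /=; exact: fK.
Qed.

Lemma bml_lint m f : locally_finite m -> bml f -> lint m f.
Proof.
move=> lf bf x y; have [mf [K fK]] := bf x y.
have sub := @subset_itvco_cc R x y.
apply: (@cintegrable_bounded _ _ _ _ K) => //; first exact: cmeasurableS sub mf.
by move=> s /sub /=; rewrite in_itv /=; exact: fK.
Qed.

Lemma lintD m f g : lint m f -> lint m g -> lint m (fun s => f s + g s).
Proof. by move=> lf lg x y; exact: cintegrableD. Qed.

Lemma lintZ m (k : C) f : lint m f -> lint m (fun s => k * f s).
Proof. by move=> lf x y; exact: cintegrableZ. Qed.

Lemma eq_mint m x y f g : x <= y -> (forall s, x <= s < y -> f s = g s) ->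
  mint m x y f = mint m x y g.
Proof.
move=> xy fg; rewrite !mintE//; apply: eq_cint => s; rewrite itvcoE; exact: fg.
Qed.

Lemma mint_chasles m f : lint m f ->
  forall x y z, mint m x z f = mint m x y f + mint m y z f.
Proof.
move=> lf; apply: chasles_of_ordered => [x y|x y z xy yz].
  exact: mint_sym.
by rewrite !mintE// ?(le_trans xy)//; exact: cint_cat.
Qed.

Lemma mintD m x y f g : lint m f -> lint m g ->
  mint m x y (fun s => f s + g s) = mint m x y f + mint m x y g.
Proof.
move=> lf lg; wlog xy : x y / x <= y => [h|].
  case: (leP x y) => [/h//|/ltW/h E].
  by rewrite !(mint_sym _ y x) E opprD.
by rewrite !mintE//; exact: cintD.
Qed.

Lemma mintZ m x y (k : C) f : lint m f ->
  mint m x y (fun s => k * f s) = k * mint m x y f.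
Proof.
move=> lf; wlog xy : x y / x <= y => [h|].
  case: (leP x y) => [/h//|/ltW/h E].
  by rewrite !(mint_sym _ y x) E mulrN.
by rewrite !mintE//; exact: cintZ.
Qed.

Lemma Rintegral_subitv m (x y a b : R) (g : R -> R) :
  a <= x -> y <= b -> m.-integrable `[a, b[ (EFin \o g) ->
  (forall s, 0 <= g s) ->
  \int[m]_(s in `[x, y[) g s <= \int[m]_(s in `[a, b[) g s.
Proof.
move=> ax yb ig g0.
have sub : `[x, y[%classic `<=` `[a, b[%classic.
  move=> s /=; rewrite !in_itv /= => /andP[xs sy].
  by rewrite (le_trans ax xs) (lt_le_trans sy yb).
rewrite /Rintegral fine_le//.
- by apply: integrable_fin_num => //; apply: integrableS ig.
- exact: integrable_fin_num.
- apply: ge0_subset_integral => //; first exact: measurable_int ig.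
  by move=> s _; rewrite lee_fin.
Qed.

Lemma n1_mint_le m x y a b f : a <= x -> x <= y -> y <= b -> lint m f ->
  n1 (mint m x y f) <= \int[m]_(s in `[a, b[) n1 (f s).
Proof.
move=> ax xy yb lf; rewrite mintE//.
apply: (@le_trans _ _ (\int[m]_(s in `[x, y[) n1 (f s))).
  by apply: n1_cint_le => //; exact: cintegrable_n1.
apply: Rintegral_subitv => //; last by move=> s; exact: n1_ge0.
exact: cintegrable_n1.
Qed.

Lemma n1_mint_bounded m f : lint m f -> forall c x y, exists K,
  forall t, x <= t <= y -> n1 (mint m c t f) <= K.
Proof.
move=> lf c x y.
exists (\int[m]_(s in `[Num.min c x, Num.max c y[) n1 (f s)) => t /andP[xt ty].
case: (leP c t) => [ct|/ltW tc].
  by apply: n1_mint_le => //; rewrite ?ge_min ?le_max ?lexx ?ty ?orbT.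
rewrite mint_sym n1N.
by apply: n1_mint_le => //; rewrite ?ge_min ?le_max ?lexx ?xt ?orbT.
Qed.

(** For a nonnegative integrand the integral is a monotone function of its
    endpoint; in general the integrand is a difference of two such ones. *)
Lemma measurable_mint_Re m f c : lint m f ->
  measurable_fun setT (fun t : T => complex.Re (mint m c t f)).
Proof.
have ge0_case g : lint m g -> (forall s, 0 <= complex.Re (g s)) ->
    measurable_fun setT (fun t : T => complex.Re (mint m c t g)).
  move=> lg g0; apply: nondecreasing_measurable => // s t st.
  rewrite (mint_chasles lg c s t) Re_add lerDl mintE//=.
  exact: Rintegral_ge0.
move=> lf.
(* [f + h] and [h] have nonnegative real parts *)
pose h s : C := (n1 (f s))%:C.
have lh : lint m h.
  by move=> x y; split; [exact: cintegrable_n1|exact: integrable0].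
have lfh : lint m (fun s => f s + h s) by exact: lintD.
have -> : (fun t : T => complex.Re (mint m c t f)) = (fun t =>
    complex.Re (mint m c t (fun s => f s + h s)) - complex.Re (mint m c t h)).
  by apply/funext => t; rewrite mintD// Re_add addrK.
apply: measurable_funB; apply: ge0_case => // s.
  rewrite Re_add /= /n1 addrA addr_ge0// -lerBlDl sub0r.
  by rewrite -normrN ler_norm.
exact: n1_ge0.
Qed.

Lemma bml_mint m f c : lint m f -> bml (fun t => mint m c t f).
Proof.
move=> lf x y; split; last exact: n1_mint_bounded.
split; first by apply: measurable_funTS; exact: measurable_mint_Re.
have -> : (fun s : T => complex.Im (mint m c s f)) =
    (fun s => complex.Re (mint m c s (fun s => - 'i * f s))).
  by apply/funext => s; rewrite mintZ// Re_mul /=; ring.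
by apply: measurable_funTS; apply: measurable_mint_Re; exact: lintZ.
Qed.

(** The intervals [[t, x)] decrease to the empty set as [t] tends to [x] from
    the left, so dominated convergence applies; an atom at [x] does no harm
    because [x] is excluded.  This is why distribution functions of measures are
    left-continuous here. *)
Lemma mint_left_cont m f x (e : R) : lint m f -> 0 < e ->
  exists2 t0, t0 < x & forall t, t0 < t -> t < x -> n1 (mint m t x f) < e.
Proof.
move=> lf e0.
pose D := `[x - 1, x[%classic : set R.
have mD : measurable (D : set T) by exact: measurable_itv.
pose g (s : R) : R := n1 (f s).
pose g_ (n : nat) (s : T) : \bar R := (g s * (x - n.+1%:R^-1 <= s)%R%:R)%:E.
have ig : m.-integrable D (EFin \o g).
  by apply: (@cintegrable_n1 _ m D f); [exact: measurable_itv|exact: lf].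
have mg : measurable_fun D (g : T -> R).
  by apply/measurable_EFinP; exact: measurable_int ig.
have gE n : (\int[m]_(s in D) g_ n s)%E =
    (\int[m]_(s in `[x - n.+1%:R^-1, x[) g s)%:E.
  have sub : `[x - n.+1%:R^-1, x[%classic `<=` D.
    move=> s; rewrite /D /= !in_itv /= => /andP[h ->]; rewrite andbT.
    by rewrite (le_trans _ h)// lerD2l lerN2 invf_le1// ler1n.
  rewrite /Rintegral fineK; last first.
    apply: integrable_fin_num; first exact: measurable_itv.
    by apply: (integrableS mD _ sub ig); exact: measurable_itv.
  rewrite -[in RHS](setIidr sub) integral_mkcondr; apply: eq_integral => s.
  move=> /set_mem; rewrite /D /= in_itv /= => /andP[_ sx].
  rewrite /patch; case: ifPn => [/set_mem /=|/negP h].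
    by rewrite in_itv /= sx andbT /g_ => ->; rewrite mulr1.
  rewrite /g_; case: (boolP (x - n.+1%:R^-1 <= s)) => [h'|_]; last by rewrite mulr0.
  by exfalso; apply: h; rewrite inE /= in_itv /= h'.
have := @dominated_convergence _ _ _ m D _ g_ (cst 0%E) (EFin \o g).
case => //.
- move=> n; apply/measurable_EFinP; apply: measurable_funM => //.
  have -> : (fun s : T => (x - n.+1%:R^-1 <= s)%R%:R : R) =
      \1_(`[x - n.+1%:R^-1, +oo[%classic).
    apply/funext => s; rewrite indicE; congr (_ %:R); congr nat_of_bool.
    by apply/idP/idP; rewrite inE /= in_itv /= andbT.
  by apply: measurable_funTS; exact: measurable_indic.
- apply: aeW => s; rewrite /D /= in_itv /= => /andP[_ sx].
  apply: cvg_near_cst; have xs0 : 0 < x - s by rewrite subr_gt0.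
  near=> n; rewrite /g_ (_ : _ <= _ = false) ?mulr0//.
  apply/negbTE; rewrite -ltNge ltrBrDl -ltrBrDr.
  by near: n; exact: near_infty_natSinv_lt (PosNum xs0).
- apply: aeW => s n Ds; rewrite /g_ lee_fin /= /g normrM.
  rewrite ger0_norm ?n1_ge0// ler_piMr ?n1_ge0//.
  by case: (x - n.+1%:R^-1 <= s)%R; rewrite ?normr1 ?normr0.
move=> _ _; rewrite integral0.
move=> /fine_cvgP[_] /cvgrPdist_lt /(_ e e0) [n _ /(_ n (leqnn n))] /=.
rewrite gE /= sub0r normrN ger0_norm; last first.
  by apply: Rintegral_ge0 => s _; exact: n1_ge0.
move=> h; exists (x - n.+1%:R^-1).
  by rewrite ltrBlDr ltrDl.
move=> t t0t tx; apply: le_lt_trans h.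
by apply: n1_mint_le => //; exact: ltW.
Unshelve. all: by end_near. Qed.

Lemma leb_locally_finite : locally_finite (@leb R).
Proof.
move=> x y; rewrite /leb /= lebesgue_measure_itv /=.
by case: ifP => // _; rewrite -EFinB ltry.
Qed.

Lemma mint_triangle m x y u v : locally_finite m -> lint m u -> lint (@leb R) v ->
  x <= y ->
  mint m x y (fun s => u s * mint (@leb R) x s v) =
  mint (@leb R) x y (fun t => v t * mint m t y u).
Proof.
move=> lm lu lv xy; rewrite !mintE//.
have bI : bml (fun s => mint (@leb R) x s v) by exact: bml_mint.
have bJ : bml (fun t => mint m t y u).
  by under eq_fun do rewrite mint_sym; apply: bmlN; exact: bml_mint.
have sub := @subset_itvco_cc R x y.
have [u1 u2] := lu x y; have [v1 v2] := lv x y.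
have P (n : {measure set T -> \bar R}) (g : R -> R) (h : R -> C) : bml h -> n.-integrable `[x, y[ (EFin \o g) ->
    n.-integrable `[x, y[ (EFin \o (fun s => g s * complex.Re (h s))) /\
    n.-integrable `[x, y[ (EFin \o (fun s => g s * complex.Im (h s))).
  move=> bh ig; have [[h1 h2] [K hK]] := bh x y; split.
    apply: (@integrableM_bounded _ _ _ _ _ K) => //; first exact: measurable_funS sub _.
    move=> s /sub /=; rewrite in_itv /= => /hK; apply: le_trans; exact: n1_Re.
  apply: (@integrableM_bounded _ _ _ _ _ K) => //; first exact: measurable_funS sub _.
  move=> s /sub /=; rewrite in_itv /= => /hK; apply: le_trans; exact: n1_Im.
have [a1 a2] := P _ _ _ bI u1; have [a3 a4] := P _ _ _ bI u2.
have [b1 b2] := P _ _ _ bJ v1; have [b3 b4] := P _ _ _ bJ v2.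
have tri (g h : R -> R) (G H : R -> R) : m.-integrable `[x, y[ (EFin \o g) ->
    (@leb R).-integrable `[x, y[ (EFin \o h) ->
    (forall s, x <= s < y -> H s = \int[@leb R]_(t in `[x, s[) h t) ->
    (forall t, x <= t < y -> G t = \int[m]_(s in `[t, y[) g s) ->
    \int[m]_(s in `[x, y[) (g s * H s) = \int[@leb R]_(t in `[x, y[) (h t * G t).
  move=> ig ih HE GE.
  rewrite (@eq_Rintegral _ _ _ m _ (fun s => g s * \int[@leb R]_(t in `[x, s[) h t)); last first.
    by move=> s /set_mem; rewrite itvcoE => /HE ->.
  rewrite integral_triangle//; apply: eq_Rintegral => t /set_mem.
  by rewrite itvcoE => /GE ->.
have I1 s : x <= s < y -> complex.Re (mint (@leb R) x s v) =
    \int[@leb R]_(t in `[x, s[) complex.Re (v t).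
  by move=> /andP[xs _]; rewrite mintE.
have I2 s : x <= s < y -> complex.Im (mint (@leb R) x s v) =
    \int[@leb R]_(t in `[x, s[) complex.Im (v t).
  by move=> /andP[xs _]; rewrite mintE.
have J1 t : x <= t < y -> complex.Re (mint m t y u) =
    \int[m]_(s in `[t, y[) complex.Re (u s).
  by move=> /andP[_ /ltW ty]; rewrite mintE.
have J2 t : x <= t < y -> complex.Im (mint m t y u) =
    \int[m]_(s in `[t, y[) complex.Im (u s).
  by move=> /andP[_ /ltW ty]; rewrite mintE.
apply: complex_ext => /=.
  under eq_Rintegral do rewrite Re_mul.
  under [RHS]eq_Rintegral do rewrite Re_mul.
  rewrite !RintegralB//.
  rewrite (tri _ _ _ _ u1 v1 I1 J1) (tri _ _ _ _ u2 v2 I2 J2).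
  by [].
under eq_Rintegral do rewrite Im_mul.
under [RHS]eq_Rintegral do rewrite Im_mul.
rewrite !RintegralD//.
by rewrite (tri _ _ _ _ u1 v2 I2 J1) (tri _ _ _ _ u2 v1 I1 J2) addrC.
Qed.

End oriented_integrals.

(** * Families of oriented integrals *)

Section measure_families.
Context (R : realType).
Notation C := R[i].
Notation T := (measurableTypeR R).
Notation leb := (@leb R).
Implicit Types (m : {measure set T -> \bar R}) (x y z s t c : R) (f g u w v : R -> C)
  (N : R -> R -> (R -> C) -> C).

Lemma common_itv x y : exists a b, [/\ a < b, a <= x <= b & a <= y <= b].
Proof.
case: (leP x y) => h; first by exists (x - 1), (y + 1); split; lra.
by exists (y - 1), (x + 1); split; lra.
Qed.

(** The theory of the differential equation uses integrals against [omega],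
    against [upsilon], against the Lebesgue measure and against combinations of
    these with densities.  Since [omega] is no measure on the whole line, all of
    them are treated alike as families [N x y f] of oriented integrals of [f]
    from [x] to [y], of which only the following properties matter;
    [mf_triangle] is Fubini's theorem and is what gives integration by parts. *)
Record mfam N : Prop := MFam {
  mf_sym : forall x y f, N y x f = - N x y f;
  mf_ordered : forall x y z f, x <= y -> y <= z -> bml f ->
    N x z f = N x y f + N y z f;
  mf_linear : forall x y f g k, bml f -> bml g ->
    N x y (fun s => k * f s + g s) = k * N x y f + N x y g;
  mf_ext : forall x y f g, x <= y -> (forall s, x <= s < y -> f s = g s) ->
    N x y f = N x y g;
  mf_bound : forall a b, exists2 M, 0 <= M &
    forall x y f K, a <= x -> x <= y -> y <= b -> bml f -> 0 <= K ->
      (forall s, x <= s < y -> n1 (f s) <= K) -> n1 (N x y f) <= M * K;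
  mf_left_cont : forall f x (e : R), bml f -> 0 < e ->
    exists2 t0, t0 < x & forall t, t0 < t -> t < x -> n1 (N t x f) < e;
  mf_bml : forall f c, bml f -> bml (fun t => N c t f);
  mf_triangle : forall x y f v, x <= y -> bml f -> lint leb v ->
    N x y (fun s => f s * mint leb x s v) =
    mint leb x y (fun t => v t * N t y f) }.

Lemma mf_chasles N f : mfam N -> bml f ->
  forall x y z, N x z f = N x y f + N y z f.
Proof.
move=> mN bf; apply: chasles_of_ordered => [x y|x y z xy yz].
  exact: mf_sym.
exact: mf_ordered.
Qed.

Lemma mf_refl N x f : mfam N -> N x x f = 0.
Proof.
move=> mN; have := mf_sym mN x x f; move/eqP.
by rewrite -addr_eq0 -mulr2n mulrn_eq0 /= => /eqP.
Qed.

Lemma mf0 N x y : mfam N -> N x y (fun=> 0) = 0.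
Proof.
move=> mN; have := mf_linear mN x y (-1) (bml_cst 0) (bml_cst 0).
by under eq_fun do rewrite mulr0 addr0; rewrite mulN1r addNr.
Qed.

Lemma mfZ N x y k f : mfam N -> bml f -> N x y (fun s => k * f s) = k * N x y f.
Proof.
move=> mN bf; have := mf_linear mN x y k bf (bml_cst 0).
by rewrite mf0// addr0; under eq_fun do rewrite addr0.
Qed.

Lemma mfD N x y f g : mfam N -> bml f -> bml g ->
  N x y (fun s => f s + g s) = N x y f + N x y g.
Proof.
move=> mN bf bg; have := mf_linear mN x y 1 bf bg.
by under eq_fun do rewrite mul1r; rewrite mul1r.
Qed.

Lemma mfN N x y f : mfam N -> bml f -> N x y (fun s => - f s) = - N x y f.
Proof.
move=> mN bf; have := mfZ x y (-1) mN bf.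
by under eq_fun do rewrite mulN1r; rewrite mulN1r.
Qed.

Lemma mfB N x y f g : mfam N -> bml f -> bml g ->
  N x y (fun s => f s - g s) = N x y f - N x y g.
Proof. by move=> mN bf bg; rewrite mfD ?mfN//; exact: bmlN. Qed.

Lemma mfam_mint m w : locally_finite m -> lint m w ->
  mfam (fun x y f => mint m x y (fun s => w s * f s)).
Proof.
move=> lm lw; split.
- by move=> x y f; exact: mint_sym.
- by move=> x y z f _ _ bf; apply: mint_chasles; exact: bml_lintM.
- move=> x y f g k bf bg.
  rewrite -mintZ; last exact: bml_lintM.
  rewrite -mintD; [|by apply: lintZ; exact: bml_lintM|exact: bml_lintM].
  by congr mint; apply/funext => s; rewrite mulrDr mulrCA.
- by move=> x y f g xy fg; apply: eq_mint => // s /fg ->.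
- move=> a b; exists (\int[m]_(s in `[a, b[) n1 (w s)).
    by apply: Rintegral_ge0 => s _; exact: n1_ge0.
  move=> x y f K ax xy yb bf K0 fK; rewrite mintE//.
  have iw : m.-integrable `[x, y[ (EFin \o (fun s => n1 (w s))).
    by apply: cintegrable_n1 => //; exact: lw.
  apply: (@le_trans _ _ (\int[m]_(s in `[x, y[) (n1 (w s) * K))).
    apply: n1_cint_le => //.
    - exact: bml_lintM.
    - exact: (@integrableM_bounded _ _ _ _ (cst K) `|K|).
    - move=> s; rewrite itvcoE => /fK h.
      by rewrite (le_trans (n1M _ _))// ler_wpM2l ?n1_ge0.
  rewrite RintegralZr// ler_wpM2r//.
  apply: Rintegral_subitv => //; last by move=> s; exact: n1_ge0.
  by apply: cintegrable_n1 => //; exact: lw.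
- by move=> f x e bf e0; apply: mint_left_cont => //; exact: bml_lintM.
- by move=> f c bf; apply: bml_mint; exact: bml_lintM.
- move=> x y f v xy bf lv.
  rewrite -mint_triangle//; last exact: bml_lintM.
  by congr mint; apply/funext => s; rewrite mulrA.
Qed.

Lemma mfam_mint1 m : locally_finite m -> mfam (mint m).
Proof.
move=> lm; have := mfam_mint lm (bml_lint lm (bml_cst 1)).
congr mfam; apply/funext => x; apply/funext => y; apply/funext => f.
by congr mint; apply/funext => s; rewrite mul1r.
Qed.

Lemma lintM_mf N v f c : mfam N -> lint leb v -> bml f ->
  lint leb (fun t => v t * N t c f).
Proof.
move=> mN lv bf; apply: bml_lintM => //.
apply: (@eq_bml _ (fun t => - N c t f)); first by move=> s; rewrite (mf_sym mN c s).
by apply: bmlN; exact: mf_bml.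
Qed.

Lemma mfam_lin N1 N2 k : mfam N1 -> mfam N2 ->
  mfam (fun x y f => k * N1 x y f + N2 x y f).
Proof.
move=> m1 m2; split.
- by move=> x y f; rewrite (mf_sym m1) (mf_sym m2); ring.
- by move=> x y z f xy yz bf; rewrite (mf_ordered m1 xy yz)// (mf_ordered m2 xy yz)//; ring.
- by move=> x y f g c bf bg; rewrite (mf_linear m1)// (mf_linear m2)//; ring.
- by move=> x y f g xy fg; rewrite (mf_ext m1 xy fg) (mf_ext m2 xy fg).
- move=> a b; have [M M0 h] := mf_bound m1 a b; have [M' M'0 h'] := mf_bound m2 a b.
  exists (n1 k * M + M'); first by rewrite addr_ge0// mulr_ge0// n1_ge0.
  move=> x y f K ax xy yb bf K0 fK; rewrite (le_trans (n1D _ _))// mulrDl lerD//.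
    by rewrite (le_trans (n1M _ _))// -mulrA ler_wpM2l ?n1_ge0// h.
  exact: h'.
- move=> f x e bf e0.
  have e1 : 0 < e / (2 * (n1 k + 1)) by rewrite divr_gt0// mulr_gt0// ltr_wpDl// n1_ge0.
  have [t1 h1 H1] := mf_left_cont m1 x bf e1.
  have [t2 h2 H2] := mf_left_cont m2 x bf (divr_gt0 e0 (ltr0Sn _ 1)).
  exists (Num.max t1 t2); first by rewrite gt_max h1.
  move=> t; rewrite gt_max => /andP[a1 a2] tx.
  rewrite (le_lt_trans (n1D _ _))// [ltRHS](splitr e) ler_ltD//; last exact: H2.
  rewrite (le_trans (n1M _ _))//.
  rewrite (@le_trans _ _ ((n1 k + 1) * (e / (2 * (n1 k + 1)))))//.
    by rewrite ler_pM ?n1_ge0 ?lerDl// ltW// H1.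
  have h : n1 k + 1 != 0 by rewrite gt_eqF// ltr_wpDl// n1_ge0.
  by rewrite le_eqVlt; apply/orP; left; apply/eqP; field.
- by move=> f c bf; apply: bmlD; [apply: bmlZ|]; exact: mf_bml.
- move=> x y f v xy bf lv; rewrite (mf_triangle m1)// (mf_triangle m2)//.
  rewrite -mintZ; last exact: lintM_mf.
  rewrite -mintD; [|by apply: lintZ; exact: lintM_mf|exact: lintM_mf].
  by congr mint; apply/funext => t; ring.
Qed.

Lemma mfam_mul N w : mfam N -> bml w -> mfam (fun x y f => N x y (fun s => w s * f s)).
Proof.
move=> mN bw; split.
- by move=> x y f; rewrite (mf_sym mN).
- by move=> x y z f xy yz bf; apply: (mf_ordered mN) => //; exact: bmlM.
- move=> x y f g k bf bg; rewrite -(mf_linear mN); try exact: bmlM.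
  by congr N; apply/funext => s; ring.
- by move=> x y f g xy fg; apply: (mf_ext mN xy) => s /fg ->.
- move=> a b; have [M M0 h] := mf_bound mN a b.
  have [_ [L wL]] := bw a b.
  exists (M * `|L|); first by rewrite mulr_ge0.
  move=> x y f K ax xy yb bf K0 fK; rewrite -mulrA; apply: h => //.
  + exact: bmlM.
  + by rewrite mulr_ge0.
  + move=> s /[dup] /fK h1 /andP[h2 /ltW h3].
    rewrite (le_trans (n1M _ _))// ler_pM ?n1_ge0//.
    by rewrite (le_trans _ (ler_norm _))// wL// (le_trans ax)//= (le_trans h3).
- by move=> f x e bf e0; apply: (mf_left_cont mN) => //; exact: bmlM.
- by move=> f c bf; apply: (mf_bml mN); exact: bmlM.
- move=> x y f v xy bf lv; rewrite -(mf_triangle mN xy _ lv); last exact: bmlM.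
  by congr N; apply/funext => s; rewrite mulrA.
Qed.

(** All properties of such a family concern bounded intervals, hence may be
    checked for families that agree with the given one there. *)
Lemma mfam_local N :
  (forall x y f, N y x f = - N x y f) ->
  (forall x y f g, x <= y -> (forall s, x <= s < y -> f s = g s) ->
    N x y f = N x y g) ->
  (forall a b, a < b -> exists2 N', mfam N' & forall x y f,
    a <= x <= b -> a <= y <= b -> bml f -> N x y f = N' x y f) ->
  mfam N.
Proof.
move=> sN eN lN; split => //.
- move=> x y z f xy yz bf.
  have [|N' mN' NN'] := lN (x - 1) (z + 1); first by lra.
  by rewrite !NN' ?(mf_ordered mN' xy yz)//; lra.
- move=> x y f g k bf bg.
  have [a [b [ab xab yab]]] := common_itv x y.
  have [N' mN' NN'] := lN _ _ ab.
  by rewrite !NN' ?(mf_linear mN')//; apply: bmlD => //; exact: bmlZ.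
- move=> a b; case: (leP b (a - 1)) => [ba|ab].
    exists 0 => // x y f K ax xy yb; exfalso; lra.
  have [|N' mN' NN'] := lN (a - 1) (b + 1); first by lra.
  have [M M0 h] := mf_bound mN' a b; exists M => // x y f K ax xy yb bf K0 fK.
  by rewrite NN'//; [exact: h|lra|lra].
- move=> f x e bf e0; have [|N' mN' NN'] := lN (x - 1) (x + 1); first by lra.
  have [t0 t0x h] := mf_left_cont mN' x bf e0.
  exists (Num.max t0 (x - 1)); first by rewrite gt_max t0x/=; lra.
  by move=> t; rewrite gt_max => /andP[h1 h2] tx; rewrite NN'//; [exact: h|lra|lra].
- move=> f c bf x y.
  case: (leP x y) => [xy|yx]; last first.
    rewrite set_itv_ge ?bnd_simp -?ltNge//; split.
      by split; exact: measurable_fun_set0.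
    by exists 0 => s; lra.
  have [a [b [ab xab cab]]] : exists a b, [/\ a < b, a <= x /\ y <= b & a <= c <= b].
    have [a [b [_ h1 h2]]] := common_itv x c; have [a' [b' [_ h3 h4]]] := common_itv y c.
    case: (leP a a') => ?; case: (leP b b') => ?;
      [exists (a - 1), b'|exists (a - 1), b|exists (a' - 1), b'|exists (a' - 1), b]; split; lra.
  have [N' mN' NN'] := lN _ _ ab.
  have [mf [K fK]] := mf_bml mN' c bf x y; split; last first.
    by exists K => s h; rewrite NN'//; [exact: fK|lra].
  apply: eq_cmeasurable mf => s /=; rewrite in_itv /= => h.
  by rewrite NN'//; lra.
- move=> x y f v xy bf lv.
  have [|N' mN' NN'] := lN (x - 1) (y + 1); first by lra.
  rewrite NN'//; [|lra|lra|apply: bmlM => //; exact: bml_mint].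
  rewrite (mf_triangle mN')//; apply: eq_mint => // t h.
  by rewrite NN'//; lra.
Qed.

End measure_families.

(** * Integrals against a signed measure *)

Section signed_integrals.
Context (R : realType).
Notation C := R[i].
Notation T := (measurableTypeR R).
Implicit Types (x y a b : R) (f : R -> C).

(** The value of the integral does not depend on how the charge is written as
    a difference of finite measures: if [p - n = m1 - m2], then integrals
    against [p + m2] and [m1 + n] agree. *)
Lemma charge_cint_diff (nu : {charge set T -> \bar R})
    (m1 m2 : {finite_measure set T -> \bar R}) (D : set T) f (K : R) :
  measurable D ->
  (forall E, measurable E -> E `<=` D -> (nu E = m1 E - m2 E)%E) ->
  cmeasurable D f -> (forall s, D s -> n1 (f s) <= K) ->
  charge_cint nu D f = cint m1 D f - cint m2 D f.
Proof.
move=> mD nuE mf fK; rewrite /charge_cint.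
suff diff (p n : {finite_measure set T -> \bar R}) :
    (forall E, measurable E -> (nu E = p E - n E)%E) ->
    cint p D f - cint n D f = cint m1 D f - cint m2 D f.
  apply: diff => E mE.
  by rewrite (jordan_decomp (projT2 (cid (projT2 (cid (Hahn_decomposition nu))))) mE)
     /cadd /= cscaleN1.
move=> pn.
have pnE (E : set T) : measurable E -> E `<=` D -> (p E + m2 E = m1 E + n E)%E.
  move=> mE ED; have := pn _ mE; rewrite (nuE _ mE ED).
  have h1 : m1 E \is a fin_num by exact: fin_num_measure.
  have h2 : m2 E \is a fin_num by exact: fin_num_measure.
  have h3 : p E \is a fin_num by exact: fin_num_measure.
  have h4 : n E \is a fin_num by exact: fin_num_measure.
  move: h1 h2 h3 h4.
  case: (m1 E) => // r1 _; case: (m2 E) => // r2 _; case: (p E) => // r3 _.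
  case: (n E) => // r4 _ /(congr1 (@fine R)) /= h.
  by rewrite -!EFinD; congr EFin; move: h; lra.
have fin (m : {finite_measure set T -> \bar R}) : (m D < +oo)%E.
  by rewrite ltey_eq fin_num_measure.
have real_case (g : R -> R) : measurable_fun D (g : T -> R) ->
    (forall s, D s -> `|g s| <= K) ->
    \int[p]_(s in D) g s - \int[n]_(s in D) g s =
    \int[m1]_(s in D) g s - \int[m2]_(s in D) g s.
  move=> mg gK.
  have ig (m : {finite_measure set T -> \bar R}) : m.-integrable D (EFin \o g).
    exact: (integrable_bounded mD (fin m) mg gK).
  apply/eqP; rewrite subr_eq addrAC eq_sym subr_eq; apply/eqP.
  rewrite /Rintegral -!fineD; try by apply: integrable_fin_num => //; exact: ig.
  congr fine.
  rewrite -!integral_measure_add//; try exact: ig.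
  - apply: eq_measure_integral => A mA AD.
    rewrite -[LHS]/(measure_add m1 n A) -[RHS]/(measure_add p m2 A) !measure_addE.
    by apply/esym; exact: pnE.
case: mf => f1 f2.
apply: complex_ext; rewrite !(Re_add, Im_add, Re_opp, Im_opp) /=; apply: real_case => //.
- by move=> s /fK; apply: le_trans; exact: n1_Re.
- by move=> s /fK; apply: le_trans; exact: n1_Im.
Qed.

Definition omega_pos (omega : signed_borel R) a b : {finite_measure set T -> \bar R} :=
  jordan_pos (projT2 (cid (projT2 (cid (Hahn_decomposition (sb_restr omega a b)))))).
Definition omega_neg (omega : signed_borel R) a b : {finite_measure set T -> \bar R} :=
  jordan_neg (projT2 (cid (projT2 (cid (Hahn_decomposition (sb_restr omega a b)))))).

(** On subintervals of [[a, b)] a single Jordan decomposition serves, namely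
    that of the restriction of [omega] to [[a, b)]. *)
Lemma sint_local (omega : signed_borel R) a b x y f :
  a <= x <= b -> a <= y <= b -> bml f ->
  sint omega x y f = mint (omega_pos omega a b) x y f - mint (omega_neg omega a b) x y f.
Proof.
wlog xy : x y / x <= y => [h|].
  case: (leP x y) => [/h//|/ltW/h E] xab yab bf.
  by rewrite /sint orientedN -/(sint omega y x f) E// !(mint_sym _ y x); ring.
move=> /andP[ax _] /andP[_ yb] bf.
move: xy; rewrite le_eqVlt => /predU1P[->|xy].
  by rewrite !mintE// set_itvco0 !cint_set0 subrr /sint /oriented ltxx.
rewrite !mintE ?(ltW xy)// /sint /oriented xy /sb_cint.
have sub := @subset_itvco_cc R x y.
have [mf [K fK]] := bf x y.
apply: (@charge_cint_diff _ _ _ _ _ K) => //.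
- move=> E mE ED.
  have Eab : E `<=` `[a, b[%classic.
    move=> s /ED; rewrite !itvcoE => /andP[xs sy].
    by rewrite (le_trans ax xs) (lt_le_trans sy yb).
  have := jordan_decomp
    (projT2 (cid (projT2 (cid (Hahn_decomposition (sb_restr omega a b)))))) mE.
  rewrite /cadd /= cscaleN1 => <-.
  by rewrite /sb_restr (setIidl ED) (setIidl Eab).
- exact: cmeasurableS sub mf.
- by move=> s /sub /=; rewrite in_itv /=; exact: fK.
Qed.

Lemma mfam_sint (omega : signed_borel R) : mfam (sint omega).
Proof.
apply: mfam_local.
- by move=> x y f; exact: orientedN.
- move=> x y f g; rewrite le_eqVlt => /predU1P[-> _|xy fg].
    by rewrite /sint /oriented ltxx.
  rewrite /sint /oriented xy /sb_cint /charge_cint.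
  by congr (_ - _); apply: eq_cint => s; rewrite itvcoE; exact: fg.
- move=> a b ab.
  have lf (m : {finite_measure set T -> \bar R}) : locally_finite m.
    by move=> x y; rewrite ltey_eq fin_num_measure.
  exists (fun x y f => - 1 * mint (omega_neg omega a b) x y f + mint (omega_pos omega a b) x y f).
    by apply: mfam_lin; exact: mfam_mint1.
  by move=> x y f xab yab bf; rewrite (sint_local omega xab yab bf) mulN1r addrC.
Qed.

End signed_integrals.

(** * Absolute continuity and integration by parts *)

Section absolute_continuity.
Context (R : realType).
Notation C := R[i].
Notation leb := (@leb R).
Implicit Types (x y z s t c : R) (f g u v p : R -> C) (N : R -> R -> (R -> C) -> C).

(** Local absolute continuity with a given derivative, in the form of the
    fundamental theorem of calculus for oriented integrals. *)
Definition lac u v := lint leb v /\ forall x y, u y - u x = mint leb x y v.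

Lemma lacE u v : lac u v <-> loc_abs_cont_with u v.
Proof.
split=> [[lv uv] a b ab|h]; first by split.
have lv : lint leb v.
  move=> x y; case: (ltP x y) => [/h[]//|yx].
  rewrite set_itv_ge; last by rewrite bnd_simp -leNgt.
  by split; exact: integrable_set0.
split => // x y; wlog xy : x y / x <= y => [hw|].
  case: (leP x y) => [/hw//|/ltW/hw E].
  by rewrite mint_sym -E opprB.
have [_] := h x (y + 1) ltac:(lra); apply => //; lra.
Qed.

Lemma lac_bml u v : lac u v -> bml u.
Proof.
move=> [lv uv]; apply: (@eq_bml _ (fun t => u 0 + mint leb 0 t v)).
  by move=> s; rewrite -uv addrC subrK.
by apply: bmlD; [exact: bml_cst|exact: bml_mint].
Qed.

Lemma lac_left_cont u v x (e : R) : lac u v -> 0 < e ->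
  exists2 t0, t0 < x & forall t, t0 < t -> t < x -> n1 (u x - u t) < e.
Proof.
move=> [lv uv] e0; have [t0 t0x h] := mint_left_cont x lv e0.
by exists t0 => // t a b; rewrite uv h.
Qed.

Lemma lac_int f c : lint leb f -> lac (fun x => mint leb c x f) f.
Proof. by move=> lf; split => // x y; rewrite (mint_chasles lf c x y) addrC addKr. Qed.

Lemma eq_lac u v f g : (forall x, u x = f x) -> (forall x, v x = g x) ->
  lac u v -> lac f g.
Proof. by move=> /funext -> /funext ->. Qed.

Lemma lac_cst (k : C) : lac (fun=> k) (fun=> 0).
Proof.
have l0 : lint leb (fun=> 0) by move=> x y; split; exact: integrable0.
split => // x y; have := mintZ x y 0 l0; rewrite mul0r.
by move=> ->; rewrite mul0r subrr.
Qed.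

Lemma lacD u v f g : lac u v -> lac f g ->
  lac (fun x => u x + f x) (fun x => v x + g x).
Proof.
move=> [lv uv] [lg fg]; split; first exact: lintD.
by move=> x y; rewrite mintD// -uv -fg; ring.
Qed.

Lemma lacZ k u v : lac u v -> lac (fun x => k * u x) (fun x => k * v x).
Proof.
move=> [lv uv]; split; first exact: lintZ.
by move=> x y; rewrite mintZ// -uv; ring.
Qed.

(** [p] is a distribution function of the measure described by [N]; the
    derivative of a solution is of this kind. *)
Definition dist_fun p N := forall x y, p y - p x = N x y (fun=> 1).

Lemma dist_fun_bml p N : mfam N -> dist_fun p N -> bml p.
Proof.
move=> mN pN; apply: (@eq_bml _ (fun t => p 0 + N 0 t (fun=> 1))).
  by move=> s; rewrite -pN addrC subrK.
by apply: bmlD; [exact: bml_cst|apply: mf_bml => //; exact: bml_cst].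
Qed.

(** Writing [u] as an integral of [v], this is Fubini's theorem for the product
    of [N] and the Lebesgue measure.  No term for jumps occurs since [u] is
    continuous. *)
Lemma integration_by_parts N u v p : mfam N -> lac u v -> dist_fun p N ->
  forall x y, mint leb x y (fun t => v t * p t) = u y * p y - u x * p x - N x y u.
Proof.
move=> mN uv pN x y; have bu := lac_bml uv; have bp := dist_fun_bml mN pN.
case: uv => lv uv; have b1 := @bml_cst R 1.
wlog xy : x y / x <= y => [h|].
  case: (leP x y) => [/h//|/ltW/h E].
  by rewrite mint_sym E (mf_sym mN y x); ring.
have := mf_triangle mN xy b1 lv.
rewrite (_ : (fun s => 1 * mint leb x s v) = (fun s => u s - u x * 1)); last first.
  by apply/funext => s; rewrite -uv; ring.
rewrite mfB//; last exact: bmlZ.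
rewrite mfZ// -pN.
rewrite (_ : (fun t => v t * N t y (fun=> 1)) = (fun t => p y * v t + (-1) * (v t * p t))); last first.
  by apply/funext => t; rewrite -pN; ring.
have lvp : lint leb (fun t => v t * p t) by exact: bml_lintM.
rewrite mintD; [|exact: lintZ|exact: lintZ].
rewrite !mintZ// -uv => E.
have -> : mint leb x y (fun t => v t * p t) =
   p y * (u y - u x) - (p y * (u y - u x) + -1 * mint leb x y (fun t => v t * p t)) by ring.
by rewrite -E; ring.
Qed.

(** Lagrange's identity, by integrating both [f * dg] and [g * df] by parts. *)
Lemma lagrange Nf Ng f df g dg : mfam Nf -> mfam Ng -> lac f df -> lac g dg ->
  dist_fun df Nf -> dist_fun dg Ng -> forall x y,
  (f y * dg y - df y * g y) - (f x * dg x - df x * g x) = Ng x y f - Nf x y g.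
Proof.
move=> mNf mNg fdf gdg dfN dgN x y.
have h1 := integration_by_parts mNg fdf dgN x y.
have h2 := integration_by_parts mNf gdg dfN x y.
have E : mint leb x y (fun t => df t * dg t) = mint leb x y (fun t => dg t * df t).
  by congr mint; apply/funext => t; rewrite mulrC.
move: h1; rewrite E h2 => h1.
have -> : Ng x y f = f y * dg y - f x * dg x - (f y * dg y - f x * dg x - Ng x y f) by ring.
by rewrite -h1; ring.
Qed.

End absolute_continuity.

(** * Hyperbolic functions and boundary value problems *)

Section hyperbolic.
Context (R : realType).
Notation C := R[i].
Notation leb := (@leb R).

Lemma lac_C1 (f f' : R -> R) : (forall x : R, is_derive x (1 : R) f (f' x)) ->
  continuous f' -> lac (fun x => (f x)%:C) (fun x => (f' x)%:C).
Proof.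
move=> df cf'.
have ic x y : leb.-integrable `[x, y] (EFin \o f').
  by apply: continuous_compact_integrable; [exact: segment_compact|exact: continuous_subspaceT].
have lf : lint leb (fun x => (f' x)%:C).
  move=> x y; split; last exact: integrable0.
  apply: integrableS (ic x y) => //.
  by move=> s /=; rewrite !in_itv /= => /andP[-> /ltW].
split => // x y; wlog xy : x y / x <= y => [h|].
  case: (leP x y) => [/h//|/ltW/h E].
  by rewrite mint_sym -E opprB.
move: xy; rewrite le_eqVlt => /predU1P[->|xy].
  by rewrite subrr mintE// set_itvco0 cint_set0.
rewrite mintE ?ltW//; apply: complex_ext => /=; last first.
  by rewrite subr0 /Rintegral integral0.
rewrite /leb (@Rintegral_itv_bndo_bndc _ _ _ f'); last exact: (lf x y).1.
rewrite /Rintegral (@continuous_FTC2 _ f' f)//.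
- exact: continuous_subspaceT.
- split.
  + by move=> z _; exact: ex_derive.
  + apply: cvg_at_right_filter; apply: differentiable_continuous.
    by apply/derivable1_diffP; exact: ex_derive.
  + apply: cvg_at_left_filter; apply: differentiable_continuous.
    by apply/derivable1_diffP; exact: ex_derive.
- by move=> z _; rewrite derive1E; exact: derive_val.
Qed.

Lemma lac_id : lac (fun x : R => x%:C) (fun=> 1).
Proof.
by apply: (@lac_C1 id (fun=> 1)) => x; exact: cvg_cst.
Qed.

Definition cosh (x : R) : R := (expR x + expR (- x)) / 2.

Definition sh (x : R) : C := (sinh (x / 2))%:C.
Definition ch (x : R) : C := (cosh (x / 2))%:C.

Lemma is_derive_expR_scale (k x : R) :
  is_derive x (1 : R) (fun x => expR (k * x)) (k * expR (k * x)).
Proof.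
have h : is_derive x (1 : R) (fun x => k * x) k.
  by apply: is_derive_eq; rewrite /GRing.scale /= mulr1.
have := @is_derive1_comp _ expR (fun x => k * x) x (expR (k * x)) k (is_derive_expR _) h.
by rewrite mulrC.
Qed.

Lemma sinh2E (x : R) : sinh (x / 2) = 2^-1 * (expR (2^-1 * x) - expR (- 2^-1 * x)).
Proof.
rewrite /sinh; have -> : - (x / 2) = - 2^-1 * x by ring.
have -> : x / 2 = 2^-1 * x by ring.
by rewrite mulrC.
Qed.

Lemma cosh2E (x : R) : cosh (x / 2) = 2^-1 * (expR (2^-1 * x) + expR (- 2^-1 * x)).
Proof.
rewrite /cosh; have -> : - (x / 2) = - 2^-1 * x by ring.
have -> : x / 2 = 2^-1 * x by ring.
by rewrite mulrC.
Qed.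

Lemma is_derive_sinh2 (x : R) :
  is_derive x (1 : R) (fun x => sinh (x / 2)) (2^-1 * cosh (x / 2)).
Proof.
under eq_fun do rewrite sinh2E; rewrite cosh2E.
have h1 := is_derive_expR_scale 2^-1 x; have h2 := is_derive_expR_scale (- 2^-1) x.
have h := is_deriveM (is_derive_cst (2^-1 : R) x (1 : R)) (is_deriveB h1 h2).
by apply: (is_derive_eq h); rewrite /GRing.scale /=; ring.
Qed.

Lemma is_derive_cosh2 (x : R) :
  is_derive x (1 : R) (fun x => cosh (x / 2)) (2^-1 * sinh (x / 2)).
Proof.
under eq_fun do rewrite cosh2E; rewrite sinh2E.
have h1 := is_derive_expR_scale 2^-1 x; have h2 := is_derive_expR_scale (- 2^-1) x.
have h := is_deriveM (is_derive_cst (2^-1 : R) x (1 : R)) (is_deriveD h1 h2).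
by apply: (is_derive_eq h); rewrite /GRing.scale /=; ring.
Qed.

Lemma lac_sh : lac sh (fun x => 2^-1 * ch x).
Proof.
have h x : 2^-1 * ch x = (2^-1 * cosh (x / 2))%:C by rewrite rmorphM /= fmorphV rmorph_nat.
under [X in lac _ X]eq_fun do rewrite h.
apply: lac_C1 => x; first exact: is_derive_sinh2.
apply: differentiable_continuous; apply/derivable1_diffP.
have h2 := is_derive_cosh2 x.
by apply: derivableM; [exact: derivable_cst|exact: ex_derive].
Qed.

Lemma lac_ch : lac ch (fun x => 2^-1 * sh x).
Proof.
have h x : 2^-1 * sh x = (2^-1 * sinh (x / 2))%:C by rewrite rmorphM /= fmorphV rmorph_nat.
under [X in lac _ X]eq_fun do rewrite h.
apply: lac_C1 => x; first exact: is_derive_cosh2.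
apply: differentiable_continuous; apply/derivable1_diffP.
have h2 := is_derive_sinh2 x.
by apply: derivableM; [exact: derivable_cst|exact: ex_derive].
Qed.

Lemma ch2sh2 (x : R) : ch x * ch x - sh x * sh x = 1.
Proof.
rewrite /ch /sh -!rmorphM -rmorphB /=; congr (_%:C).
rewrite cosh2E sinh2E.
have : expR (2^-1 * x) * expR (- 2^-1 * x) = 1 by rewrite -expRD mulNr subrr expR0.
set p := expR _; set q := expR _ => pq.
by transitivity (p * q); [field|].
Qed.

Lemma sinh_sub (x y : R) :
  sinh ((x - y) / 2) = sinh (x / 2) * cosh (y / 2) - cosh (x / 2) * sinh (y / 2).
Proof.
rewrite !sinh2E !cosh2E.
have -> : 2^-1 * (x - y) = 2^-1 * x + - 2^-1 * y by ring.
have -> : - 2^-1 * (x - y) = - 2^-1 * x + 2^-1 * y by ring.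
by rewrite !expRD; field.
Qed.

Lemma sinh_gt0 (x : R) : 0 < x -> 0 < sinh x.
Proof. by move=> x0; rewrite /sinh divr_gt0// subr_gt0 ltr_expR; lra. Qed.

Lemma sinh0 : sinh (0 : R) = 0.
Proof. by rewrite /sinh oppr0 subrr mul0r. Qed.

End hyperbolic.

Section boundary_value_problems.
Context (R : realType).
Notation C := R[i].
Notation leb := (@leb R).
Implicit Types (x y a b c : R) (f g u du v dv F dF : R -> C)
  (N Q : R -> R -> (R -> C) -> C).

(** Variation of constants for [F'' = F / 4 + N], where the homogeneous
    equation has the solutions [sh] and [ch].  The coefficient functions are
    distribution functions with densities [ch] and [sh] with respect to [N]. *)
Lemma variation_of_constants N c (al be : C) : mfam N ->
  exists F dF, [/\ lac F dF,
    forall x, dF x = ch x * (al + N c x (@ch R)) - sh x * (be + N c x (@sh R)),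
    forall x, F x = 2 * (sh x * (al + N c x (@ch R)) - ch x * (be + N c x (@sh R))) &
    forall x y, dF y - dF x = 4^-1 * mint leb x y F + N x y (fun=> 1)].
Proof.
move=> mN.
have bch := lac_bml (lac_ch R); have bsh := lac_bml (lac_sh R).
pose A x := al + N c x (@ch R); pose B x := be + N c x (@sh R).
pose NA x y f := N x y (fun s => ch s * f s).
pose NB x y f := N x y (fun s => sh s * f s).
have mA : mfam NA by exact: mfam_mul.
have mB : mfam NB by exact: mfam_mul.
have dA : dist_fun A NA.
  move=> x y; rewrite /A /NA (_ : (fun s => ch s * 1) = @ch R); last by apply/funext => s; rewrite mulr1.
  by rewrite (mf_chasles mN bch c x y); ring.
have dB : dist_fun B NB.
  move=> x y; rewrite /B /NB (_ : (fun s => sh s * 1) = @sh R); last by apply/funext => s; rewrite mulr1.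
  by rewrite (mf_chasles mN bsh c x y); ring.
have bA := dist_fun_bml mA dA; have bB := dist_fun_bml mB dB.
have lleb f : bml f -> lint leb f by apply: bml_lint; exact: leb_locally_finite.
pose F x := 2 * (sh x * A x - ch x * B x); pose dF x := ch x * A x - sh x * B x.
have two : (2 : C) != 0 by rewrite pnatr_eq0.
have u1 : lac (fun x => 2 * sh x) (@ch R).
  have := lacZ 2 (lac_sh R).
  by under [X in lac _ X]eq_fun do rewrite mulrA mulfV// mul1r.
have u2 : lac (fun x => 2 * ch x) (@sh R).
  have := lacZ 2 (lac_ch R).
  by under [X in lac _ X]eq_fun do rewrite mulrA mulfV// mul1r.
have l1 : lint leb (fun t => ch t * A t) by apply: lleb; exact: bmlM.
have l2 : lint leb (fun t => sh t * B t) by apply: lleb; exact: bmlM.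
have l3 : lint leb (fun t => sh t * A t) by apply: lleb; exact: bmlM.
have l4 : lint leb (fun t => ch t * B t) by apply: lleb; exact: bmlM.
have FdF : lac F dF.
  split; first by apply: lleb; apply: bmlB; exact: bmlM.
  move=> x y; rewrite /dF.
  rewrite (_ : (fun x => ch x * A x - sh x * B x) =
     (fun x => ch x * A x + (-1) * (sh x * B x))); last by apply/funext => s; ring.
  rewrite mintD//; last exact: lintZ.
  rewrite mintZ// (integration_by_parts mA u1 dA) (integration_by_parts mB u2 dB).
  have -> : NA x y (fun x => 2 * sh x) = NB x y (fun x => 2 * ch x).
    by congr N; apply/funext => s; ring.
  by rewrite /F; ring.
exists F, dF; split => //.
move=> x y.
have e1 := integration_by_parts mA (lac_ch R) dA x y.
have e2 := integration_by_parts mB (lac_sh R) dB x y.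
rewrite (_ : (fun t => 2^-1 * sh t * A t) = (fun t => 2^-1 * (sh t * A t))) in e1;
  last by apply/funext => s; ring.
rewrite (_ : (fun t => 2^-1 * ch t * B t) = (fun t => 2^-1 * (ch t * B t))) in e2;
  last by apply/funext => s; ring.
rewrite mintZ// in e1; rewrite mintZ// in e2.
have -> : mint leb x y F = 2 * (mint leb x y (fun t => sh t * A t) - mint leb x y (fun t => ch t * B t)).
  rewrite /F (_ : (fun x => 2 * (sh x * A x - ch x * B x)) =
     (fun x => 2 * (sh x * A x) + (- 2) * (ch x * B x))); last by apply/funext => s; ring.
  by rewrite mintD ?mintZ//; [ring|exact: lintZ|exact: lintZ].
have e3 : N x y (fun=> 1) = NA x y (@ch R) - NB x y (@sh R).
  rewrite /NA /NB -mfB//; [|exact: bmlM|exact: bmlM].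
  by congr N; apply/funext => s; rewrite ch2sh2.
have -> : 4^-1 * (2 * (mint leb x y (fun t => sh t * A t) - mint leb x y (fun t => ch t * B t))) =
   2^-1 * mint leb x y (fun t => sh t * A t) - 2^-1 * mint leb x y (fun t => ch t * B t) by field.
by rewrite e1 e2 e3 /dF; ring.
Qed.

(** The two free constants in [variation_of_constants] are determined by the
    boundary values because [sinh ((b - a) / 2)] is nonzero; they depend linearly
    on the data, which gives the bound on the derivative. *)
Lemma bvp_exists a b : a < b -> exists2 K : R, 0 <= K & forall N m, mfam N -> 0 <= m ->
  (forall x, a <= x <= b -> n1 (N a x (@ch R)) <= m /\ n1 (N a x (@sh R)) <= m) ->
  exists F dF, [/\ lac F dF, F a = 0, F b = 0,
    forall x y, dF y - dF x = 4^-1 * mint leb x y F + N x y (fun=> 1) &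
    forall x, a <= x <= b -> n1 (dF x) <= K * m].
Proof.
move=> ab.
pose k : C := sh b * ch a - ch b * sh a.
have k0 : k != 0.
  rewrite /k /sh /ch -!rmorphM -rmorphB /= -sinh_sub fmorph_eq0 gt_eqF// sinh_gt0//.
  by rewrite divr_gt0// subr_gt0.
have [_ [c1 ch1]] := lac_bml (lac_ch R) a b.
have [_ [c2 sh2]] := lac_bml (lac_sh R) a b.
pose c0 := `|c1| + `|c2|.
have chc x : a <= x <= b -> n1 (ch x) <= c0.
  by move=> /ch1 h; rewrite (le_trans h)// /c0 (le_trans (ler_norm _))// lerDl.
have shc x : a <= x <= b -> n1 (sh x) <= c0.
  by move=> /sh2 h; rewrite (le_trans h)// /c0 (le_trans (ler_norm _))// lerDr.
have c00 : 0 <= c0 by rewrite addr_ge0.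
pose g0 := (2 * c0 * n1 k^-1) * c0 + 1.
exists (2 * c0 * g0); first by rewrite !(mulr_ge0, addr_ge0)// n1_ge0.
move=> N m mN m0 Nm.
have aab : a <= a <= b by rewrite lexx ltW.
have bab : a <= b <= b by rewrite lexx ltW.
(* the coefficients [ga * ch a] and [ga * sh a] give [F a = 0]; [ga] is chosen for [F b = 0] *)
pose ga : C := - (sh b * N a b (@ch R) - ch b * N a b (@sh R)) * k^-1.
have gam : n1 ga <= (2 * c0 * n1 k^-1) * m.
  rewrite (le_trans (n1M _ _))// n1N mulrAC ler_wpM2r ?n1_ge0//.
  rewrite (le_trans (n1D _ _))// n1N -mulrA mulr_natl mulr2n lerD//.
    by rewrite (le_trans (n1M _ _))// ler_pM ?n1_ge0 ?shc//; have [] := Nm _ bab.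
  by rewrite (le_trans (n1M _ _))// ler_pM ?n1_ge0 ?chc//; have [] := Nm _ bab.
have [F [dF [FdF dFx FE dFE]]] := variation_of_constants a (ga * ch a) (ga * sh a) mN.
exists F, dF; split => //.
- by rewrite FE !mf_refl// !addr0; ring.
- by rewrite FE /ga; move: k0; rewrite /k => k0; field.
move=> x xab; rewrite dFx; have [N1 N2] := Nm _ xab.
have est w (z y : C) : n1 w <= c0 -> n1 z <= c0 -> n1 y <= m -> n1 (z * (ga * w + y)) <= c0 * g0 * m.
  move=> wc zc ym; rewrite (le_trans (n1M _ _))// -mulrA ler_pM ?n1_ge0//.
  rewrite (le_trans (n1D _ _))// /g0 mulrDl mul1r lerD// (le_trans (n1M _ _))//.
  by rewrite mulrAC ler_pM ?n1_ge0.
rewrite (le_trans (n1D _ _))// n1N -!mulrA mulr_natl mulr2n !mulrA lerD//.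
  by apply: est => //; exact: chc.
by apply: est => //; exact: shc.
Qed.

(** A linear equation whose second derivative [u''] is the measure [Q] with
    density [u]; the two instances are the equation with and without the
    coefficients [omega] and [upsilon]. *)
Definition solves Q u du := lac u du /\ forall x y, du y - du x = Q x y u.

Lemma solves_dist Q u du : solves Q u du ->
  dist_fun du (fun x y f => Q x y (fun s => u s * f s)).
Proof.
by move=> [_ h] x y; rewrite h; congr Q; apply/funext => s; rewrite mulr1.
Qed.

(** The right-hand side of Lagrange's identity vanishes for two solutions of
    the same equation. *)
Lemma wronskian_const Q u du v dv : mfam Q -> solves Q u du -> solves Q v dv ->
  forall x y, u x * dv x - du x * v x = u y * dv y - du y * v y.
Proof.
move=> mN su sv x y.
have bu := lac_bml su.1; have bv := lac_bml sv.1.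
have := lagrange (mfam_mul mN bu) (mfam_mul mN bv) su.1 sv.1
  (solves_dist su) (solves_dist sv) x y.
rewrite (_ : (fun s => v s * u s) = (fun s => u s * v s)); last first.
  by apply/funext => s; rewrite mulrC.
by rewrite subrr => /eqP; rewrite subr_eq0 => /eqP.
Qed.

(** Lagrange's identity for [F] and [u] on [[a, x]] and for [F] and [v] on
    [[x, b]] gives two linear equations for [F x] and [dF x]; eliminating [dF x]
    gives the Green kernel. *)
Lemma green_representation Q N a b u du v dv F dF : mfam Q -> mfam N ->
  solves Q u du -> solves Q v dv -> u a = 0 -> v b = 0 ->
  lac F dF -> (forall x y, dF y - dF x = Q x y F - N x y (fun=> 1)) ->
  F a = 0 -> F b = 0 ->
  forall x, F x * (v x * du x - dv x * u x) = v x * N a x u + u x * N x b v.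
Proof.
move=> mQ mN su sv ua vb FdF dFE Fa Fb x.
have bu := lac_bml su.1; have bv := lac_bml sv.1; have bF := lac_bml FdF.
pose NF x y f := (-1) * N x y f + Q x y (fun s => F s * f s).
have mNF : mfam NF by apply: mfam_lin => //; exact: mfam_mul.
have dFN : dist_fun dF NF.
  move=> s t; rewrite dFE /NF addrC mulN1r; congr (_ + _).
  by congr Q; apply/funext => r; rewrite mulr1.
have key w dw : solves Q w dw -> forall s t,
    (w t * dF t - dw t * F t) - (w s * dF s - dw s * F s) = - N s t w.
  move=> sw s t; have bw := lac_bml sw.1.
  rewrite (lagrange (mfam_mul mQ bw) mNF sw.1 FdF (solves_dist sw) dFN).
  rewrite /NF (_ : (fun r => F r * w r) = (fun r => w r * F r)); last first.
    by apply/funext => r; rewrite mulrC.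
  by ring.
have k1 := key _ _ su a x; have k2 := key _ _ sv x b.
rewrite ua Fa vb Fb in k1 k2.
have -> : N a x u = - (u x * dF x - du x * F x) by rewrite -[N a x u]opprK -k1; ring.
have -> : N x b v = v x * dF x - dv x * F x by rewrite -[N x b v]opprK -k2; ring.
by ring.
Qed.

End boundary_value_problems.

(** * Initial value problems *)

Section initial_value_problems.
Context (R : realType).
Notation C := R[i].
Notation leb := (@leb R).
Implicit Types (x y a b c s t : R) (f g u du : R -> C) (N Q : R -> R -> (R -> C) -> C).

Lemma dyadic_series (a_ : nat -> R) (K : R) : (forall n, `|a_ n| <= K / 2 ^+ n) ->
  exists l, forall n, `|l - \sum_(k < n) a_ k| <= 2 * K / 2 ^+ n.
Proof.
move=> aK.
pose S n := \sum_(k < n) a_ k.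
have K0 : 0 <= K by have := aK 0%N; rewrite expr0 divr1; exact: le_trans.
have Sd n p : `|S (n + p)%N - S n| <= 2 * K / 2 ^+ n - 2 * K / 2 ^+ (n + p).
  elim: p => [|p IH]; first by rewrite addn0 !subrr normr0.
  rewrite addnS /S big_ord_recr /= -/(S _) -addrA (addrC (a_ _)) addrA.
  rewrite (le_trans (ler_normD _ _))//.
  have h : 2 * K / 2 ^+ (n + p).+1 = K / 2 ^+ (n + p).
    by rewrite exprS; field; rewrite expf_neq0.
  rewrite h; have := aK (n + p)%N.
  have : 2 * K / 2 ^+ (n + p) = 2 * (K / 2 ^+ (n + p)) by rewrite mulrA.
  by move: IH; lra.
(* the lower ends of nested intervals around the limit *)
pose U : set R := [set x | exists n, x = S n - 2 * K / 2 ^+ n].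
have UB n : ubound U (S n + 2 * K / 2 ^+ n).
  move=> _ [m ->].
  have pos k : 0 <= 2 * K / 2 ^+ k by rewrite divr_ge0 ?mulr_ge0// exprn_ge0.
  case: (leqP m n) => [/subnKC mn|/ltnW /subnKC nm].
    have := Sd m (n - m)%N; rewrite mn ler_norml => /andP[h _].
    by have := pos n; have := pos m; move: h; lra.
  have := Sd n (m - n)%N; rewrite nm ler_norml => /andP[_ h].
  by have := pos n; have := pos m; move: h; lra.
exists (sup U) => n; rewrite ler_norml.
have h1 : S n - 2 * K / 2 ^+ n <= sup U.
  by apply: ub_le_sup; [exists (S 0%N + 2 * K / 2 ^+ 0); exact: UB|exists n].
have h2 : sup U <= S n + 2 * K / 2 ^+ n.
  by apply: ge_sup; [exists (S 0%N - 2 * K / 2 ^+ 0), 0%N|exact: UB].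
by rewrite -/(S n); move: h1 h2; lra.
Qed.

(** Picard iterates are compared at the dyadic rate at which they converge. *)
Lemma small_dyadic (z : R) (K : R) : (forall n, z <= K / 2 ^+ n) -> z <= 0.
Proof.
move=> h; rewrite leNgt; apply/negP => z0.
have K0 : 0 <= K by have := h 0%N; rewrite expr0 divr1; move: z0; lra.
have := archi_boundP (divr_ge0 K0 (ltW z0)); set n := Num.bound _ => nK.
have := h n; rewrite ler_pdivlMr ?exprn_gt0// mulrC -ler_pdivlMr// => h1.
have := lt_le_trans nK (_ : n%:R <= 2 ^+ n); rewrite -natrX ler_nat => /(_ (ltnW (ltn_expl _ _))).
by rewrite natrX ltNge h1 => /(_ isT).
Qed.

(** The operator whose fixed points, up to an affine function, are the
    solutions of the initial value problem at [c]. *)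
Definition volterra Q c u x := mint leb c x (fun t => Q c t u).

Lemma bml_sub x : bml (fun s => (x - s)%:C).
Proof.
have := bmlB (bml_cst x%:C) (lac_bml (@lac_id R)).
by apply: eq_bml => s; rewrite rmorphB.
Qed.

(** Interchanging the two integrations produces the kernel [x - s]. *)
Lemma volterraE Q c u x : mfam Q -> bml u ->
  volterra Q c u x = Q c x (fun s => (x - s)%:C * u s).
Proof.
move=> mQ bu.
have lid := @lac_id R.
have bid := lac_bml lid.
have mu := mfam_mul mQ bu.
have dQ : dist_fun (fun t => Q c t u) (fun x y f => Q x y (fun s => u s * f s)).
  move=> s t; rewrite (mf_chasles mQ bu c s t) addrC addKr.
  by congr Q; apply/funext => r; rewrite mulr1.
have := integration_by_parts mu lid dQ c x.
rewrite (_ : (fun t => 1 * Q c t u) = (fun t => Q c t u)); last first.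
  by apply/funext => t; rewrite mul1r.
rewrite -/(volterra Q c u x) => ->; rewrite mf_refl// mulr0 subr0.
rewrite -mfZ// -mfB//; [|exact: bmlZ|exact: bmlM].
by congr Q; apply/funext => s; rewrite rmorphB; ring.
Qed.

Lemma lac_volterra Q c u : mfam Q -> bml u -> lac (volterra Q c u) (fun t => Q c t u).
Proof.
move=> mQ bu; apply: lac_int; apply: bml_lint; first exact: leb_locally_finite.
exact: mf_bml.
Qed.

Lemma mul_expR_le (l d r K : R) : 0 < l -> 0 <= d -> 0 <= K ->
  d * (K * expR (l * r)) <= K / l * expR (l * (r + d)).
Proof.
move=> l0 d0 K0; rewrite mulrDr expRD.
have h : l * d <= expR (l * d) by rewrite (le_trans _ (expR_ge1Dx _))// lerDr.
have -> : d * (K * expR (l * r)) = (K / l * expR (l * r)) * (l * d).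
  by field; rewrite gt_eqF.
rewrite [leRHS]mulrA ler_wpM2l// mulr_ge0 ?expR_ge0// divr_ge0// ltW//.
Qed.

(** The kernel [x - s] makes the Volterra operator a contraction for the norm
    weighted by [expR (l * `|x - c|)], because [d * expR (- l * d) <= 1 / l].
    Gronwall's lemma would have to deal with the atoms of the measures, whereas
    here they are harmless since the kernel vanishes on the diagonal. *)
Lemma volterra_contraction Q c (r : R) : mfam Q -> exists2 l, 0 < l &
  forall u K, bml u -> 0 <= K ->
    (forall x, `|x - c| <= r -> n1 (u x) <= K * expR (l * `|x - c|)) ->
    forall x, `|x - c| <= r -> n1 (volterra Q c u x) <= K / 2 * expR (l * `|x - c|).
Proof.
move=> mQ; have [M M0 QM] := mf_bound mQ (c - r) (c + r).
have bid := bml_sub.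
(* [M] bounds the total variation, so that [M / l <= 1 / 2] *)
exists (2 * (M + 1)); first by move: M0; lra.
set l := 2 * (M + 1); have l0 : 0 < l by rewrite /l; move: M0; lra.
move=> u K bu K0 uK x xr; rewrite volterraE//.
have fin : M * (K / l * expR (l * `|x - c|)) <= K / 2 * expR (l * `|x - c|).
  rewrite mulrA ler_wpM2r ?expR_ge0// mulrCA ler_wpM2l//.
  rewrite ler_pdivrMr// /l; move: M0; lra.
apply: le_trans fin.
have bk : bml (fun s => (x - s)%:C * u s) by exact: bmlM.
have pos : 0 <= K / l * expR (l * `|x - c|).
  by rewrite mulr_ge0 ?expR_ge0// divr_ge0// ltW.
move: xr; rewrite ler_distl => /andP[rx xr].
case: (leP c x) => cx.
  apply: QM => //; first by move: cx rx xr; lra.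
  move=> s /andP[cs sx].
  have sr : `|s - c| <= r by rewrite ger0_norm; move: cs sx xr; lra.
  rewrite (le_trans (n1M _ _))// n1_real ger0_norm; last by move: sx; lra.
  rewrite (le_trans (ler_wpM2l _ (uK _ sr)))//; first by move: sx; lra.
  rewrite [`|s - c|]ger0_norm; last by lra.
  rewrite [`|x - c|]ger0_norm; last by lra.
  have -> : x - c = (s - c) + (x - s) by ring.
  by apply: mul_expR_le => //; move: sx; lra.
rewrite (mf_sym mQ x c) n1N; apply: QM => //; [exact: ltW|by move: cx rx xr; lra|].
move=> s /andP[xs sc].
have sr : `|s - c| <= r by rewrite ler0_norm; move: xs sc rx; lra.
rewrite (le_trans (n1M _ _))// n1_real ler0_norm; last by move: xs; lra.
rewrite (le_trans (ler_wpM2l _ (uK _ sr)))//; first by move: xs; lra.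
rewrite [`|s - c|]ler0_norm; last by move: sc; lra.
rewrite [`|x - c|]ler0_norm; last by move: cx; lra.
have -> : - (x - c) = - (s - c) + - (x - s) by ring.
by apply: mul_expR_le => //; move: xs; lra.
Qed.

Lemma volterraD Q c u f x : mfam Q -> bml u -> bml f ->
  volterra Q c (fun s => u s + f s) x = volterra Q c u x + volterra Q c f x.
Proof.
move=> mQ bu bf; rewrite !volterraE//; last exact: bmlD.
have bk := bml_sub x.
rewrite -mfD//; [|exact: bmlM|exact: bmlM].
by congr Q; apply/funext => s; rewrite mulrDr.
Qed.

Lemma bml_ball_bound f c (r : R) : bml f ->
  exists2 K, 0 <= K & forall x, `|x - c| <= r -> n1 (f x) <= K.
Proof.
move=> bf; have [_ [K fK]] := bf (c - r) (c + r); exists `|K| => // x.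
by rewrite ler_distl => h; rewrite (le_trans (fK _ h))// ler_norm.
Qed.

Lemma volterra_eq0 Q c u : mfam Q -> bml u -> (forall x, u x = volterra Q c u x) ->
  forall x, u x = 0.
Proof.
move=> mQ bu uT x; apply: n1_eq0; apply/eqP; rewrite eq_le n1_ge0 andbT.
have [l l0 contr] := volterra_contraction c `|x - c| mQ.
have [K K0 uK] := bml_ball_bound c `|x - c| bu.
apply: (@small_dyadic _ (K * expR (l * `|x - c|))) => n.
suff : forall y, `|y - c| <= `|x - c| -> n1 (u y) <= K / 2 ^+ n * expR (l * `|y - c|).
  by move=> /(_ _ (lexx _)); rewrite mulrAC.
elim: n => [|n IH] y yr.
  rewrite expr0 divr1 (le_trans (uK _ yr))// ler_peMr//.
  by rewrite -expR0 ler_expR mulr_ge0// ltW.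
rewrite uT exprSr invfM mulrA; apply: contr => //.
by rewrite divr_ge0// exprn_ge0.
Qed.

(** The difference to the zero solution is a fixed point of a contraction. *)
Lemma ivp_unique Q c u du : mfam Q -> solves Q u du -> u c = 0 -> du c = 0 ->
  forall x, u x = 0.
Proof.
move=> mQ [udu duE] uc duc; have bu := lac_bml udu.
apply: (volterra_eq0 (Q := Q) (c := c)) => // x.
rewrite -[LHS]subr0 -uc udu.2; congr mint; apply/funext => t.
by rewrite -duE duc subr0.
Qed.

Lemma dyadic_cvg (S : nat -> R) (l K : R) :
  (forall n, `|l - S n| <= K / 2 ^+ n) -> S n @[n --> \oo] --> l.
Proof.
move=> h; apply/cvgrPdist_le => e e0.
have K0 : 0 <= K by have := h 0%N; rewrite expr0 divr1; exact: le_trans.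
near=> n; rewrite (le_trans (h n))// ler_pdivrMr ?exprn_gt0// mulrC -ler_pdivrMr//.
apply: (@le_trans _ _ n%:R); last first.
  by rewrite -natrX ler_nat ltnW// ltn_expl.
rewrite (le_trans (ltW (archi_boundP _)))//; first by rewrite divr_ge0// ltW.
by rewrite ler_nat; near: n; exact: nbhs_infty_ge.
Unshelve. all: by end_near. Qed.

Lemma complex_series (a_ : nat -> C) : (exists K, forall n, n1 (a_ n) <= K / 2 ^+ n) ->
  exists l, forall K, (forall n, n1 (a_ n) <= K / 2 ^+ n) ->
    forall n, n1 (l - \sum_(k < n) a_ k) <= 4 * K / 2 ^+ n.
Proof.
have key K : (forall n, n1 (a_ n) <= K / 2 ^+ n) -> exists l, forall n,
    n1 (l - \sum_(k < n) a_ k) <= 4 * K / 2 ^+ n.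
  move=> aK.
  have [l1 h1] := @dyadic_series (fun n => complex.Re (a_ n)) K
    (fun n => le_trans (n1_Re _) (aK n)).
  have [l2 h2] := @dyadic_series (fun n => complex.Im (a_ n)) K
    (fun n => le_trans (n1_Im _) (aK n)).
  exists (l1 +i* l2) => n; rewrite /n1 Re_add Im_add Re_opp Im_opp /=.
  have -> : complex.Re (\sum_(k < n) a_ k) = \sum_(k < n) complex.Re (a_ k).
    by elim/big_rec2 : _ => // i y1 y2 _ <-; rewrite Re_add.
  have -> : complex.Im (\sum_(k < n) a_ k) = \sum_(k < n) complex.Im (a_ k).
    by elim/big_rec2 : _ => // i y1 y2 _ <-; rewrite Im_add.
  have -> : 4 * K / 2 ^+ n = 2 * K / 2 ^+ n + 2 * K / 2 ^+ n by ring.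
  exact: lerD.
move=> [K aK]; have [l hl] := key K aK; exists l => K' aK'.
have [l' hl'] := key K' aK'; suff -> : l = l' by [].
apply/eqP; rewrite -subr_eq0; apply/eqP; apply: n1_eq0; apply/eqP.
rewrite eq_le n1_ge0 andbT; apply: (@small_dyadic _ (4 * K + 4 * K')) => n.
have -> : l - l' = (l - \sum_(k < n) a_ k) + - (l' - \sum_(k < n) a_ k) by ring.
by rewrite (le_trans (n1D _ _))// n1N mulrDl lerD.
Qed.

(** Picard iteration, in the form of a Neumann series of the Volterra operator
    applied to the affine function with the prescribed initial values.  The
    contraction constants depend on the radius around [c], but the pointwise sum
    does not. *)
Lemma ivp_exists Q c (al be : C) : mfam Q -> exists u du,
  [/\ solves Q u du, u c = al & forall t, du t = be + Q c t u].
Proof.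
move=> mQ.
pose u0 (x : R) : C := al + be * (x%:C - c%:C).
have lu0 : lac u0 (fun=> be).
  have := lacD (lac_cst (al - be * c%:C)) (lacZ be (@lac_id R)).
  by apply: eq_lac => x; rewrite /u0; ring.
pose u_ n := iter n (volterra Q c) u0.
have bu_ n : bml (u_ n).
  elim: n => [|n IH]; first exact: lac_bml lu0.
  exact: lac_bml (lac_volterra c mQ IH).
pose S n x := \sum_(k < n) u_ k x.
have bS n : bml (S n).
  elim: n => [|n IH].
    by apply: (@eq_bml _ (fun=> 0)); [move=> x; rewrite /S big_ord0|exact: bml_cst].
  apply: (@eq_bml _ (fun x => S n x + u_ n x)); first by move=> x; rewrite /S big_ord_recr.
  exact: bmlD.
have SE n x : S n.+1 x = u0 x + volterra Q c (S n) x.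
  elim: n x => [|n IH] x.
    rewrite volterraE; [|exact: mQ|exact: bS].
    rewrite {1}/S big_ord_recr big_ord0 /= add0r.
    rewrite (_ : (fun s => _) = (fun=> 0)) ?mf0 ?addr0//.
    by apply/funext => s; rewrite /S big_ord0 mulr0.
  have -> : S n.+2 x = S n.+1 x + volterra Q c (u_ n) x by rewrite /S big_ord_recr.
  rewrite IH -addrA -volterraD//; congr (_ + volterra _ _ _ _).
  by apply/funext => s; rewrite /S big_ord_recr.
have bound r : exists K l, [/\ 0 <= K, 0 < l,
    forall n x, `|x - c| <= r -> n1 (u_ n x) <= K / 2 ^+ n &
    forall f L, bml f -> 0 <= L -> (forall x, `|x - c| <= r -> n1 (f x) <= L) ->
      forall x, `|x - c| <= r -> n1 (volterra Q c f x) <= L * expR (l * r)].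
  have [l l0 contr] := volterra_contraction c r mQ.
  have [K K0 uK] := bml_ball_bound c r (bu_ 0%N).
  have e1 x : 1 <= expR (l * `|x - c|) by rewrite -expR0 ler_expR mulr_ge0// ltW.
  exists (K * expR (l * r)), l; split => //; first by rewrite mulr_ge0// expR_ge0.
    move=> n x xr; suff : n1 (u_ n x) <= K / 2 ^+ n * expR (l * `|x - c|).
      move/le_trans; apply; rewrite mulrAC ler_wpM2r ?invr_ge0 ?exprn_ge0//.
      by rewrite ler_wpM2l// ler_expR ler_wpM2l// ltW.
    elim: n x xr => [|n IH] x xr; first by rewrite expr0 divr1 (le_trans (uK _ xr))// ler_peMr.
    by rewrite exprSr invfM mulrA; apply: contr => //; rewrite divr_ge0// exprn_ge0.
  move=> f L bf L0 fL x xr.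
  apply: (@le_trans _ _ (L / 2 * expR (l * `|x - c|))).
    by apply: contr => // y yr; rewrite (le_trans (fL _ yr))// ler_peMr.
  rewrite ler_pM ?expR_ge0//; [by rewrite divr_ge0|by move: L0; lra|].
  by rewrite ler_expR ler_wpM2l// ltW.
have lim x : exists l, forall K, (forall n, n1 (u_ n x) <= K / 2 ^+ n) ->
    forall n, n1 (l - S n x) <= 4 * K / 2 ^+ n.
  apply: complex_series; have [K [l [_ _ h _]]] := bound `|x - c|.
  by exists K => n; apply: h.
have [f fE] := choice lim.
have bf : bml f.
  move=> x y; have [K [l [K0 l0 h _]]] := bound (`|x - c| + `|y - c|).
  have hb s : x <= s <= y -> `|s - c| <= `|x - c| + `|y - c|.
    move=> /andP[xs sy]; rewrite ler_norml; apply/andP; split.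
      have := ler_norm (- (x - c)); rewrite normrN; have := normr_ge0 (y - c).
      by move: xs; lra.
    by have := ler_norm (y - c); have := normr_ge0 (x - c); move: sy; lra.
  split.
    split.
      apply: (@measurable_fun_cvg _ _ _ _ (fun n s => complex.Re (S n s))).
        by move=> n; exact: (bS n x y).1.1.
      move=> s /=; rewrite in_itv /= => /hb sr.
      apply: (@dyadic_cvg _ _ (4 * K)) => n.
      have := fE s K (fun n => h n s sr) n; apply: le_trans.
      by rewrite -Re_opp -Re_add n1_Re.
    apply: (@measurable_fun_cvg _ _ _ _ (fun n s => complex.Im (S n s))).
      by move=> n; exact: (bS n x y).1.2.
    move=> s /=; rewrite in_itv /= => /hb sr.
    apply: (@dyadic_cvg _ _ (4 * K)) => n.
    have := fE s K (fun n => h n s sr) n; apply: le_trans.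
    by rewrite -Im_opp -Im_add n1_Im.
  exists (4 * K) => s /hb sr.
  have := fE s K (fun n => h n s sr) 0%N.
  by rewrite /S big_ord0 subr0 expr0 divr1.
have fix_f x : f x = u0 x + volterra Q c f x.
  apply/eqP; rewrite -subr_eq0; apply/eqP; apply: n1_eq0; apply/eqP.
  rewrite eq_le n1_ge0 andbT.
  have [K [l [K0 l0 h h']]] := bound `|x - c|.
  (* compare both sides with the partial sum [S n.+1] *)
  apply: (@small_dyadic _ (4 * K + 4 * K * expR (l * `|x - c|))) => n.
  have -> : f x - (u0 x + volterra Q c f x) =
      (f x - S n.+1 x) + volterra Q c (fun s => S n s + (-1) * f s) x.
    rewrite SE volterraD//; last exact: bmlZ.
    have -> : volterra Q c (fun s => -1 * f s) x = - volterra Q c f x.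
      rewrite !volterraE//; last exact: bmlZ.
      have bk := bml_sub x.
      rewrite -mfN//; last exact: bmlM.
      by congr Q; apply/funext => s; ring.
    by ring.
  rewrite (le_trans (n1D _ _))// mulrDl lerD//.
    have := fE x K (fun n => h n x (lexx _)) n.+1.
    move/le_trans; apply; rewrite ler_wpM2l ?mulr_ge0//.
    by rewrite lef_pV2 ?posrE ?exprn_gt0// ler_eXn2l// ltr1n.
  rewrite mulrAC; apply: h' => //.
  - by apply: bmlD => //; exact: bmlZ.
  - by rewrite divr_ge0 ?mulr_ge0// exprn_ge0.
  - move=> y yr; have := fE y K (fun n => h n y yr) n.
    by rewrite -n1N opprB mulN1r.
exists f, (fun t => be + Q c t f); split => //; last first.
  rewrite fix_f /u0 subrr mulr0 addr0 /volterra mintE//.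
  by rewrite set_itvco0 cint_set0 addr0.
split; last by move=> x y; rewrite (mf_chasles mQ bf c x y); ring.
by apply: eq_lac (lacD lu0 (lac_volterra c mQ bf)) => // x; rewrite -fix_f.
Qed.

End initial_value_problems.

(** * Uniqueness of the derivative almost everywhere *)

Section derivative_uniqueness.
Context (R : realType).
Notation C := R[i].
Notation T := (measurableTypeR R).
Notation leb := (@leb R).
Implicit Types (x y s t a b : R) (f g df dg : R -> C).

Lemma ae_imp (m : {measure set T -> \bar R}) (P Q : R -> Prop) :
  (forall x, P x -> Q x) -> {ae m, forall x, P x} -> {ae m, forall x, Q x}.
Proof.
by move=> PQ; apply: filterS => //; exact: (ae_filter_ringOfSetsType m).
Qed.

Lemma ae_imp2 (m : {measure set T -> \bar R}) (P Q S : R -> Prop) :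
  (forall x, P x -> Q x -> S x) ->
  {ae m, forall x, P x} -> {ae m, forall x, Q x} -> {ae m, forall x, S x}.
Proof.
by move=> PQS; apply: filterS2 => //; exact: (ae_filter_ringOfSetsType m).
Qed.

(** The primitive of [g] vanishes identically, and Lebesgue's differentiation
    theorem recovers [g] from it almost everywhere. *)
Lemma integral0_ae0 (g : R -> R) a b : leb.-integrable setT (EFin \o g) ->
  (forall s, ~~ (a <= s < b) -> g s = 0) ->
  (forall x y, \int[leb]_(s in `[x, y[) g s = 0) ->
  {ae leb, forall x, g x = 0}.
Proof.
move=> ig g0 h.
have iS (D : set R) : measurable (D : set T) -> leb.-integrable D (EFin \o g).
  by move=> mD; exact: integrableS ig.
(* [g] vanishes off [[a, b)], so that integrals from minus infinity are integrals from [a] *)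
have F0 x : \int[leb]_(t in `]-oo, x]) g t = 0.
  have -> : \int[leb]_(t in `]-oo, x]) g t = \int[leb]_(t in `[a, x]) g t.
    rewrite Rintegral_mkcond [RHS]Rintegral_mkcond; apply: eq_Rintegral => s _.
    rewrite /patch; case: ifPn; case: ifPn => //.
      rewrite notin_setE inE /= !in_itv /= => /negP; rewrite negb_and -!ltNge => h1 h2.
      apply: g0; rewrite negb_and -!ltNge.
      by case/orP: h1 => [->//|]; rewrite ltNge h2.
    rewrite inE notin_setE /= !in_itv /= => /andP[_ ->].
    by move=> /negP.
  rewrite /leb -Rintegral_itv_bndo_bndc; first exact: h.
  exact: iS.
have lg : locally_integrable setT g.
  by apply: open_integrable_locally => //; exact: openT.
have ig' y : lebesgue_measure.-integrable `]-oo, y] (EFin \o g) by exact: iS.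
have := FTC1Ny ig' lg; apply: ae_imp => x /= [_ <-].
by under eq_fun do rewrite F0; rewrite derive1_cst.
Qed.

End derivative_uniqueness.

Section sobolev_spaces.
Context (R : realType) (a b : R) (ab : a < b).
Notation C := R[i].
Notation T := (measurableTypeR R).
Notation leb := (@leb R).
Implicit Types (x y s t : R) (f g df dg u v : R -> C).
Notation acw := (@abs_cont_with R a b).
Notation D := (`[a, b[%classic : set T).

(** Composition with [clamp] extends an absolutely continuous function from
    [[a, b]] to the line, with the derivative cut off outside [[a, b)]. *)
Definition clamp x : R := Num.min (Num.max a x) b.
Definition cut f x : C := if (a <= x < b) then f x else 0.

Lemma clamp_id x : a <= x <= b -> clamp x = x.
Proof. by move=> /andP[ax xb]; rewrite /clamp max_r// min_l. Qed.

Lemma clamp_itv x : a <= clamp x <= b.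
Proof. by rewrite /clamp le_min ge_min le_max !lexx (ltW ab) orbT. Qed.

Lemma le_clamp x y : x <= y -> clamp x <= clamp y.
Proof.
move=> xy; rewrite /clamp le_min2//.
by rewrite ge_max !le_max lexx xy orbT.
Qed.

Lemma itv_clamp x y : x <= y ->
  `[x, y[%classic `&` D = `[clamp x, clamp y[%classic.
Proof.
move=> xy; apply/seteqP; rewrite /clamp; split=> s /=; rewrite !in_itv /=.
  move=> [/andP[xs sy] /andP[as_ sb]]; apply/andP; split.
    by rewrite ge_min ge_max as_ xs.
  by rewrite lt_min lt_max sb sy orbT.
rewrite ge_min ge_max lt_min lt_max => /andP[h1 /andP[h2 h3]].
case/orP: h1 => [/andP[h4 h5]|h4]; last by move: h3; rewrite ltNge h4.
split; first by rewrite h5 /=; case/orP: h2 => // h2; move: h2; rewrite ltNge h4.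
by rewrite h4 h3.
Qed.

Lemma cut_patch (h : C -> R) f : h 0 = 0 ->
  (fun s => (h (cut f s))%:E) = ((fun s => (h (f s))%:E) \_ D).
Proof.
move=> h0; apply/funext => s; rewrite /patch /cut.
have -> : (s \in D) = (a <= s < b) by apply/idP/idP; rewrite inE /= in_itv.
by case: ifP => //; rewrite h0.
Qed.

Lemma cintegrable_cut df : cintegrable leb D df -> cintegrable leb setT (cut df).
Proof.
have mD : measurable D by exact: measurable_itv.
move=> [h1 h2]; split.
  by rewrite (cut_patch (h := @complex.Re R))//; exact: (integrable_mkcond _ mD).1.
by rewrite (cut_patch (h := @complex.Im R))//; exact: (integrable_mkcond _ mD).1.
Qed.

Lemma acw_lac f df : acw f df -> lac (fun x => f (clamp x)) (cut df).
Proof.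
move=> [idf fE].
have mD : measurable D by exact: measurable_itv.
have ic := cintegrable_cut idf.
have lc : lint leb (cut df) by move=> x y; exact: cintegrableS ic.
split => // x y; wlog xy : x y / x <= y => [h|].
  case: (leP x y) => [/h//|/ltW/h E].
  by rewrite mint_sym -E opprB.
have /andP[h1 h2] := clamp_itv x; have /andP[h3 h4] := clamp_itv y.
rewrite fE ?le_clamp// !mintE ?le_clamp// -itv_clamp//.
have E s : (s \in D) = (a <= s < b) by apply/idP/idP; rewrite inE /= in_itv.
rewrite /cint; congr (_ +i* _); rewrite Rintegral_mkcondr; apply: eq_Rintegral => s _;
  by rewrite /patch /cut E; case: ifP.
Qed.

Lemma lac_acw u v : lac u v -> acw u v.
Proof. by move=> /lacE; apply. Qed.

Lemma eq_acw f g df : (forall x, a <= x <= b -> f x = g x) -> acw f df -> acw g df.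
Proof.
move=> fg [idf fE]; split => // x y ax xy yb; rewrite -!fg ?fE//.
  by rewrite ax (le_trans xy).
by rewrite (le_trans ax xy).
Qed.

Lemma eq_acwE f g : (forall x, a <= x <= b -> f x = g x) ->
  ac_deriv a b f = ac_deriv a b g.
Proof.
move=> fg; congr xget; apply/funext => df; apply/propext; split; apply: eq_acw => //.
by move=> x h; rewrite fg.
Qed.

Lemma acw_deriv f df : acw f df -> acw f (ac_deriv a b f).
Proof.
move=> h; have := @xgetPex _ 0 [set df | acw f df].
by apply; exists df.
Qed.

Lemma lac0_ae v : lac (fun=> 0) (cut v) -> cintegrable leb D v ->
  {ae leb, forall x, cut v x = 0}.
Proof.
move=> [lv h0] iv; have [i1 i2] := cintegrable_cut iv.
have z x y : mint leb x y (cut v) = 0 by rewrite -h0 subrr.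
have zc (h : C -> R) : h 0 = 0 -> forall s, ~~ (a <= s < b) -> h (cut v s) = 0.
  by move=> h00 s /negbTE; rewrite /cut => ->.
have zi x y : cint leb `[x, y[ (cut v) = 0.
  case: (leP x y) => xy; first by rewrite -mintE.
  by rewrite set_itv_ge ?cint_set0// bnd_simp -leNgt ltW.
have a1 := integral0_ae0 i1 (zc (@complex.Re R) erefl) (fun x y => congr1 (@complex.Re R) (zi x y)).
have a2 := integral0_ae0 i2 (zc (@complex.Im R) erefl) (fun x y => congr1 (@complex.Im R) (zi x y)).
by apply: ae_imp2 a1 a2 => x h1 h2; exact: complex_ext.
Qed.

Lemma acw_unique f df dg : acw f df -> acw f dg ->
  {ae leb, forall x, a <= x < b -> df x = dg x}.
Proof.
move=> h1 h2.
have iv : cintegrable leb D (fun x => df x + -1 * dg x).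
  apply: cintegrableD => //; first exact: h1.1.
  by apply: cintegrableZ => //; exact: h2.1.
have l : lac (fun=> 0) (cut (fun x => df x + -1 * dg x)).
  have := lacD (acw_lac h1) (lacZ (-1) (acw_lac h2)).
  apply: eq_lac => x; first by ring.
  by rewrite /cut; case: ifP => // _; ring.
have := lac0_ae l iv; apply: ae_imp => x + h; rewrite /cut h => /eqP.
by rewrite mulN1r subr_eq0 => /eqP.
Qed.

Lemma ae_eq_cint (m : {measure set T -> \bar R}) f g : cmeasurable D f -> cmeasurable D g ->
  {ae m, forall x, a <= x < b -> f x = g x} -> cint m D f = cint m D g.
Proof.
move=> [f1 f2] [g1 g2] fg; rewrite /cint /Rintegral.
congr (fine _ +i* fine _); apply: ae_eq_integral => //; try exact/measurable_EFinP.
  by apply: ae_imp fg => x fg; rewrite /= in_itv /= => /fg ->.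
by apply: ae_imp fg => x fg; rewrite /= in_itv /= => /fg ->.
Qed.

Lemma cmeasurable_conj (E : set T) f : cmeasurable E f -> cmeasurable E (fun s => (f s)^*).
Proof.
move=> [f1 f2]; split.
  by apply: eq_measurable_fun f1 => s _; case: (f s).
have := measurableT_comp (@oppr_measurable R setT) f2.
by apply: eq_measurable_fun => s _ /=; case: (f s).
Qed.

(** The derivative used in the definition of the scalar product is a choice;
    any other derivative agrees with it almost everywhere. *)
Lemma H1_dotE f g df dg : acw f df -> acw g dg ->
  H1_dot a b f g = 4^-1 * mint leb a b (fun x => f x * (g x)^*) +
    mint leb a b (fun x => df x * (dg x)^*).
Proof.
move=> hf hg; congr (_ + _); have hf' := acw_deriv hf; have hg' := acw_deriv hg.
rewrite !mintE ?ltW//; apply: ae_eq_cint.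
- apply: cmeasurableM; [exact: cintegrable_measurable hf'.1|].
  by apply: cmeasurable_conj; exact: cintegrable_measurable hg'.1.
- apply: cmeasurableM; [exact: cintegrable_measurable hf.1|].
  by apply: cmeasurable_conj; exact: cintegrable_measurable hg.1.
- apply: ae_imp2 (acw_unique hf' hf) (acw_unique hg' hg) => x h1 h2 h.
  by rewrite h1// h2.
Qed.

End sobolev_spaces.

(** * Square integrability and the Dirichlet energy *)

Section square_integrability.
Context (R : realType).
Notation C := R[i].
Notation T := (measurableTypeR R).
Implicit Types (m : {measure set T -> \bar R}) (D : set T) (f g : R -> C) (z u : C).

Definition sq z : R := complex.Re z ^+ 2 + complex.Im z ^+ 2.

Lemma sq_ge0 z : 0 <= sq z. Proof. by rewrite addr_ge0// sqr_ge0. Qed.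

Lemma sq0 : sq 0 = 0. Proof. by rewrite /sq /= expr0n /= addr0. Qed.

Lemma sqM z u : sq (z * u) = sq z * sq u.
Proof. by rewrite /sq Re_mul Im_mul; ring. Qed.

Lemma sqD z u : sq (z + u) <= 2 * sq z + 2 * sq u.
Proof.
rewrite /sq Re_add Im_add -subr_ge0.
set p := complex.Re z; set q := complex.Re u; set r := complex.Im z; set s := complex.Im u.
have -> : 2 * (p ^+ 2 + r ^+ 2) + 2 * (q ^+ 2 + s ^+ 2) - ((p + q) ^+ 2 + (r + s) ^+ 2) =
  (p - q) ^+ 2 + (r - s) ^+ 2 by ring.
by rewrite addr_ge0// sqr_ge0.
Qed.

Lemma sqr_addr_le (p q : R) : (p + q) ^+ 2 <= 2 * p ^+ 2 + 2 * q ^+ 2.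
Proof.
rewrite -subr_ge0.
have -> : 2 * p ^+ 2 + 2 * q ^+ 2 - (p + q) ^+ 2 = (p - q) ^+ 2 by ring.
exact: sqr_ge0.
Qed.

Lemma n1_sqr_le z : n1 z ^+ 2 <= 2 * sq z.
Proof.
rewrite /n1 /sq -(real_normK (num_real (complex.Re z))) -(real_normK (num_real (complex.Im z))).
by rewrite mulrDr sqr_addr_le.
Qed.

Lemma sq_le_n1 z : sq z <= n1 z ^+ 2.
Proof.
rewrite /n1 /sq -(real_normK (num_real (complex.Re z))) -(real_normK (num_real (complex.Im z))).
by rewrite sqrrD addrAC lerDl mulrn_wge0// mulr_ge0.
Qed.

Lemma sq_le z (K : R) : n1 z <= K -> sq z <= K ^+ 2.
Proof.
move=> zK; rewrite (le_trans (sq_le_n1 z))// ler_pXn2r// nnegrE ?n1_ge0//.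
exact: le_trans (n1_ge0 _) zK.
Qed.

Lemma measurable_sq D f : cmeasurable D f -> measurable_fun D (fun s => sq (f s) : R).
Proof. by move=> [f1 f2]; apply: measurable_funD; exact: measurable_funX. Qed.

Lemma sqi_measurable m D f : square_integrable m D f -> cmeasurable D f.
Proof. by case. Qed.

Lemma sqi_int m D f : square_integrable m D f -> m.-integrable D (EFin \o (sq \o f)).
Proof. by case. Qed.

Lemma sqi_lin m D (k : C) f g : measurable D -> square_integrable m D f ->
  square_integrable m D g -> square_integrable m D (fun s => k * f s + g s).
Proof.
move=> mD [mf fi] [mg gi].
have mfg : cmeasurable D (fun s => k * f s + g s).
  by apply: cmeasurableD => //; apply: cmeasurableM => //; exact: cmeasurable_cst.
split => //.
apply: (@le_integrable _ _ _ _ _ mD _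
  (fun s => (2 * sq k)%:E * (sq (f s))%:E + 2%:E * (sq (g s))%:E)%E).
- by apply/measurable_EFinP; exact: measurable_sq.
- move=> s Ds /=; rewrite lee_fin -/(sq _) ger0_norm ?sq_ge0//.
  rewrite (le_trans (sqD _ _))// sqM mulrA ger0_norm//.
  by rewrite addr_ge0// !mulr_ge0// sq_ge0.
- by apply: integrableD => //; exact: integrableZl.
Qed.

Lemma sqi_bounded m D f (K : R) : measurable D -> (m D < +oo)%E -> cmeasurable D f ->
  (forall s, D s -> n1 (f s) <= K) -> square_integrable m D f.
Proof.
move=> mD Doo mf fK; split => //.
apply: (@integrable_bounded _ _ _ (fun s => sq (f s)) (K ^+ 2)) => //.
  exact: measurable_sq.
by move=> s Ds; rewrite ger0_norm ?sq_ge0// sq_le// fK.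
Qed.

Lemma sqi_cintegrable m D f : measurable D -> (m D < +oo)%E ->
  square_integrable m D f -> cintegrable m D f.
Proof.
move=> mD Doo [mf fi]; apply: (@cintegrableP _ _ _ _ (fun s => 1 + 2 * sq (f s))) => //.
  have i1 : m.-integrable D (EFin \o cst (1 : R)).
    by apply: (@integrable_bounded _ _ _ (cst 1) `|1|).
  have := integrableD mD i1 (integrableZl mD 2 fi).
  by apply: eq_integrable.
move=> s _; have := n1_sqr_le (f s); have := sqr_ge0 (n1 (f s) - 1).
by have := n1_ge0 (f s); set n := n1 _ => ? h1 h2; nra.
Qed.

(** The quadratic polynomial in [t] that integrates [(t * g - 1) ^+ 2] is
    nonnegative. *)
Lemma jensen m D (g : R -> R) : measurable D -> (m D < +oo)%E ->
  m.-integrable D (EFin \o g) -> m.-integrable D (EFin \o (fun s => g s ^+ 2)) ->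
  (\int[m]_(s in D) g s) ^+ 2 <= fine (m D) * \int[m]_(s in D) (g s ^+ 2).
Proof.
move=> mD Doo ig ig2.
set I := \int[m]_(s in D) g s; set J := \int[m]_(s in D) _; set M := fine _.
have J0 : 0 <= J by apply: Rintegral_ge0 => s _; exact: sqr_ge0.
have M0 : 0 <= M by exact: fine_ge0.
have i1 : m.-integrable D (EFin \o cst (1 : R)).
  by apply: (@integrable_bounded _ _ _ (cst 1) `|1|).
have quad t : 0 <= t ^+ 2 * J - 2 * t * I + M.
  have -> : t ^+ 2 * J - 2 * t * I + M = \int[m]_(s in D) ((t * g s - 1) ^+ 2).
    have -> : (fun s => (t * g s - 1) ^+ 2) =
        (fun s => (t ^+ 2 * g s ^+ 2 - (2 * t) * g s) + cst 1 s).
      by apply/funext => s /=; ring.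
    rewrite RintegralD//.
    - rewrite RintegralB ?RintegralZl//; try exact: integrable_scale.
      by rewrite (Rintegral_cst _ mD) mul1r.
    - have := integrableB mD (integrable_scale (t ^+ 2) mD ig2) (integrable_scale (2 * t) mD ig).
      by apply: eq_integrable.
  by apply: Rintegral_ge0 => s _; exact: sqr_ge0.
have [J1|J1] := eqVneq J 0.
  have [->|I0] := eqVneq I 0; first by rewrite expr0n /= mulr_ge0.
  (* the polynomial is affine in [t] and takes the value [- M - 2] here *)
  have := quad ((M + 1) / I); rewrite J1 mulr0 sub0r.
  have -> : - (2 * ((M + 1) / I) * I) + M = - M - 2 by field.
  by move: M0; lra.
have Jp : 0 < J by rewrite lt_neqAle eq_sym J1.
(* the minimum of the polynomial *)
have := quad (I / J).
have -> : (I / J) ^+ 2 * J - 2 * (I / J) * I + M = (M * J - I ^+ 2) / J by field.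
by rewrite pmulr_lge0 ?invr_gt0// subr_ge0.
Qed.

(** Cauchy-Schwarz against a constant function. *)
Lemma n1_int_sqr_le m D f : measurable D -> (m D < +oo)%E -> square_integrable m D f ->
  (\int[m]_(s in D) n1 (f s)) ^+ 2 <= 2 * fine (m D) * \int[m]_(s in D) sq (f s).
Proof.
move=> mD Doo sf; have [mf fi] := sf; have cf := sqi_cintegrable mD Doo sf.
have i2 : m.-integrable D (EFin \o (fun s => 2 * sq (f s))).
  by have := integrableZl mD 2 fi; apply: eq_integrable.
have in2 : m.-integrable D (EFin \o (fun s => n1 (f s) ^+ 2)).
  apply: (@le_integrable _ _ _ _ _ mD _ _ _ _ i2).
    by apply/measurable_EFinP; apply: measurable_funX; exact: cmeasurable_n1.
  move=> s _ /=; rewrite lee_fin ger0_norm ?sqr_ge0//.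
  by rewrite (le_trans (n1_sqr_le _))// ler_norm.
apply: (le_trans (jensen mD Doo (cintegrable_n1 mD cf) in2)).
rewrite -[leRHS]mulrA [leRHS]mulrCA; apply: ler_wpM2l; first exact: fine_ge0.
rewrite -RintegralZl//; apply: le_Rintegral => // s _; exact: n1_sqr_le.
Qed.

Lemma int_sq_lin m D (k : C) f g : measurable D ->
  square_integrable m D f -> square_integrable m D g ->
  \int[m]_(s in D) sq (k * f s + g s) <=
  2 * sq k * \int[m]_(s in D) sq (f s) + 2 * \int[m]_(s in D) sq (g s).
Proof.
move=> mD su sw; have [_ i1] := sqi_lin k mD su sw; have [_ i2] := su; have [_ i3] := sw.
rewrite -!RintegralZl// -RintegralD//; try exact: integrable_scale.
apply: le_Rintegral => //.
  have := integrableD mD (integrable_scale (2 * sq k) mD i2) (integrable_scale 2 mD i3).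
  by apply: eq_integrable.
by move=> s _; rewrite (le_trans (sqD _ _))// sqM mulrA.
Qed.

End square_integrability.

Section sobolev_energy.
Context (R : realType) (a b : R) (ab : a < b).
Notation C := R[i].
Notation T := (measurableTypeR R).
Notation leb := (@leb R).
Implicit Types (x y s t : R) (f g df dg u v : R -> C).
Notation acw := (@abs_cont_with R a b).
Notation D := (`[a, b[%classic : set T).

Let mD : measurable D. Proof. exact: measurable_itv. Qed.
Let Doo : (leb D < +oo)%E. Proof. exact: leb_locally_finite. Qed.

Lemma leb_itv : fine (leb D) = b - a.
Proof. by rewrite /leb /= lebesgue_measure_itv /= lte_fin ab. Qed.

Definition energy f : R := complex.Re (H1_dot a b f f).

Definition h10_with f df :=
  [/\ acw f df, square_integrable leb D df, f a = 0 & f b = 0].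

Lemma H10P f : H10 a b f <-> exists df, h10_with f df.
Proof.
split=> [[[df [h1 h2]] fa fb]|[df [h1 h2 fa fb]]]; first by exists df.
by split => //; exists df.
Qed.

(** A function that is absolutely continuous on [[a, b]] is bounded there. *)
Lemma acw_sqi f df : acw f df -> square_integrable leb D f.
Proof.
move=> h; have bf := lac_bml (acw_lac ab h).
have [mf [K fK]] := bf a b.
have E s : D s -> f (clamp a b s) = f s.
  by move=> /=; rewrite in_itv /= => /andP[h1 h2]; rewrite clamp_id// h1 ltW.
apply: (@sqi_bounded _ _ _ _ K) => //.
  apply: eq_cmeasurable E _.
  apply: cmeasurableS mf; first exact: measurable_itv.
  by move=> s /=; rewrite !in_itv /= => /andP[-> /ltW].
move=> s Ds; rewrite -E//; apply: fK; move: Ds => /=.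
by rewrite in_itv /= => /andP[-> /ltW].
Qed.

Lemma energyE f df : acw f df ->
  energy f = 4^-1 * \int[leb]_(s in D) sq (f s) + \int[leb]_(s in D) sq (df s).
Proof.
move=> h; rewrite /energy (H1_dotE ab h h) Re_add !mintE ?ltW//.
have -> : (4^-1 : C) = (4^-1 : R)%:C by rewrite fmorphV rmorph_nat.
rewrite Re_mul /= mul0r subr0; congr (_ * _ + _); apply: eq_Rintegral => s _;
  by rewrite /sq /conjc; case: (_ s) => p q /=; ring.
Qed.

Lemma energy_ge0 f df : acw f df -> 0 <= energy f.
Proof.
move=> h; rewrite (energyE h) addr_ge0// ?mulr_ge0// Rintegral_ge0// => s _;
  exact: sq_ge0.
Qed.

Lemma eq_energy f g : (forall x, a <= x <= b -> f x = g x) -> energy f = energy g.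
Proof.
move=> fg; rewrite /energy /H1_dot (eq_acwE fg); congr (complex.Re (_ * _ + _)).
by apply: eq_mint; [exact: ltW|move=> s /andP[h1 h2]; rewrite fg// h1 ltW].
Qed.

Lemma eq_h10 f g df : (forall x, a <= x <= b -> f x = g x) ->
  h10_with f df -> h10_with g df.
Proof.
move=> fg [h1 h2 fa fb]; split => //; first exact: eq_acw fg h1.
  by rewrite -fg// lexx ltW.
by rewrite -fg// lexx ltW.
Qed.

(** Since [f a = 0], the values of [f] are integrals of the derivative, which
    Cauchy-Schwarz bounds by the energy.  In particular the energy controls the
    norm of [f] in the space of square integrable functions of any locally
    finite measure. *)
Lemma sobolev f df : h10_with f df -> forall x, a <= x <= b ->
  n1 (f x) ^+ 2 <= 2 * (b - a) * energy f.
Proof.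
move=> [h sdf fa _] x /andP[ax xb].
have [idf fE] := h.
have step : n1 (f x) <= \int[leb]_(s in D) n1 (df s).
  have -> : f x = mint leb a x df by rewrite -fE// fa subr0.
  rewrite mintE//.
  have sub : `[a, x[%classic `<=` D.
    by move=> s /=; rewrite !in_itv /= => /andP[-> h2]; exact: lt_le_trans xb.
  have i' : cintegrable leb `[a, x[ df by exact: cintegrableS idf.
  apply: (@le_trans _ _ (\int[leb]_(s in `[a, x[) n1 (df s))).
    by apply: n1_cint_le => //; exact: cintegrable_n1.
  apply: Rintegral_subitv => //; last by move=> s; exact: n1_ge0.
  exact: cintegrable_n1.
have J0 : 0 <= \int[leb]_(s in D) sq (f s) by apply: Rintegral_ge0 => s _; exact: sq_ge0.
apply: (@le_trans _ _ ((\int[leb]_(s in D) n1 (df s)) ^+ 2)).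
  by rewrite ler_pXn2r// nnegrE ?n1_ge0// Rintegral_ge0// => s _; exact: n1_ge0.
apply: (le_trans (n1_int_sqr_le mD Doo sdf)); rewrite leb_itv.
apply: ler_wpM2l; first by rewrite mulr_ge0// subr_ge0 ltW.
by rewrite (energyE h) lerDr mulr_ge0.
Qed.

Lemma energy_eq0 f df : h10_with f df -> energy f = 0 -> forall x, a <= x <= b -> f x = 0.
Proof.
move=> h e0 x xab; apply: n1_eq0; apply/eqP; rewrite -sqrf_eq0 eq_le sqr_ge0 andbT.
by have := sobolev h xab; rewrite e0 mulr0.
Qed.

Lemma acw_lin (k : C) f df g dg : acw f df -> acw g dg ->
  acw (fun x => k * f x + g x) (fun x => k * df x + dg x).
Proof.
move=> hf hg.
have h := lac_acw ab (lacD (lacZ k (acw_lac ab hf)) (acw_lac ab hg)).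
have [_ E] := h; have [i1 _] := hf; have [i2 _] := hg; split.
  by apply: cintegrableD => //; exact: cintegrableZ.
move=> x y ax xy yb.
have := E x y ax xy yb; rewrite !clamp_id ?ax ?yb ?(le_trans ax xy) ?(le_trans xy yb)// => ->.
apply: eq_mint => // s /andP[xs sy]; rewrite /cut.
by rewrite (le_trans ax xs) (lt_le_trans sy yb).
Qed.

Lemma h10_lin (k : C) f df g dg : h10_with f df -> h10_with g dg ->
  h10_with (fun x => k * f x + g x) (fun x => k * df x + dg x).
Proof.
move=> [h1 h2 fa fb] [h3 h4 ga gb]; split.
- exact: acw_lin.
- exact: sqi_lin.
- by rewrite fa ga mulr0 addr0.
- by rewrite fb gb mulr0 addr0.
Qed.

(** A substitute for the triangle inequality that avoids square roots. *)
Lemma energy_lin (k : C) f df g dg : acw f df -> acw g dg ->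
  square_integrable leb D df -> square_integrable leb D dg ->
  energy (fun x => k * f x + g x) <= 2 * sq k * energy f + 2 * energy g.
Proof.
move=> h1 h2 s1 s2; rewrite (energyE (acw_lin k h1 h2)) (energyE h1) (energyE h2).
have k1 := int_sq_lin k mD (acw_sqi h1) (acw_sqi h2); have k2 := int_sq_lin k mD s1 s2.
by move: k1 k2; lra.
Qed.

Lemma h10_bounded u v (K : R) : lac u v -> u a = 0 -> u b = 0 ->
  (forall x, a <= x < b -> n1 (v x) <= K) ->
  h10_with u v /\ energy u <= (4^-1 * (b - a) ^+ 3 + (b - a)) * K ^+ 2.
Proof.
move=> uv ua ub vK; have h := lac_acw ab uv.
have mv := cintegrable_measurable h.1.
have vK' s : D s -> n1 (v s) <= K by move=> /=; rewrite in_itv; exact: vK.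
have K0 : 0 <= K by apply: le_trans (n1_ge0 _) (vK a _); rewrite lexx.
have sv : square_integrable leb D v by exact: sqi_bounded vK'.
split => //; rewrite (energyE h).
have uK s : D s -> n1 (u s) <= K * (b - a).
  move=> /=; rewrite in_itv /= => /andP[as_ sb].
  have -> : u s = mint leb a s v by rewrite -uv.2 ua subr0.
  rewrite mintE//.
  have sub : `[a, s[%classic `<=` D.
    by move=> t /=; rewrite !in_itv /= => /andP[-> h2]; exact: lt_trans sb.
  apply: (@le_trans _ _ (\int[leb]_(t in `[a, s[) K)).
    apply: n1_cint_le => //; first exact: (uv.1 a s).
      by apply: (@integrable_bounded _ _ _ (cst K) `|K|) => //; exact: leb_locally_finite.
    by move=> t /sub /vK'.
  rewrite Rintegral_cst// ler_wpM2l//.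
  rewrite /leb /= lebesgue_measure_itv /=; case: ifP => _ /=; last by rewrite subr_ge0 ltW.
  by rewrite lerD2r ltW.
have bnd w (L : R) : square_integrable leb D w -> (forall s, D s -> n1 (w s) <= L) ->
    \int[leb]_(s in D) sq (w s) <= L ^+ 2 * (b - a).
  move=> sw wL; rewrite -leb_itv -(Rintegral_cst _ mD).
  apply: le_Rintegral => //; first exact: sqi_int sw.
    by apply: (@integrable_bounded _ _ _ (cst (L ^+ 2)) `|L ^+ 2|).
  by move=> s Ds; rewrite sq_le// wL.
have b1 := bnd _ _ (acw_sqi h) uK; have b2 := bnd _ _ sv vK'.
have -> : (4^-1 * (b - a) ^+ 3 + (b - a)) * K ^+ 2 =
  4^-1 * ((K * (b - a)) ^+ 2 * (b - a)) + K ^+ 2 * (b - a) by ring.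
by apply: lerD => //; rewrite ler_wpM2l.
Qed.

End sobolev_energy.

(** * The Dirichlet kernel and its potentials *)

Section dirichlet_green_kernel.
Context (R : realType).
Notation C := R[i].
Notation T := (measurableTypeR R).
Notation leb := (@leb R).
Implicit Types (x y s t a b c : R) (f g F dF G K : R -> C) (N : R -> R -> (R -> C) -> C).

Lemma mfamZ k N : mfam N -> mfam (fun x y f => k * N x y f).
Proof.
move=> mN; have := mfam_lin (k - 1) mN mN; congr mfam.
by apply/funext => x; apply/funext => y; apply/funext => f; ring.
Qed.

Lemma mfam_leb : mfam (mint leb).
Proof. exact/mfam_mint1/leb_locally_finite. Qed.

Lemma bml_if c f g : bml f -> bml g -> bml (fun s => if s <= c then f s else g s).
Proof.
move=> bf bg x y.
have [[f1 f2] [K fK]] := bf x y; have [[g1 g2] [L gL]] := bg x y.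
split; last first.
  exists (`|K| + `|L|) => s h; case: ifP => _.
    by rewrite (le_trans (fK _ h))// (le_trans (ler_norm _))// lerDl.
  by rewrite (le_trans (gL _ h))// (le_trans (ler_norm _))// lerDr.
have mc : measurable_fun `[x, y]%classic (fun s : T => s <= c).
  by apply: measurable_fun_ler => //; exact: measurable_id.
have sub (h : T -> R) (E : set T) : measurable_fun `[x, y] h -> measurable_fun (`[x, y] `&` E) h.
  by move=> mh; apply: measurable_funS mh => // s [].
split.
  have := measurable_fun_if _ mc (sub _ _ f1) (sub _ _ g1).
  by move=> h; apply: eq_measurable_fun (h _) => // s _; case: ifP.
have := measurable_fun_if _ mc (sub _ _ f2) (sub _ _ g2).
by move=> h; apply: eq_measurable_fun (h _) => // s _; case: ifP.
Qed.

(** Kernels that are defined by cases on [s <= x] split into two integrals; the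
    point [x] itself belongs to the second interval, which is harmless for a
    kernel that is continuous on the diagonal. *)
Lemma split_kernel N a b x f g : mfam N -> bml f -> bml g -> a <= x <= b ->
  f x = g x ->
  N a b (fun s => if s <= x then f s else g s) = N a x f + N x b g.
Proof.
move=> mN bf bg /andP[ax xb] fg; rewrite (mf_ordered mN ax xb); last exact: bml_if.
congr (_ + _); apply: mf_ext => // s /andP[h1 h2]; first by rewrite ltW.
case: ifP => // h3; have -> : s = x by apply/eqP; rewrite eq_le h3.
by [].
Qed.

Section kernel.
Context (a b : R) (ab : a < b).

Definition lsh x : C := (sinh ((x - a) / 2))%:C.
Definition rsh x : C := (sinh ((b - x) / 2))%:C.

Let S : C := (sinh ((b - a) / 2))%:C.

Let S0 : S != 0.
Proof.
by rewrite /S fmorph_eq0 gt_eqF// sinh_gt0// divr_gt0// subr_gt0.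
Qed.

(** The source term of the equation [u'' = u / 4]. *)
Definition leb4 x y f : C := 4^-1 * mint leb x y f.

Lemma mfam_leb4 : mfam leb4. Proof. exact/mfamZ/mfam_leb. Qed.

Lemma lshE x : lsh x = sh x * ch a - ch x * sh a.
Proof. by rewrite /lsh /sh /ch sinh_sub -!rmorphM -rmorphB. Qed.

Lemma rshE x : rsh x = sh b * ch x - ch b * sh x.
Proof. by rewrite /rsh /sh /ch sinh_sub -!rmorphM -rmorphB. Qed.

Lemma solves_sh : solves leb4 (@sh R) (fun x => 2^-1 * ch x).
Proof.
split; first exact: lac_sh.
move=> x y; rewrite -mulrBr (lac_ch R).2 /leb4 mintZ; last first.
  by apply: bml_lint; [exact: leb_locally_finite|exact: lac_bml (lac_sh R)].
by rewrite mulrA; congr (_ * _); field.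
Qed.

Lemma solves_ch : solves leb4 (@ch R) (fun x => 2^-1 * sh x).
Proof.
split; first exact: lac_ch.
move=> x y; rewrite -mulrBr (lac_sh R).2 /leb4 mintZ; last first.
  by apply: bml_lint; [exact: leb_locally_finite|exact: lac_bml (lac_ch R)].
by rewrite mulrA; congr (_ * _); field.
Qed.

Lemma solves_lin N k l f df g dg : mfam N -> solves N f df -> solves N g dg ->
  solves N (fun x => k * f x + l * g x) (fun x => k * df x + l * dg x).
Proof.
move=> mN [lf fE] [lg gE]; split; first by apply: lacD; exact: lacZ.
move=> x y; rewrite (mf_linear mN); [|exact: lac_bml lf|exact/bmlZ/(lac_bml lg)].
by rewrite mfZ// -?fE -?gE; [ring|exact: lac_bml lg].
Qed.

Lemma solves_lsh :
  solves leb4 lsh (fun x => ch a * (2^-1 * ch x) + - sh a * (2^-1 * sh x)).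
Proof.
have := solves_lin (ch a) (- sh a) mfam_leb4 solves_sh solves_ch.
by congr solves; apply/funext => x; rewrite lshE; ring.
Qed.

Lemma solves_rsh :
  solves leb4 rsh (fun x => - ch b * (2^-1 * ch x) + sh b * (2^-1 * sh x)).
Proof.
have := solves_lin (- ch b) (sh b) mfam_leb4 solves_sh solves_ch.
by congr solves; apply/funext => x; rewrite rshE; ring.
Qed.

Lemma bml_lsh : bml lsh. Proof. exact: lac_bml solves_lsh.1. Qed.
Lemma bml_rsh : bml rsh. Proof. exact: lac_bml solves_rsh.1. Qed.

Lemma K0E x : (fun s => (K0 a b x s)%:C) =
  (fun s => 2 / S * (if s <= x then rsh x * lsh s else lsh x * rsh s)).
Proof.
apply/funext => s; rewrite /K0 rmorphM fmorph_div rmorph_nat; congr (_ * _).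
by case: ifP => _; rewrite rmorphM // mulrC.
Qed.

Lemma bml_K0 x : bml (fun s => (K0 a b x s)%:C).
Proof.
rewrite K0E; apply: bmlZ; apply: bml_if; apply: bmlZ; [exact: bml_lsh|exact: bml_rsh].
Qed.

Lemma mf_K0 N x : mfam N -> a <= x <= b ->
  N a b (fun s => (K0 a b x s)%:C) = 2 / S * (rsh x * N a x lsh + lsh x * N x b rsh).
Proof.
move=> mN xab; have b1 := bml_lsh; have b2 := bml_rsh.
rewrite K0E mfZ//; last by apply: bml_if; exact: bmlZ.
by rewrite split_kernel ?mfZ//; [exact: bmlZ|exact: bmlZ|rewrite mulrC].
Qed.

(** [K0] is the kernel of [green_representation] for the equation [u'' = u / 4],
    with the solutions [sinh ((x - a) / 2)] and [sinh ((b - x) / 2)], whose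
    Wronskian is [sinh ((b - a) / 2) / 2]. *)
Lemma K0_representation N F dF : mfam N -> lac F dF -> F a = 0 -> F b = 0 ->
  (forall x y, dF y - dF x = leb4 x y F - N x y (fun=> 1)) ->
  forall x, a <= x <= b -> F x = N a b (fun s => (K0 a b x s)%:C).
Proof.
move=> mN FdF Fa Fb dFE x xab; rewrite mf_K0//.
have la : lsh a = 0 by rewrite /lsh subrr mul0r sinh0.
have rb : rsh b = 0 by rewrite /rsh subrr mul0r sinh0.
rewrite -(green_representation mfam_leb4 mN solves_lsh solves_rsh la rb FdF dFE Fa Fb).
have SE : S = sh b * ch a - ch b * sh a by rewrite /S /sh /ch sinh_sub -!rmorphM -rmorphB.
have -> : rsh x * (ch a * (2^-1 * ch x) + - sh a * (2^-1 * sh x)) -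
    (- ch b * (2^-1 * ch x) + sh b * (2^-1 * sh x)) * lsh x =
    2^-1 * S * (ch x * ch x - sh x * sh x).
  by rewrite lshE rshE SE; ring.
by rewrite ch2sh2; field.
Qed.

End kernel.

Lemma dirichlet_exists N a b : a < b -> mfam N -> exists F dF, [/\ lac F dF, F a = 0, F b = 0 &
  forall x y, dF y - dF x = leb4 x y F - N x y (fun=> 1)].
Proof.
move=> ab mN; have [K K0 bvp] := bvp_exists ab.
have mN' := mfamZ (-1) mN.
have bch := lac_bml (lac_ch R); have bsh := lac_bml (lac_sh R).
have [_ [m1 h1]] := mf_bml mN' a bch a b.
have [_ [m2 h2]] := mf_bml mN' a bsh a b.
have m0 : 0 <= `|m1| + `|m2| by exact: addr_ge0.
have [|F [dF [lF Fa Fb dFE _]]] := bvp _ _ mN' m0.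
  move=> x xab; split.
    by rewrite (le_trans (h1 x xab))// (le_trans (ler_norm _))// lerDl.
  by rewrite (le_trans (h2 x xab))// (le_trans (ler_norm _))// lerDr.
by exists F, dF; split => // x y; rewrite dFE mulN1r.
Qed.

End dirichlet_green_kernel.

Section green_potentials.
Context (R : realType) (omega : signed_borel R)
  (upsilon : {measure set (measurableTypeR R) -> \bar R})
  (upsilon_fin : locally_finite upsilon) (a b : R) (ab : a < b).
Notation C := R[i].
Notation T := (measurableTypeR R).
Notation leb := (@leb R).
Notation D := (`[a, b[%classic : set T).
Implicit Types (x y s t : R) (f g F dF G K : R -> C).

(** Integration of [f] against the complex measure [g omega + k upsilon]. *)
Definition src g k x y f : C :=
  sint omega x y (fun s => g s * f s) + mint upsilon x y (fun s => k s * f s).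

Lemma mfam_src G K : bml G -> lint upsilon K -> mfam (src G K).
Proof.
move=> bG lK.
have := mfam_lin 1 (mfam_mul (mfam_sint omega) bG) (mfam_mint upsilon_fin lK).
congr mfam; apply/funext => x; apply/funext => y; apply/funext => f.
by rewrite mul1r.
Qed.

Lemma eq_src g k G K x y f : x <= y -> (forall s, x <= s < y -> g s = G s) ->
  (forall s, x <= s < y -> k s = K s) -> src g k x y f = src G K x y f.
Proof.
move=> xy gG kK; rewrite /src (mf_ext (mfam_sint omega) (g := fun s => G s * f s) xy).
  by rewrite (@eq_mint _ _ _ _ _ (fun s => K s * f s) xy)// => s /kK ->.
by move=> s /gG ->.
Qed.

Lemma Omega_UpsilonE g k x : Omega0 omega a b g x + Upsilon0 upsilon a b k x =
  src g k a b (fun s => (K0 a b x s)%:C).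
Proof.
rewrite /Omega0 /Upsilon0 /src; congr (sint omega a b _ + mint upsilon a b _);
  by apply/funext => s; rewrite mulrC.
Qed.

(** The data of the boundary value problem are bounded by the supremum of [G] on
    the side of [omega], because [omega] is merely of bounded variation on
    [[a, b)], and by the integral of [K] on the side of [upsilon]. *)
Lemma potential_exists : exists2 M : R, 0 <= M & forall G K m, bml G -> lint upsilon K ->
  0 <= m -> (forall x, a <= x < b -> n1 (G x) <= m) ->
  exists F dF, [/\ lac F dF, F a = 0, F b = 0,
    forall x y, dF y - dF x = leb4 x y F - src G K x y (fun=> 1) &
    forall x, a <= x <= b ->
      n1 (dF x) <= M * (m + \int[upsilon]_(s in D) n1 (K s))].
Proof.
have [M1 M10 bvp] := bvp_exists ab.
have [_ [c1 ch1]] := lac_bml (lac_ch R) a b.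
have [_ [c2 sh2]] := lac_bml (lac_sh R) a b.
pose c0 := `|c1| + `|c2|.
have chc x : a <= x <= b -> n1 (ch x) <= c0.
  by move=> /ch1 h; rewrite (le_trans h)// /c0 (le_trans (ler_norm _))// lerDl.
have shc x : a <= x <= b -> n1 (sh x) <= c0.
  by move=> /sh2 h; rewrite (le_trans h)// /c0 (le_trans (ler_norm _))// lerDr.
have c00 : 0 <= c0 by rewrite addr_ge0.
have [M2 M20 sb] := mf_bound (mfam_sint omega) a b.
exists (M1 * ((M2 + 1) * c0)); first by rewrite !(mulr_ge0, addr_ge0).
move=> G K m bG lK m0 Gm.
pose J := \int[upsilon]_(s in D) n1 (K s).
have J0 : 0 <= J by apply: Rintegral_ge0 => s _; exact: n1_ge0.
(* [omega] is estimated by its total variation, [upsilon] through [K] itself *)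
have mN : mfam (fun x y f => - 1 * src G K x y f) by exact/mfamZ/mfam_src.
have est f : bml f -> (forall x, a <= x <= b -> n1 (f x) <= c0) ->
    forall x, a <= x <= b -> n1 (- 1 * src G K a x f) <= (M2 + 1) * c0 * (m + J).
  move=> bf fc x /andP[ax xb]; rewrite mulN1r n1N /src (le_trans (n1D _ _))//.
  have in_ab s : a <= s < x -> a <= s <= b /\ a <= s < b.
    by move=> /andP[-> sx]; rewrite (le_trans (ltW sx) xb) (lt_le_trans sx xb).
  have b1 : n1 (sint omega a x (fun s => G s * f s)) <= M2 * (m * c0).
    apply: sb => //; [exact: bmlM|exact: mulr_ge0|].
    by move=> s /in_ab[h1 h2]; rewrite (le_trans (n1M _ _))// ler_pM ?n1_ge0 ?Gm ?fc.
  have b2 : n1 (mint upsilon a x (fun s => K s * f s)) <= J * c0.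
    have lKf : lint upsilon (fun s => K s * f s) by exact: bml_lintM.
    have iK : upsilon.-integrable D (EFin \o (fun s => n1 (K s))).
      by apply: cintegrable_n1 => //; exact: lK.
    have iKx : upsilon.-integrable `[a, x[ (EFin \o (fun s => n1 (K s))).
      by apply: cintegrable_n1 => //; exact: lK.
    have iKc : upsilon.-integrable `[a, x[ (EFin \o (fun s => n1 (K s) * c0)).
      exact: (@integrableM_bounded _ _ _ _ (cst c0) `|c0|).
    rewrite mintE//; apply: (@le_trans _ _ (\int[upsilon]_(s in `[a, x[) (n1 (K s) * c0))).
      apply: n1_cint_le => // s; rewrite itvcoE => /in_ab[h1 h2].
      by rewrite (le_trans (n1M _ _))// ler_wpM2l ?n1_ge0 ?fc.
    rewrite RintegralZr// ler_wpM2r//; apply: Rintegral_subitv => //.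
    by move=> s; exact: n1_ge0.
  apply: (le_trans (lerD b1 b2)).
  have e1 : 0 <= M2 * c0 * J by rewrite !mulr_ge0.
  have e2 : 0 <= c0 * m by rewrite mulr_ge0.
  have -> : (M2 + 1) * c0 * (m + J) = M2 * (m * c0) + J * c0 + (M2 * c0 * J + c0 * m) by ring.
  by rewrite lerDl addr_ge0.
have bch := lac_bml (lac_ch R); have bsh := lac_bml (lac_sh R).
have pos : 0 <= (M2 + 1) * c0 * (m + J) by rewrite !(mulr_ge0, addr_ge0).
have [|F [dF [FdF Fa Fb dFE dFb]]] := bvp _ _ mN pos.
  by move=> x xab; split; exact: est.
exists F, dF; split => //.
  by move=> x y; rewrite dFE /leb4 mulN1r.
by move=> x xab; rewrite (le_trans (dFb _ xab))// mulrA.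
Qed.

End green_potentials.

(** * A class of smooth functions *)

Section smooth_functions.
Context (R : realType).
Implicit Types (x y t k c : R) (f g : R -> R).

Lemma is_derive_quotient f x (l : R) :
  h^-1 * (f (h + x) - f x) @[h --> 0^'] --> l -> is_derive x (1 : R) f l.
Proof.
move=> h.
have h' : (fun t : R => t^-1 *: (f (t *: (1 : R) + x) - f x)) @ 0^' --> l.
  apply: cvg_trans h; apply: near_eq_cvg; near=> t.
  by rewrite /GRing.scale /= mulr1.
split; first by apply/cvg_ex; exists l.
exact: cvg_lim h'.
Unshelve. all: by end_near. Qed.

(** The classical smooth functions that vanish to infinite order at [0]; the
    powers of [t^-1] are needed to be closed under differentiation. *)
Definition flat n t : R := if 0 < t then t^-1 ^+ n * expR (- t^-1) else 0.

Lemma flat_le0 n t : t <= 0 -> flat n t = 0.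
Proof. by rewrite /flat ltNge => ->. Qed.

Lemma flat_gt0 t : 0 < t -> 0 < flat 0 t.
Proof. by rewrite /flat => ->; rewrite expr0 mul1r expR_gt0. Qed.

Lemma flat_ge0 n t : 0 <= flat n t.
Proof.
rewrite /flat; case: ifP => // t0.
by rewrite mulr_ge0 ?expR_ge0// exprn_ge0// invr_ge0 ltW.
Qed.

(** The exponential series dominates every power of [t^-1]; hence the
    difference quotients of [flat] at [0] tend to [0]. *)
Lemma flat_bound n t : flat n.+1 t <= n.+2`!%:R * `|t|.
Proof.
rewrite /flat; case: ifP => t0; last by rewrite mulr_ge0.
rewrite gtr0_norm//; set s := t^-1.
have s0 : 0 < s by rewrite invr_gt0.
have -> : t = s^-1 by rewrite invrK.
have h : s ^+ n.+2 / n.+2`!%:R <= expR s.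
  by rewrite (le_trans _ (expR_ge1Dxn n.+1 (ltW s0)))// lerDr.
rewrite expRN ler_pdivrMr ?expR_gt0// mulrAC ler_pdivlMr// -exprSr.
by rewrite mulrC -ler_pdivrMr ?ltr0n ?fact_gt0.
Qed.

Lemma is_derive_flat n x :
  is_derive x (1 : R) (flat n) (flat n.+2 x - n%:R * flat n.+1 x).
Proof.
have [x0|x0|x0] := ltgtP 0 x.
- have dV : is_derive x (1 : R) (fun t => t^-1) (- x ^- 2).
    have x0' : x != 0 by rewrite gt_eqF.
    split; first exact: (@derivableV R R^o id).
    by rewrite (@deriveV R R^o id)// derive_id /GRing.scale /= mulr1.
  have dN : is_derive x (1 : R) (fun t => - t^-1) (x ^- 2).
    by have := is_deriveN dV; rewrite opprK.
  have h := is_deriveM (is_deriveX n dV) (is_derive1_comp (is_derive_expR _) dN).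
  apply: (@near_eq_is_derive _ _ _ ((fun t => t^-1) ^+ n * (expR \o (fun t => - t^-1)))).
    near=> t; rewrite /flat ifT; first by rewrite fctE /= exprfctE.
    by near: t; exact: lt_nbhsr.
  apply: (is_derive_eq h); rewrite /flat x0 /GRing.scale /= exprfctE.
  rewrite -!exprVn; set s := x^-1; set E := expR _.
  case: (n) => [|k]; first by rewrite /=; ring.
  by rewrite /= !exprS; ring.
- rewrite !flat_le0 ?ltW// mulr0 subr0.
  apply: (@near_eq_is_derive R R^o R^o (cst 0)).
  near=> t; rewrite flat_le0//; apply: ltW; near: t; exact: lt_nbhsl.
rewrite -x0 !flat_le0// mulr0 subr0.
apply: is_derive_quotient; apply/cvgrPdist_le => e e0.
near=> h; rewrite addr0 [flat n 0]flat_le0// subr0 sub0r normrN.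
have [h0|h0] := leP h 0; first by rewrite flat_le0// mulr0 normr0 ltW.
have -> : h^-1 * flat n h = flat n.+1 h by rewrite /flat h0 mulrA exprS.
rewrite ger0_norm ?flat_ge0// (le_trans (flat_bound _ _))//.
rewrite mulrC -ler_pdivlMr ?ltr0n ?fact_gt0//.
near: h; apply: dnbhs0_le; rewrite divr_gt0// ltr0n fact_gt0.
Unshelve. all: by end_near. Qed.

(** Closed under differentiation by [smooth_class_derive], so that all its
    members are infinitely differentiable; the last clause admits primitives. *)
Inductive smooth_class : (R -> R) -> Prop :=
| SmoothFlat n : smooth_class (flat n)
| SmoothExp k : smooth_class (fun x => expR (k * x))
| SmoothCst k : smooth_class (fun=> k)
| SmoothAdd f g : smooth_class f -> smooth_class g -> smooth_class (fun x => f x + g x)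
| SmoothMul f g : smooth_class f -> smooth_class g -> smooth_class (fun x => f x * g x)
| SmoothAff f k c : smooth_class f -> smooth_class (fun x => f (k * x + c))
| SmoothPrim f g : smooth_class f -> (forall x, is_derive x (1 : R) g (f x)) ->
    smooth_class g.

Lemma smooth_class_derive f : smooth_class f ->
  exists2 g, smooth_class g & forall x, is_derive x (1 : R) f (g x).
Proof.
elim=> {f}.
- move=> n; exists (fun x => flat n.+2 x + (- n%:R) * flat n.+1 x).
    by apply: SmoothAdd; [|apply: SmoothMul; [exact: SmoothCst|]]; exact: SmoothFlat.
  by move=> x; rewrite mulNr; exact: is_derive_flat.
- move=> k; exists (fun x => k * expR (k * x)).
    by apply: SmoothMul; [exact: SmoothCst|exact: SmoothExp].
  exact: is_derive_expR_scale.
- by move=> k; exists (fun=> 0); [exact: SmoothCst|move=> x; exact: is_derive_cst].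
- move=> f g sf [f' sf' df] sg [g' sg' dg]; exists (fun x => f' x + g' x).
    exact: SmoothAdd.
  by move=> x; exact: is_deriveD.
- move=> f g sf [f' sf' df] sg [g' sg' dg].
  exists (fun x => f x * g' x + g x * f' x).
    by apply: SmoothAdd; exact: SmoothMul.
  by move=> x; exact: is_deriveM.
- move=> f k c sf [f' sf' df]; exists (fun x => f' (k * x + c) * k).
    by apply: SmoothMul; [exact: SmoothAff|exact: SmoothCst].
  move=> x.
  have h : is_derive x (1 : R) (fun x => k * x + c) k.
    by apply: is_derive_eq; rewrite /GRing.scale /= mulr1 addr0.
  exact: (@is_derive1_comp _ f (fun x => k * x + c) x _ k (df _) h).
- by move=> f g sf _ dg; exists f.
Qed.

Lemma smooth_classP f : smooth_class f -> forall n x, derivable (derive1n n f) x 1.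
Proof.
move=> sf n; suff : smooth_class (derive1n n f).
  by move=> /smooth_class_derive[g _ dg] x; have dgx := dg x; exact: ex_derive.
elim: n => [|n IH]; first exact: sf.
rewrite derive1nS; have [g sg dg] := smooth_class_derive IH.
have -> // : (derive1n n f)^`()%classic = g.
by apply/funext => x; rewrite derive1E; have dgx := dg x; exact: derive_val.
Qed.

Lemma derive1_is f g : (forall x, is_derive x (1 : R) f (g x)) -> f^`()%classic = g.
Proof.
by move=> h; apply/funext => x; rewrite derive1E; have hx := h x; exact: derive_val.
Qed.

Lemma is_derive_continuous f g : (forall x, is_derive x (1 : R) f (g x)) -> continuous f.
Proof.
move=> h x; apply: differentiable_continuous; apply/derivable1_diffP.
by have hx := h x; exact: ex_derive.
Qed.

Lemma smooth_class_continuous f : smooth_class f -> continuous f.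
Proof. by move=> /smooth_class_derive[g _]; exact: is_derive_continuous. Qed.

Lemma derive_left0 g x : derivable g x 1 -> (forall t, t <= x -> g t = 0) -> g^`()%classic x = 0.
Proof.
move=> dg g0; have /cvg_dnbhs_at_left := dg.
have h0 : (fun h : R => h^-1 *: (g (h *: (1 : R) + x) - g x)) @ 0^'- --> (0 : R).
  apply: cvg_near_cst; near=> h; rewrite !g0 ?subrr ?scaler0//.
  rewrite /GRing.scale /= mulr1 -lerBrDr subrr; near: h; exact: nbhs_left_le.
move=> h1; have := cvg_unique _ h1 h0; rewrite derive1E /derive.
by apply; exact: Rhausdorff.
Unshelve. all: by end_near. Qed.

Lemma derive_right0 g x : derivable g x 1 -> (forall t, x <= t -> g t = 0) -> g^`()%classic x = 0.
Proof.
move=> dg g0; have /cvg_dnbhs_at_right := dg.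
have h0 : (fun h : R => h^-1 *: (g (h *: (1 : R) + x) - g x)) @ 0^'+ --> (0 : R).
  apply: cvg_near_cst; near=> h; rewrite !g0 ?subrr ?scaler0//.
  rewrite /GRing.scale /= mulr1 -lerBlDr subrr; near: h; exact: nbhs_right_ge.
move=> h1; have := cvg_unique _ h1 h0; rewrite derive1E /derive.
by apply; exact: Rhausdorff.
Unshelve. all: by end_near. Qed.

(** All derivatives are continuous and vanish on one side of the endpoints. *)
Lemma test_fun_out c d (h : R -> R) : c < d -> test_fun c d h ->
  forall n x, (x <= c) || (d <= x) -> derive1n n h x = 0.
Proof.
move=> cd [sh h0]; elim=> [|n IH] x xo.
  rewrite derive1n0; case/orP: xo => [|dx]; last first.
    by apply: h0; rewrite in_itv /= negb_and -leNgt dx orbT.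
  rewrite le_eqVlt => /predU1P[->|xc]; last first.
    by apply: h0; rewrite in_itv /= negb_and -ltNge xc.
  have hc : h t @[t --> c^'-] --> h c.
    apply: cvg_at_left_filter; apply: differentiable_continuous.
    by apply/derivable1_diffP; exact: (sh 0%N c).
  have h1 : h t @[t --> c^'-] --> (0 : R).
    apply: cvg_near_cst; near=> t; apply: h0; rewrite in_itv /= negb_and -ltNge.
    by apply/orP; left; near: t; exact: nbhs_left_lt.
  by have := cvg_unique _ hc h1; apply; exact: Rhausdorff.
rewrite derive1nS; case/orP: xo => xo.
  by apply: derive_left0 => // t tx; apply: IH; rewrite (le_trans tx xo).
by apply: derive_right0 => // t tx; apply: IH; rewrite (le_trans xo tx) orbT.
Unshelve. all: by end_near. Qed.

End smooth_functions.

(** * Distributional solutions and a mollified fundamental solution *)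

Section distributions.
Context (R : realType).
Notation C := R[i].
Notation leb := (@leb R).
Implicit Types (x y s t a b c d : R) (U F dF G K u v w : R -> C)
  (N : R -> R -> (R -> C) -> C).

Lemma test_fun_lac c d (h : R -> R) n : test_fun c d h ->
  lac (fun x => (derive1n n h x)%:C) (fun x => (derive1n n.+1 h x)%:C).
Proof.
move=> [sh _]; apply: lac_C1 => x.
  by rewrite derive1nS derive1E; apply/derivableP; exact: sh.
by apply: differentiable_continuous; apply/derivable1_diffP; exact: (sh n.+1 x).
Qed.

(** Two integrations by parts, the first one for the measure with distribution
    function [dF] and the second one for the density [w]. *)
Lemma weak_form N F dF u v w c d : mfam N -> lac F dF ->
  (forall x y, dF y - dF x = leb4 x y F - N x y (fun=> 1)) ->
  lac u v -> lac v w -> u c = 0 -> u d = 0 -> v c = 0 -> v d = 0 -> bml w ->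
  mint leb c d (fun x => F x * (- w x + 4^-1 * u x)) = N c d u.
Proof.
move=> mN FdF dFE uv vw uc ud vc vd bw.
have bF := lac_bml FdF; have bu := lac_bml uv; have bv := lac_bml vw.
have lleb f : bml f -> lint leb f by apply: bml_lint; exact: leb_locally_finite.
have mw := mfam_mul (mfam_leb R) bw.
have dw : dist_fun v (fun x y f => mint leb x y (fun s => w s * f s)).
  by move=> x y; rewrite vw.2; congr mint; apply/funext => s; rewrite mulr1.
have e1 := integration_by_parts mw FdF dw c d.
have mQ := mfam_lin (- 1) mN (mfam_mul (mfam_leb4 R) bF).
have dQ : dist_fun dF (fun x y f => - 1 * N x y f + leb4 x y (fun s => F s * f s)).
  move=> x y; rewrite dFE mulN1r addrC; congr (_ + _).
  by rewrite /leb4; congr (_ * mint _ _ _ _); apply/funext => s; rewrite mulr1.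
have e2 := integration_by_parts mQ uv dQ c d.
rewrite vc vd !mulr0 subrr sub0r in e1.
rewrite uc ud !mul0r subrr sub0r in e2.
rewrite (_ : (fun x => F x * (- w x + 4^-1 * u x)) =
   (fun x => (-1) * (w x * F x) + 4^-1 * (F x * u x))); last first.
  by apply/funext => x; ring.
have l1 : lint leb (fun x => w x * F x) by apply: lleb; exact: bmlM.
have l2 : lint leb (fun x => F x * u x) by apply: lleb; exact: bmlM.
rewrite mintD; [|exact: lintZ|exact: lintZ].
rewrite !mintZ// mulN1r -e1.
have -> : mint leb c d (fun t => dF t * v t) = mint leb c d (fun t => v t * dF t).
  by congr mint; apply/funext => t; rewrite mulrC.
by rewrite e2 /leb4; ring.
Qed.

Lemma strong_distr omega (upsilon : {measure set (measurableTypeR R) -> \bar R}) F dF G K :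
  locally_finite upsilon -> bml G -> lint upsilon K -> lac F dF ->
  (forall x y, dF y - dF x = leb4 x y F - src omega upsilon G K x y (fun=> 1)) ->
  distr_eq omega upsilon F G K.
Proof.
move=> uf bG lK FdF dFE c d h cd th.
have out := test_fun_out cd th.
have h0 := test_fun_lac 0 th; have h1 := test_fun_lac 1 th.
have b2 := lac_bml (test_fun_lac 2 th).
have zc n : (derive1n n h c)%:C = 0 :> C by rewrite out// lexx.
have zd n : (derive1n n h d)%:C = 0 :> C by rewrite out// lexx orbT.
have := weak_form (mfam_src omega uf bG lK) FdF dFE h0 h1 (zc _) (zd _) (zc _) (zd _) b2.
rewrite /src derive1n0 => <-; apply: eq_mint; first exact: ltW.
by move=> x _; rewrite rmorphD rmorphN rmorphM fmorphV rmorph_nat.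
Qed.

End distributions.

Section fundamental_solution.
Context (R : realType).
Notation C := R[i].
Notation leb := (@leb R).
Implicit Types (x y s t a b c d : R).

(** Variation of constants for [h'' = h / 4 + rho] with a smooth bump [rho]
    supported in [[- e, 0]] and [h = 0] on the left of it.  To the right of the
    bump the solution is a combination of two exponentials whose coefficients
    [m1] and [m2] do not change under translations, so that suitable
    combinations of translates cancel there. *)
Lemma mollified_fundamental (e : R) : 0 < e ->
  exists rho Rho Phi dPhi : R -> R, exists m1 m2 : R,
  [/\ [/\ smooth_class rho, smooth_class Phi,
     (forall x, is_derive x (1 : R) Rho (rho x)),
     (forall x, is_derive x (1 : R) Phi (dPhi x)) &
     (forall x, is_derive x (1 : R) dPhi (4^-1 * Phi x + rho x))],
   [/\ (forall x, 0 <= rho x), (forall x, (x <= - e) || (0 <= x) -> rho x = 0),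
    0 < Rho 0 - Rho (- e), (forall x, x <= - e -> Rho x = Rho (- e)) &
    (forall x, 0 <= x -> Rho x = Rho 0)],
   (forall x, x <= - e -> Phi x = 0) &
   (forall x, 0 <= x -> Phi x = m1 * expR (2^-1 * x) - m2 * expR (- 2^-1 * x))].
Proof.
move=> e0.
pose rho x := flat 0 (- 1 * x + 0) * flat 0 (1 * x + e).
have srho : smooth_class rho.
  by apply: SmoothMul; apply: (SmoothAff (f := flat 0)); exact: SmoothFlat.
have rho_out x : (x <= - e) || (0 <= x) -> rho x = 0.
  rewrite /rho; case/orP => h.
    by rewrite [flat 0 (1 * x + e)]flat_le0 ?mulr0//; lra.
  by rewrite [flat 0 (- 1 * x + 0)]flat_le0 ?mul0r//; lra.
have rho0 x : 0 <= rho x by rewrite mulr_ge0// flat_ge0.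
have prim (f : R -> R) : smooth_class f -> exists2 F : R -> R,
    smooth_class (fun x => F x) & [/\ forall x, is_derive x (1 : R) F (rho x * f x),
      forall x, x <= - e -> F x = 0 & forall x, 0 <= x -> F x = F 0].
  move=> sf; pose g x := rho x * f x.
  have sg : smooth_class g by exact: SmoothMul.
  have cg := smooth_class_continuous sg.
  have g_out x : (x <= - e) || (0 <= x) -> g x = 0 by move=> h; rewrite /g rho_out ?mul0r.
  have ig0 : leb.-integrable `[- e, 0] (EFin \o g).
    by apply: continuous_compact_integrable; [exact: segment_compact|exact: continuous_subspaceT].
  have igT : leb.-integrable setT (EFin \o g).
    have mI : measurable (`[- e, 0]%classic : set (measurableTypeR R)) by exact: measurable_itv.
    have : leb.-integrable setT ((EFin \o g) \_ `[- e, 0]).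
      exact: (integrable_mkcond _ mI).1.
    apply: eq_integrable => // x _; rewrite /patch; case: ifPn => //.
    rewrite notin_setE /= in_itv /= => /negP; rewrite negb_and -!ltNge => h.
    by case/orP: h => /ltW h; rewrite g_out// h ?orbT.
  have ig (D : set R) : measurable (D : set (measurableTypeR R)) -> leb.-integrable D (EFin \o g).
    by move=> mD; exact: integrableS igT.
  pose F x := \int[lebesgue_measure]_(t in `]-oo, x]) g t.
  have dF x : is_derive x (1 : R) F (g x).
    have xx1 : x < x + 1 by rewrite ltrDl.
    have iu : lebesgue_measure.-integrable `]-oo, (x + 1)] (EFin \o g).
      by apply: ig; exact: measurable_itv.
    have [d1 d2] := @continuous_FTC1 _ g -oo%O x (x + 1) xx1 iu (ltNyr x) (cg x).
    by split; [exact: d1|rewrite -derive1E].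
  exists F; first exact: SmoothPrim sg dF.
  split => // x hx.
    rewrite /F (@eq_Rintegral _ _ _ _ _ (cst 0)) ?Rintegral_cst ?mul0r//.
    move=> t /set_mem /=; rewrite in_itv /= => tx; apply: g_out.
    by rewrite (le_trans tx hx).
  rewrite /F Rintegral_mkcond [RHS]Rintegral_mkcond; apply: eq_Rintegral => t _.
  rewrite /patch !(mem_setE) /=; case: (leP t 0) => t0.
    by rewrite !in_itv /= t0 (le_trans t0 hx).
  have -> : g t = 0 by rewrite g_out// (ltW t0) orbT.
  by case: ifP; case: ifP.
have [A sA [dA A0 A1]] := prim (fun x => expR (- 2^-1 * x)) (SmoothExp _).
have [B sB [dB B0 B1]] := prim (fun x => expR (2^-1 * x)) (SmoothExp _).
have [Rh sR [dR R0 R1]] := prim (fun=> 1) (SmoothCst _).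
(* the kernel is [2 * sinh ((x - t) / 2)], split by the addition theorem *)
pose Phi x := expR (2^-1 * x) * A x + (-1) * (expR (- 2^-1 * x) * B x).
pose dPhi x := 2^-1 * (expR (2^-1 * x) * A x + expR (- 2^-1 * x) * B x).
have E1 x := is_derive_expR_scale 2^-1 x; have E2 x := is_derive_expR_scale (- 2^-1) x.
have pq x : expR (2^-1 * x) * expR (- 2^-1 * x) = 1 by rewrite -expRD mulNr subrr expR0.
exists rho, Rh, Phi, dPhi, (A 0), (B 0).
have sPhi : smooth_class Phi.
  apply: SmoothAdd; first by apply: SmoothMul => //; exact: SmoothExp.
  apply: SmoothMul; first exact: SmoothCst.
  by apply: SmoothMul => //; exact: SmoothExp.
split.
- split => //.
  + by move=> x; have := dR x; rewrite mulr1.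
  + move=> x; have h := is_deriveD (is_deriveM (E1 x) (dA x))
      (is_deriveM (is_derive_cst (-1 : R) x (1 : R)) (is_deriveM (E2 x) (dB x))).
    apply: (is_derive_eq h); rewrite /dPhi /GRing.scale /=.
    transitivity (2^-1 * (expR (2^-1 * x) * A x + expR (- 2^-1 * x) * B x) +
      (rho x * (expR (2^-1 * x) * expR (- 2^-1 * x)) - rho x * (expR (2^-1 * x) * expR (- 2^-1 * x)))).
      by ring.
    by rewrite subrr addr0.
  + move=> x; have h := is_deriveM (is_derive_cst (2^-1 : R) x (1 : R))
      (is_deriveD (is_deriveM (E1 x) (dA x)) (is_deriveM (E2 x) (dB x))).
    apply: (is_derive_eq h); rewrite /Phi /GRing.scale /=.
    transitivity (4^-1 * (expR (2^-1 * x) * A x + - 1 * (expR (- 2^-1 * x) * B x)) +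
      rho x * (expR (2^-1 * x) * expR (- 2^-1 * x))).
      by field.
    by rewrite pq mulr1.
- split => //.
  + rewrite subr_gt0; apply: (@gtr0_derive1_lt_cc _ Rh (- e) 0).
    * by move=> x _; have hx := dR x; exact: ex_derive.
    * move=> x; rewrite in_itv /= => /andP[h1 h2].
      rewrite derive1E; have hx := dR x; rewrite derive_val mulr1.
      by rewrite mulr_gt0// flat_gt0//; lra.
    * apply: continuous_subspaceT; exact: is_derive_continuous dR.
    * by rewrite in_itv /= lexx oppr_le0 ltW.
    * by rewrite in_itv /= lexx oppr_le0 ltW.
    * by rewrite oppr_lt0.
  + by move=> x hx; rewrite !R0.
- by move=> x hx; rewrite /Phi A0// B0// !mulr0 addr0.
- move=> x hx; rewrite /Phi A1// B1//; ring.
Qed.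

End fundamental_solution.

(** * Weyl's lemma *)

Section weyl.
Context (R : realType).
Notation C := R[i].
Notation leb := (@leb R).
Notation T := (measurableTypeR R).
Implicit Types (x y s t a b c d : R).

Lemma n1_scale (k : R) (z : C) : 0 <= k -> n1 (k%:C * z) = k * n1 z.
Proof.
by move=> k0; rewrite /n1 Re_mul Im_mul /= !mul0r subr0 addr0 !normrM ger0_norm// mulrDr.
Qed.

(** The bump [rho], moved to the left of [p], has total mass
    [Rho 0 - Rho (- e)], so that this is an average of [U p - U y]. *)
Lemma mollify (U : R -> C) (dU : R -> C) (rho Rho : R -> R) (e de c d p : R) :
  lac U dU -> 0 < e -> 0 <= de -> smooth_class rho ->
  (forall x, is_derive x (1 : R) Rho (rho x)) ->
  (forall x, 0 <= rho x) -> (forall x, (x <= - e) || (0 <= x) -> rho x = 0) ->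
  (forall x, x <= - e -> Rho x = Rho (- e)) -> (forall x, 0 <= x -> Rho x = Rho 0) ->
  c <= p - e -> p <= d ->
  (forall t, p - e < t -> t < p -> n1 (U p - U t) < de) ->
  n1 ((Rho 0 - Rho (- e))%:C * U p -
      mint leb c d (fun y => (rho (1 * y + - p))%:C * U y)) <= (Rho 0 - Rho (- e)) * de.
Proof.
move=> UdU e0 de0 srho dRho rho0 rho_out Rho0 Rho1 cp pd Up.
have cd : c <= d by move: cp pd e0; lra.
pose r y := rho (1 * y + - p).
have bU := lac_bml UdU.
have lr : lac (fun y => (Rho (1 * y + - p))%:C) (fun y => (r y)%:C).
  apply: lac_C1.
    move=> y; have h : is_derive y (1 : R) (fun y => 1 * y + - p) 1.
      by apply: is_derive_eq; rewrite /GRing.scale /=; ring.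
    by have := is_derive1_comp (dRho _) h; rewrite mulr1.
  by apply: smooth_class_continuous; exact: (SmoothAff 1 (- p) srho).
have br : bml (fun y => (r y)%:C).
  have sr : smooth_class r by exact: (SmoothAff 1 (- p) srho).
  have [r' sr' dr'] := smooth_class_derive sr.
  exact: lac_bml (lac_C1 dr' (smooth_class_continuous sr')).
have mE : mint leb c d (fun y => (r y)%:C) = (Rho 0 - Rho (- e))%:C.
  rewrite -lr.2 -rmorphB; congr (_ - _)%:C.
    by rewrite Rho1//; move: pd; lra.
  by rewrite Rho0//; move: cp; lra.
have lleb f : bml f -> lint leb f by apply: bml_lint; exact: leb_locally_finite.
have -> : (Rho 0 - Rho (- e))%:C * U p - mint leb c d (fun y => (r y)%:C * U y) =
    mint leb c d (fun y => (r y)%:C * (U p - U y)).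
  rewrite -mE mulrC -mintZ; last exact: lleb.
  rewrite -(mfB _ _ (mfam_leb R)); [|exact: bmlZ|exact: bmlM].
  by congr mint; apply/funext => y; ring.
have lrU : lint leb (fun y => (r y)%:C * (U p - U y)).
  by apply: lleb; apply: bmlM => //; apply: bmlB => //; exact: bml_cst.
have ir : leb.-integrable `[c, d[ (EFin \o r) by exact: (lr.1 c d).1.
rewrite mintE//; apply: (@le_trans _ _ (\int[leb]_(s in `[c, d[) (r s * de))).
  apply: n1_cint_le => //.
    exact: (@integrableM_bounded _ _ _ _ (cst de) `|de|).
  move=> y _; rewrite n1_scale; last exact: rho0.
  have [->|rn0] := eqVneq (r y) 0; first by rewrite !mul0r.
  rewrite ler_wpM2l ?rho0// ltW//.
  have : ~~ ((1 * y + - p <= - e) || (0 <= 1 * y + - p)).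
    by apply: contra rn0 => h; apply/eqP; exact: rho_out.
  by rewrite negb_or -!ltNge => /andP[h1 h2]; apply: Up; move: h1 h2; lra.
rewrite RintegralZr// ler_wpM2r//.
by have := congr1 (@complex.Re R) mE; rewrite mintE//= => ->.
Qed.

(** Three translates of a mollified fundamental solution, to [a], [x] and [b],
    span a two-dimensional space to the right of [b]; the combination with
    coefficients [sinh ((b - x) / 2)], [- sinh ((b - a) / 2)] and
    [sinh ((x - a) / 2)] vanishes there and hence is a test function.  Tested
    against it, the equation expresses the average of [U] near [x] by the
    averages near [a] and [b], which are small. *)
Lemma weyl_lemma (U dU : R -> C) a b x : lac U dU ->
  (forall c d h, c < d -> test_fun c d h ->
     mint leb c d (fun y => U y * (- derive1n 2 h y + 4^-1 * h y)%:C) = 0) ->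
  U a = 0 -> U b = 0 -> a < x -> x < b -> U x = 0.
Proof.
move=> UdU hU Ua Ub ax xb.
pose c1 := sinh ((b - x) / 2); pose c2 := - sinh ((b - a) / 2); pose c3 := sinh ((x - a) / 2).
have c20 : c2%:C != 0 :> C.
  rewrite fmorph_eq0 oppr_eq0 gt_eqF// sinh_gt0// divr_gt0// subr_gt0.
  exact: lt_trans ax xb.
have bU := lac_bml UdU.
suff : c2%:C * U x = 0 by move/eqP; rewrite mulf_eq0 (negbTE c20) => /eqP.
apply: n1_small => de de0.
(* [de / L] is the oscillation of [U] allowed at each of the three points *)
pose L := `|c1| + `|c2| + `|c3| + 1.
have L0 : 0 < L by rewrite ltr_wpDl// !addr_ge0.
have deL : 0 < de / L by exact: divr_gt0.
have [t1 t1a ha] := lac_left_cont a UdU deL.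
have [t2 t2x hx] := lac_left_cont x UdU deL.
have [t3 t3b hb] := lac_left_cont b UdU deL.
pose e := Num.min (a - t1) (Num.min (x - t2) (b - t3)).
have e0 : 0 < e by rewrite !lt_min !subr_gt0 t1a t2x t3b.
have e1 : e <= a - t1 by rewrite ge_min lexx.
have e2 : e <= x - t2 by rewrite !ge_min lexx orbT.
have e3 : e <= b - t3 by rewrite !ge_min lexx !orbT.
have [rho [Rho [Phi [dPhi [m1 [m2 [[srho sPhi dRho dPhi1 dPhi2]
  [rho0 rho_out Rm Rho0 Rho1] Phi0 Phi1]]]]]]] := mollified_fundamental e0.
pose h y := c1 * Phi (1 * y + - a) + (c2 * Phi (1 * y + - x) + c3 * Phi (1 * y + - b)).
pose h1 y := c1 * dPhi (1 * y + - a) + (c2 * dPhi (1 * y + - x) + c3 * dPhi (1 * y + - b)).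
pose r y := c1 * rho (1 * y + - a) + (c2 * rho (1 * y + - x) + c3 * rho (1 * y + - b)).
have sh : smooth_class h.
  by apply: SmoothAdd; [|apply: SmoothAdd]; (apply: SmoothMul; [exact: SmoothCst|]);
    exact: (SmoothAff 1 _ sPhi).
have comb (f g : R -> R) y : (forall z, is_derive z (1 : R) f (g z)) ->
    is_derive y (1 : R)
      (fun y => c1 * f (1 * y + - a) + (c2 * f (1 * y + - x) + c3 * f (1 * y + - b)))
      (c1 * g (1 * y + - a) + (c2 * g (1 * y + - x) + c3 * g (1 * y + - b))).
  move=> fg.
  have tr q : is_derive y (1 : R) (fun y => f (1 * y + q)) (g (1 * y + q)).
    have hq : is_derive y (1 : R) (fun y => 1 * y + q) 1.
      by apply: is_derive_eq; rewrite /GRing.scale /=; ring.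
    by have := is_derive1_comp (fg _) hq; rewrite mulr1.
  have sc k q : is_derive y (1 : R) (fun y => k * f (1 * y + q)) (k * g (1 * y + q)).
    have h0 := is_deriveM (is_derive_cst (k : R) y (1 : R)) (tr q).
    by apply: (is_derive_eq h0); rewrite /GRing.scale /= mulr0 addr0.
  exact: (is_deriveD (sc _ _) (is_deriveD (sc _ _) (sc _ _))).
have hh1 : h^`()%classic = h1 by apply: derive1_is => y; exact: comb.
have h1h2 : h1^`()%classic = (fun y => 4^-1 * h y + r y).
  apply: derive1_is => y; have h0 := comb _ _ y dPhi2.
  by apply: (is_derive_eq h0); rewrite /h /r; ring.
(* the three translates cancel to the right of [b] *)
have th : test_fun (a - e) b h.
  split; first exact: smooth_classP.
  move=> y; rewrite in_itv /= negb_and -ltNge -leNgt => /orP[ya|by_].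
    by rewrite /h !Phi0 ?mulr0 ?addr0//; move: ya e0 ax xb; lra.
  rewrite /h !Phi1; try (move: by_ ax xb; lra).
  rewrite /c1 /c2 /c3 /sinh.
  have ex (u v : R) : expR (2^-1 * (1 * u + - v)) = expR (2^-1 * u) * expR (- 2^-1 * v).
    by rewrite -expRD; congr expR; ring.
  have ex' (u v : R) : expR (- 2^-1 * (1 * u + - v)) = expR (- 2^-1 * u) * expR (2^-1 * v).
    by rewrite -expRD; congr expR; ring.
  have eh (u v : R) : expR ((u - v) / 2) = expR (2^-1 * u) * expR (- 2^-1 * v).
    by rewrite -expRD; congr expR; ring.
  have eh' (u v : R) : expR (- ((u - v) / 2)) = expR (- 2^-1 * u) * expR (2^-1 * v).
    by rewrite -expRD; congr expR; ring.
  by rewrite !ex !ex' !eh !eh'; field.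
have cd : a - e < b by move: ax xb e0; clear; lra.
have := hU _ _ _ cd th.
pose J p := mint leb (a - e) b (fun y => (rho (1 * y + - p))%:C * U y).
have brho p : bml (fun y => (rho (1 * y + - p))%:C).
  have sr : smooth_class (fun y => rho (1 * y + - p)) by exact: (SmoothAff 1 (- p) srho).
  have [r' sr' dr'] := smooth_class_derive sr.
  exact: lac_bml (lac_C1 dr' (smooth_class_continuous sr')).
have bJ p : bml (fun y => (rho (1 * y + - p))%:C * U y) by exact: bmlM.
have mleb := mfam_leb R.
rewrite (_ : (fun y => U y * (- derive1n 2 h y + 4^-1 * h y)%:C) = (fun y =>
    - c1%:C * ((rho (1 * y + - a))%:C * U y) + (- c2%:C * ((rho (1 * y + - x))%:C * U y) +
      - c3%:C * ((rho (1 * y + - b))%:C * U y)))); last first.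
  apply/funext => y; rewrite derive1nS derive1n1 hh1 h1h2 opprD addrAC addNr add0r /r.
  by rewrite rmorphN !rmorphD !rmorphM; ring.
rewrite !mfD//; try (by apply: bmlZ); last by apply: bmlD; exact: bmlZ.
rewrite !mfZ// -/(J a) -/(J x) -/(J b) => J0.
set m := Rho 0 - Rho (- e) in Rm.
have K p : a <= p -> p <= b -> (forall t, p - e < t -> t < p -> n1 (U p - U t) < de / L) ->
    n1 (m%:C * U p - J p) <= m * (de / L).
  move=> ap pb hp; apply: (mollify UdU e0 (ltW deL) srho dRho rho0 rho_out) => //.
  by move: ap; lra.
have Ka : n1 (m%:C * U a - J a) <= m * (de / L).
  by apply: K; [|move: ax xb; lra|move=> t u v; apply: ha => //; move: u e1; lra].
have Kx : n1 (m%:C * U x - J x) <= m * (de / L).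
  by apply: K; [exact: ltW|exact: ltW|move=> t u v; apply: hx => //; move: u e2; lra].
have Kb : n1 (m%:C * U b - J b) <= m * (de / L).
  by apply: K; [exact: ltW (lt_trans ax xb)| |move=> t u v; apply: hb => //; move: u e3; clear; lra].
have E : m%:C * (c2%:C * U x) = c1%:C * (m%:C * U a - J a) +
   (c2%:C * (m%:C * U x - J x) + c3%:C * (m%:C * U b - J b)).
  rewrite Ua Ub !mulr0 !sub0r -[LHS]addr0 -J0; ring.
have : m * n1 (c2%:C * U x) <= m * de.
  rewrite -n1_scale ?(ltW Rm)// E.
  apply: (@le_trans _ _ (`|c1| * (m * (de / L)) + (`|c2| * (m * (de / L)) + `|c3| * (m * (de / L))))).
    have est k z : n1 z <= m * (de / L) -> n1 (k%:C * z) <= `|k| * (m * (de / L)).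
      by move=> hz; rewrite (le_trans (n1M _ _))// n1_real ler_wpM2l.
    rewrite (le_trans (n1D _ _))// lerD ?est// (le_trans (n1D _ _))// lerD ?est//.
  have -> : m * de = L * (m * (de / L)) by field; rewrite gt_eqF.
  have : 0 <= m * (de / L) by rewrite mulr_ge0// ltW.
  by rewrite /L !mulrDl mul1r; move: (m * (de / L)) `|c1| `|c2| `|c3|; clear => w u1 u2 u3 w0; lra.
by rewrite ler_pM2l.
Qed.

End weyl.

(** * The linear relation as an integral equation *)

Section relation_T0.
Context (R : realType) (omega : signed_borel R)
  (upsilon : {measure set (measurableTypeR R) -> \bar R})
  (upsilon_fin : locally_finite upsilon) (a b : R) (ab : a < b).
Notation C := R[i].
Notation T := (measurableTypeR R).
Notation leb := (@leb R).
Notation D := (`[a, b[%classic : set T).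
Notation cut := (cut a b).
Notation clamp := (clamp a b).
Implicit Types (x y s t : R) (f g F dF G K : R -> C)
  (m : {measure set T -> \bar R}).

Let mD : measurable D. Proof. exact: measurable_itv. Qed.

Lemma sqi_cut m f (E : set T) : measurable E ->
  square_integrable m D f -> square_integrable m E (cut f).
Proof.
move=> mE [[f1 f2] fi].
have M (h : C -> R) : h 0 = 0 -> measurable_fun D (fun s => h (f s) : R) ->
    measurable_fun E (fun s : T => h (cut f s) : R).
  move=> h0 mh; apply: measurable_funTS; apply/measurable_EFinP.
  rewrite /comp cut_patch//; apply/measurable_restrict => //.
  by rewrite setTI; exact/measurable_EFinP.
split; first by split; [exact: (M (@complex.Re R))|exact: (M (@complex.Im R))].
apply: (@integrableS _ _ _ _ setT) => //.
rewrite (@cut_patch R a b (@sq R) f (@sq0 R)).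
exact: (integrable_mkcond _ mD).1.
Qed.

Lemma lint_cut m f : locally_finite m -> square_integrable m D f -> lint m (cut f).
Proof.
by move=> lm sf x y; apply: sqi_cintegrable => //; exact: sqi_cut.
Qed.

Lemma cut_id f x : a <= x < b -> cut f x = f x.
Proof. by rewrite /cut => ->. Qed.

Lemma sqi_bml m f x y : locally_finite m -> bml f -> square_integrable m `[x, y[ f.
Proof.
move=> lm bf; have [mf [K fK]] := bf x y.
have sub := @subset_itvco_cc R x y.
apply: (@sqi_bounded _ _ _ _ K) => //; first exact: cmeasurableS sub mf.
by move=> s /sub /=; rewrite in_itv /=; exact: fK.
Qed.

Lemma H1_loc_lac f : H1_loc f -> exists df, lac f df.
Proof. by move=> [df [h _]]; exists df; exact/lacE. Qed.

Lemma clamp_H1_loc f df : h10_with a b f df -> H1_loc (fun x => f (clamp x)).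
Proof.
move=> [h s _ _]; exists (cut df); split; first exact/lacE/acw_lac.
by move=> x y; exact: sqi_cut.
Qed.

(** Weyl's lemma for the difference of the two solutions. *)
Lemma distr_eq_unique f df F dF G K : bml G -> lint upsilon K ->
  lac f df -> lac F dF -> distr_eq omega upsilon f G K -> distr_eq omega upsilon F G K ->
  f a = F a -> f b = F b -> forall x, a <= x <= b -> f x = F x.
Proof.
move=> bG lK lf lF eqf eqF fa fb x /andP[ax xb].
pose U x := f x + -1 * F x.
have lU : lac U (fun x => df x + -1 * dF x) by apply: lacD => //; exact: lacZ.
have Ua : U a = 0 by rewrite /U fa mulN1r subrr.
have Ub : U b = 0 by rewrite /U fb mulN1r subrr.
suff : U x = 0 by rewrite /U mulN1r => /eqP; rewrite subr_eq0 => /eqP.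
move: ax; rewrite le_eqVlt => /predU1P[<-//|ax].
move: xb; rewrite le_eqVlt => /predU1P[->//|xb].
apply: (weyl_lemma lU _ Ua Ub ax xb) => c d h cd th.
have h1 := eqf _ _ _ cd th; have h2 := eqF _ _ _ cd th.
have bk : bml (fun y => (- derive1n 2 h y + 4^-1 * h y)%:C).
  apply: (@eq_bml _ (fun y => -1 * (derive1n 2 h y)%:C + 4^-1 * (derive1n 0 h y)%:C)).
    by move=> y; rewrite mulN1r rmorphD rmorphN rmorphM fmorphV rmorph_nat.
  by apply: bmlD; apply: bmlZ; exact: lac_bml (test_fun_lac _ th).
have bf := lac_bml lf; have bF := lac_bml lF.
set k := fun y => _ in bk.
have E : (fun y => U y * k y) = (fun y => f y * k y + -1 * (F y * k y)).
  by apply/funext => y; rewrite /U; ring.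
rewrite -/k in h1 h2.
rewrite [X in mint _ _ _ X]E (mfD _ _ (mfam_leb R)); [|exact: bmlM|exact/bmlZ/bmlM].
rewrite (mfZ _ _ _ (mfam_leb R)); last exact: bmlM.
by rewrite [X in X + _]h1 [X in _ + _ * X]h2 mulN1r subrr.
Qed.

(** Continuity at [b]; functions on [[a, b)] carry no value there. *)
Lemma lac_eq_end f df g dg : lac f df -> lac g dg ->
  (forall x, a <= x < b -> f x = g x) -> f b = g b.
Proof.
move=> lf lg fg; apply/eqP; rewrite -subr_eq0; apply/eqP; apply: n1_small => e e0.
have [t1 t1b h1] := lac_left_cont b lf (divr_gt0 e0 (ltr0Sn _ 1)).
have [t2 t2b h2] := lac_left_cont b lg (divr_gt0 e0 (ltr0Sn _ 1)).
pose t := Num.max a (Num.max ((t1 + b) / 2) ((t2 + b) / 2)).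
have tb : t < b by rewrite !gt_max ab /=; apply/andP; split; lra.
have at_ : a <= t by rewrite le_max lexx.
have t1t : t1 < t by rewrite !lt_max; apply/orP; right; apply/orP; left; lra.
have t2t : t2 < t by rewrite !lt_max; apply/orP; right; apply/orP; right; lra.
have fgt : f t = g t by apply: fg; rewrite at_.
have -> : f b - g b = (f b - f t) + - (g b - g t) by rewrite fgt; ring.
by rewrite (le_trans (n1D _ _))// n1N [leRHS]splitr lerD// ltW// ?h1// h2.
Qed.

Lemma cmeasurable_itvco f : bml f -> cmeasurable D f.
Proof. by move=> bf; exact: (sqi_bml a b (@leb_locally_finite R) bf).1. Qed.

(** For an element of the relation, the potential of the source
    [tf.1 omega + tf.2 upsilon] is a second distributional solution with the same
    boundary values.  Conversely, the source is extended to the line, where its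
    potential is the first component of an element of the relation on the
    line. *)
Lemma T0P (f tf : cfun R * cfun R) : T0 omega upsilon a b (f, tf) <->
  [/\ H0 upsilon a b f, H0 upsilon a b tf,
    forall x, a <= x <= b ->
      f.1 x = Omega0 omega a b tf.1 x + Upsilon0 upsilon a b tf.2 x &
    {ae upsilon, forall x, a <= x < b -> f.2 x = tf.1 x}].
Proof.
have aab : a <= a <= b by rewrite lexx ltW.
have bab : a <= b <= b by rewrite lexx ltW.
split.
  move=> [/= Hf Htf [F [TF [[HF HTF FT F2]] [r1 r2] [t1 t2]]]].
  have [dF1 lF] := H1_loc_lac HF.1.
  have [dG lG] := H1_loc_lac HTF.1.
  have bG := lac_bml lG.
  have lK : lint upsilon TF.2 by move=> x y; apply: sqi_cintegrable => //; exact: (HTF.2 x y).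
  have [Ft [dFt [lFt Fta Ftb dFtE]]] := dirichlet_exists ab (mfam_src omega upsilon_fin bG lK).
  have [df [hdf sdf fa fb]] := (H10P a b f.1).1 Hf.1.
  have [dtf [hdtf sdtf tfa tfb]] := (H10P a b tf.1).1 Htf.1.
  have Fa : F.1 a = Ft a by rewrite Fta -r1 ?lexx//.
  have Fb : F.1 b = Ft b.
    rewrite Ftb -fb -[in RHS](clamp_id bab); apply: (lac_eq_end lF (acw_lac ab hdf)).
    by move=> x /andP[h1 h2]; rewrite clamp_id ?r1 ?h1// ltW.
  have FE := distr_eq_unique bG lK lF lFt FT (strong_distr upsilon_fin bG lK lFt dFtE) Fa Fb.
  split => //.
    move=> x xab.
    have -> : f.1 x = F.1 x.
      case/andP: xab => ax; rewrite le_eqVlt => /predU1P[->|xb]; last by rewrite r1 ?ax.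
      by rewrite Fb Ftb fb.
    rewrite FE// (K0_representation ab (mfam_src omega upsilon_fin bG lK) lFt Fta Ftb dFtE xab).
    rewrite Omega_UpsilonE /src; congr (_ + _).
      apply: (mf_ext (mfam_sint omega)); first exact: ltW.
      by move=> s /t1 ->.
    have bK0' := bml_K0 a b x.
    rewrite !mintE ?ltW//; apply: ae_eq_cint.
    - apply: cmeasurableM; last exact: cmeasurable_itvco.
      exact: (HTF.2 a b).1.
    - apply: cmeasurableM; last exact: cmeasurable_itvco.
      exact: Htf.2.1.
    - by apply: ae_imp t2 => s h /h ->.
  by apply: ae_imp2 r2 F2 => s h1 h2 h; rewrite h1// h2 t1.
move=> [Hf Htf fE f2E].
have [df hdf] := (H10P a b f.1).1 Hf.1.
have [dtf hdtf] := (H10P a b tf.1).1 Htf.1.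
have [h1 s1 fa fb] := hdf; have [h2 s2 tfa tfb] := hdtf.
(* the source is extended by its boundary values and by zero *)
pose G x := tf.1 (clamp x); pose K := cut tf.2.
have lG := acw_lac ab h2; have bG : bml G := lac_bml lG.
have lK : lint upsilon K by apply: lint_cut => //; exact: Htf.2.
have Gid s : a <= s < b -> tf.1 s = G s.
  by move=> /andP[u v]; rewrite /G clamp_id// u ltW.
have Kid s : a <= s < b -> tf.2 s = K s by move=> h; rewrite /K cut_id.
have [F [dF [lF Fa Fb dFE]]] := dirichlet_exists ab (mfam_src omega upsilon_fin bG lK).
have FE x : a <= x <= b -> F x = f.1 x.
  move=> xab; rewrite fE// Omega_UpsilonE.
  rewrite (eq_src omega upsilon _ (ltW ab) Gid Kid).
  exact: (K0_representation ab (mfam_src omega upsilon_fin bG lK) lF Fa Fb dFE xab).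
split => //; exists (F, G), (G, K); split.
- split.
  + split; last by move=> x y; exact: sqi_bml.
    exists dF; split; first exact/lacE.
    move=> x y; apply: sqi_bml; first exact: leb_locally_finite.
    apply: (@eq_bml _ (fun t => dF 0 + (leb4 0 t F - src omega upsilon G K 0 t (fun=> 1)))).
      by move=> t; rewrite -dFE; ring.
    have b1 := @bml_cst R 1.
    apply: bmlD; first exact: bml_cst.
    apply: bmlB; first by apply: (mf_bml (mfam_leb4 R)); exact: lac_bml lF.
    exact: (mf_bml (mfam_src omega upsilon_fin bG lK)).
  + split; first exact: clamp_H1_loc hdtf.
    by move=> x y; apply: sqi_cut => //; exact: Htf.2.
  + exact: strong_distr dFE.
  + exact: aeW.
- split; first by move=> x /andP[u v] /=; rewrite FE// u ltW.
  by apply: ae_imp f2E => x h xab /=; rewrite h// Gid.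
- split; first by move=> x h /=; exact: Gid.
  by apply: aeW => x h /=; exact: Kid.
Qed.

End relation_T0.

(** * The quadratic operator pencil *)

Lemma constant_arith (R : realFieldType) (j d e i u : R) : j <= 2 * d * i ->
  0 <= u * i -> 0 <= d * e -> 2 * (2 * u * e) + 2 * j <= 2 * (2 * u + 2 * d) * (e + i).
Proof. lra. Qed.

Section pencil.
Context (R : realType) (omega : signed_borel R)
  (upsilon : {measure set (measurableTypeR R) -> \bar R})
  (upsilon_fin : locally_finite upsilon) (a b : R) (ab : a < b).
Notation C := R[i].
Notation T := (measurableTypeR R).
Notation leb := (@leb R).
Notation D := (`[a, b[%classic : set T).
Notation Om := (Omega0 omega a b).
Notation Up := (Upsilon0 upsilon a b).
Notation en := (energy a b).
Notation sqi := (square_integrable upsilon D).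
Notation L := (L0 omega upsilon a b).
Implicit Types (x y s t : R) (f g h w u df dg K : R -> C) (z k : C).

Let mD : measurable D. Proof. exact: measurable_itv. Qed.
Let Doo : (upsilon D < +oo)%E. Proof. exact: upsilon_fin. Qed.

(** The embedding into the square integrable functions of [upsilon], from
    [sobolev]. *)
Lemma h10_sqi : exists2 M : R, 0 <= M & forall f df, h10_with a b f df ->
  sqi f /\ \int[upsilon]_(s in D) sq (f s) <= M * en f.
Proof.
have d0 : 0 <= fine (upsilon D) by exact: fine_ge0.
have ba : 0 <= 2 * (b - a) by rewrite mulr_ge0// subr_ge0 ltW.
exists (fine (upsilon D) * (2 * (b - a))); first exact: mulr_ge0.
move=> f df hf.
have bf : bml (fun x => f (clamp a b x)) by have [h _ _ _] := hf; exact: lac_bml (acw_lac ab h).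
have E s : D s -> f (clamp a b s) = f s.
  by move=> /=; rewrite in_itv /= => /andP[h1 h2]; rewrite clamp_id// h1 ltW.
have mf : cmeasurable D f by apply: eq_cmeasurable E _; exact: cmeasurable_itvco.
have sb s : D s -> sq (f s) <= 2 * (b - a) * en f.
  move=> /=; rewrite in_itv /= => /andP[h1 h2].
  by apply: (le_trans (sq_le_n1 _)); apply: (sobolev ab hf); rewrite h1 ltW.
have e0 : 0 <= en f by have [h _ _ _] := hf; exact: energy_ge0 h.
have is_ : upsilon.-integrable D (EFin \o (sq (R:=R) \o f)).
  apply: (@integrable_bounded _ _ _ (sq (R:=R) \o f) (2 * (b - a) * en f)) => //.
    exact: measurable_sq.
  by move=> s Ds /=; rewrite ger0_norm ?sq_ge0// sb.
split; first by [].
rewrite -mulrA mulrC -(Rintegral_cst _ mD); apply: le_Rintegral => //.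
by apply: (@integrable_bounded _ _ _ (cst (2 * (b - a) * en f)) `|2 * (b - a) * en f|).
Qed.

Lemma H10_sqi (f : cfun R) : H10 a b f -> sqi f.
Proof. by have [M _ h] := h10_sqi => /H10P[df hf]; exact: (h _ _ hf).1. Qed.

(** Boundedness of the integral operators for the energy: [potential_exists]
    bounds the derivative of the potential uniformly, where [sobolev] bounds the
    supremum of [g] and Cauchy-Schwarz the integral of [K]. *)
Lemma potential_bounded : exists2 M : R, 0 <= M & forall g dg K,
  h10_with a b g dg -> sqi K ->
  (exists dp, h10_with a b (fun x => Om g x + Up K x) dp) /\
  en (fun x => Om g x + Up K x) <= M * (en g + \int[upsilon]_(s in D) sq (K s)).
Proof.
have [M1 M10 pot] := potential_exists omega upsilon_fin ab.
have d0 : 0 <= fine (upsilon D) by exact: fine_ge0.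
pose c := 4^-1 * (b - a) ^+ 3 + (b - a).
have c0 : 0 <= c by rewrite addr_ge0 ?mulr_ge0 ?exprn_ge0 ?subr_ge0// ltW.
pose l := 2 * (b - a) + 2 * fine (upsilon D).
have ba : 0 <= b - a by rewrite subr_ge0 ltW.
exists (c * M1 ^+ 2 * (2 * l)).
  have l0 : 0 <= l by rewrite addr_ge0 ?mulr_ge0.
  by rewrite !mulr_ge0 ?exprn_ge0.
move=> g dg K hg sK; have [h1 _ ga gb] := hg.
pose G x := g (clamp a b x); pose K' := cut a b K.
have lG := acw_lac ab h1; have bG : bml G := lac_bml lG.
have lK : lint upsilon K' by exact: lint_cut.
have Gid s : a <= s < b -> g s = G s by move=> /andP[u v]; rewrite /G clamp_id// u ltW.
have Kid s : a <= s < b -> K s = K' s by move=> h; rewrite /K' cut_id.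
have e0 : 0 <= en g by exact: energy_ge0 h1.
(* the supremum bound of [sobolev] *)
pose m := Num.sqrt (2 * (b - a) * en g).
have m0 : 0 <= m by exact: sqrtr_ge0.
have m2 : m ^+ 2 = 2 * (b - a) * en g by rewrite sqr_sqrtr// !mulr_ge0.
have Gm x : a <= x < b -> n1 (G x) <= m.
  move=> xab; rewrite -Gid// -(@ler_pXn2r _ 2) ?nnegrE ?n1_ge0// m2.
  by apply: (sobolev ab hg); case/andP: xab => -> /ltW.
have [F [dF [lF Fa Fb dFE dFb]]] := pot G K' m bG lK m0 Gm.
have FE x : a <= x <= b -> F x = Om g x + Up K x.
  move=> xab; rewrite Omega_UpsilonE (eq_src omega upsilon _ (ltW ab) Gid Kid).
  exact: (K0_representation ab (mfam_src omega upsilon_fin bG lK) lF Fa Fb dFE xab).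
set J := Rintegral _ _ _ in dFb; set I := Rintegral _ _ _.
have JE : J = \int[upsilon]_(s in D) n1 (K s).
  by apply: eq_Rintegral => s; rewrite inE /= in_itv /= => /Kid ->.
have J2 : J ^+ 2 <= 2 * fine (upsilon D) * I by rewrite JE; exact: n1_int_sqr_le.
have I0 : 0 <= I by apply: Rintegral_ge0 => s _; exact: sq_ge0.
have [|hF eF] := h10_bounded (K := M1 * (m + J)) ab lF Fa Fb.
  by move=> x /andP[ax xb]; apply: dFb; rewrite ax ltW.
split; first by exists dF; exact: eq_h10 FE hF.
rewrite -(eq_energy ab FE); apply: (le_trans eF).
rewrite -/c exprMn mulrA -[leRHS]mulrA; apply: ler_wpM2l; first by rewrite mulr_ge0 ?sqr_ge0.
have k2 : 0 <= (b - a) * I by rewrite mulr_ge0.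
have k3 : 0 <= fine (upsilon D) * en g by rewrite mulr_ge0.
apply: (le_trans (sqr_addr_le _ _)); rewrite m2; exact: constant_arith.
Qed.

Lemma Omega0_lin z g dg h dh x : h10_with a b g dg -> h10_with a b h dh ->
  Om (fun s => z * g s + h s) x = z * Om g x + Om h x.
Proof.
move=> [hg _ _ _] [hh _ _ _].
have bg := lac_bml (acw_lac ab hg); have bh := lac_bml (acw_lac ab hh).
have bk := bml_K0 a b x.
pose G s := (K0 a b x s)%:C * g (clamp a b s); pose H s := (K0 a b x s)%:C * h (clamp a b s).
have bG : bml G by exact: bmlM.
have bH : bml H by exact: bmlM.
have ci s : a <= s < b -> clamp a b s = s.
  by move=> /andP[u v]; rewrite clamp_id// u ltW.
have ext f1 f2 : (forall s, a <= s < b -> f1 s = f2 s) -> sint omega a b f1 = sint omega a b f2.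
  by apply: (mf_ext (mfam_sint omega)); exact: ltW.
have := mf_linear (mfam_sint omega) a b z bG bH; rewrite /Omega0.
rewrite -(ext (fun s => (K0 a b x s)%:C * g s) G); last by move=> s /ci; rewrite /G => ->.
rewrite -(ext (fun s => (K0 a b x s)%:C * h s) H); last by move=> s /ci; rewrite /H => ->.
by move=> <-; apply: ext => s /ci; rewrite /G /H => ->; ring.
Qed.

Lemma Upsilon0_lin z g h x : sqi g -> sqi h ->
  Up (fun s => z * g s + h s) x = z * Up g x + Up h x.
Proof.
move=> sg sh.
have [mk [k0 kb]] := bml_K0 a b x a b.
have sub : D `<=` `[a, b]%classic.
  by move=> s /=; rewrite !in_itv /= => /andP[-> /ltW].
have ci f : sqi f -> cintegrable upsilon D (fun s => (K0 a b x s)%:C * f s).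
  move=> sf; apply: (@eq_cintegrable _ _ _ (fun s => f s * (K0 a b x s)%:C)) => //.
    by move=> s _; rewrite mulrC.
  apply: (@cintegrableM _ _ _ _ _ k0) => //; first exact: sqi_cintegrable.
    exact: cmeasurableS sub mk.
  by move=> s /sub /=; rewrite in_itv /=; exact: kb.
rewrite /Upsilon0 !mintE ?ltW// -cintZ//; last exact: ci.
rewrite -cintD//; [|exact/cintegrableZ/ci|exact: ci].
by apply: eq_cint => s _; ring.
Qed.

Lemma h10_0 : h10_with a b (fun=> 0 : C) (fun=> 0).
Proof.
split => //; first by apply: lac_acw => //; exact: lac_cst.
by apply: (@sqi_bounded _ _ _ _ 0) => //; [exact: leb_locally_finite|move=> s _; rewrite n1_0].
Qed.

Lemma sqi0 : sqi (fun=> 0).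
Proof. by apply: (@sqi_bounded _ _ _ _ 0) => // s _; rewrite n1_0. Qed.

Lemma Omega0_0 x : Om (fun=> 0) x = 0.
Proof.
have := Omega0_lin (-1) x h10_0 h10_0.
by under [X in Om X]eq_fun do rewrite mulr0 addr0; rewrite mulN1r addNr.
Qed.

Lemma Upsilon0_0 x : Up (fun=> 0) x = 0.
Proof.
have := Upsilon0_lin (-1) x sqi0 sqi0.
by under [X in Up X]eq_fun do rewrite mulr0 addr0; rewrite mulN1r addNr.
Qed.

Lemma L0E z w x : L z w x = w x - z * Om w x - z ^+ 2 * Up w x.
Proof. by []. Qed.

Lemma L0_lin z k f df g dg x : h10_with a b f df -> h10_with a b g dg ->
  L z (fun s => k * f s + g s) x = k * L z f x + L z g x.
Proof.
have [M M0 hs] := h10_sqi.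
move=> hf hg; rewrite !L0E (Omega0_lin k x hf hg).
by rewrite Upsilon0_lin; [ring|exact: (hs _ _ hf).1|exact: (hs _ _ hg).1].
Qed.

Lemma L0_h10 z f df : h10_with a b f df -> exists dp, h10_with a b (L z f) dp.
Proof.
have [M M0 hs] := h10_sqi; have [M' M'0 pb] := potential_bounded.
move=> hf; have sf := (hs _ _ hf).1.
have z0 := sqi0.
have hz := h10_0.
have [[d1 h1] _] := pb _ _ _ hf z0; have [[d2 h2] _] := pb _ _ _ hz sf.
exists (fun x => - z * d1 x + (- z ^+ 2 * d2 x + df x)).
apply: (eq_h10 ab _ (h10_lin ab (- z) h1 (h10_lin ab (- z ^+ 2) h2 hf))) => x _.
by rewrite L0E Upsilon0_0 Omega0_0; ring.
Qed.

End pencil.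

(** * Resolvent sets *)

Lemma sqrt_le_scale (R : realType) (x y c : R) : 0 <= c -> x <= c * y ->
  Num.sqrt x <= Num.sqrt c * Num.sqrt y.
Proof. by move=> c0 h; rewrite -sqrtrM// ler_wsqrtr. Qed.

Lemma le_scale_sqrt (R : realType) (x y c : R) : 0 <= x -> 0 <= y ->
  Num.sqrt x <= c * Num.sqrt y -> x <= c ^+ 2 * y.
Proof.
move=> x0 y0 h; rewrite -(sqr_sqrtr x0) -(sqr_sqrtr y0) -exprMn.
by rewrite ler_pXn2r// nnegrE ?sqrtr_ge0// (le_trans _ h) ?sqrtr_ge0.
Qed.

Section resolvents.
Context (R : realType) (omega : signed_borel R)
  (upsilon : {measure set (measurableTypeR R) -> \bar R})
  (upsilon_fin : locally_finite upsilon) (a b : R) (ab : a < b).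
Notation C := R[i].
Notation T := (measurableTypeR R).
Notation leb := (@leb R).
Notation D := (`[a, b[%classic : set T).
Notation Om := (Omega0 omega a b).
Notation Up := (Upsilon0 upsilon a b).
Notation en := (energy a b).
Notation sqi := (square_integrable upsilon D).
Notation L := (L0 omega upsilon a b).
Notation T0 := (T0 omega upsilon a b).
Implicit Types (x y s t : R) (u w df dg K : R -> C) (z k : C).

Let mD : measurable D. Proof. exact: measurable_itv. Qed.
Let Doo : (upsilon D < +oo)%E. Proof. exact: upsilon_fin. Qed.

Lemma H10_lin z (f g : cfun R) : H10 a b f -> H10 a b g -> H10 a b (z *: f + g).
Proof.
move=> /H10P[df hf] /H10P[dg hg]; apply/H10P.
by exists (fun x => z * df x + dg x); exact: h10_lin.
Qed.

Lemma L0_H10 z (f : cfun R) : H10 a b f -> H10 a b (L z f).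
Proof. by move=> /H10P[df hf]; apply/H10P; exact: L0_h10 hf. Qed.

Lemma en_ge0 (f : cfun R) : H10 a b f -> 0 <= en f.
Proof. by move=> /H10P[df [h _ _ _]]; exact: energy_ge0 h. Qed.

Lemma en_lin z (f g : cfun R) : H10 a b f -> H10 a b g ->
  en (z *: f + g) <= 2 * sq z * en f + 2 * en g.
Proof.
by move=> /H10P[df [h1 s1 _ _]] /H10P[dg [h2 s2 _ _]]; exact: (energy_lin ab z h1 h2).
Qed.

Lemma energy0 (f : cfun R) : (forall x, a <= x <= b -> f x = 0) -> en f = 0.
Proof.
move=> f0; have -> : en f = en (fun=> 0) by exact: eq_energy.
have h : abs_cont_with a b (fun=> 0 : C) (fun=> 0) by apply: lac_acw => //; exact: lac_cst.
by rewrite (energyE ab h) sq0 !Rintegral_cst ?mul0r ?mulr0 ?addr0.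
Qed.

Lemma same_H10 (f g : cfun R) : H10 a b f -> H10 a b g ->
  same (H1_dot a b) f g <-> forall x, a <= x <= b -> f x = g x.
Proof.
move=> hf hg; have hfg : H10 a b (f - g).
  by rewrite addrC -scaleN1r; exact: H10_lin.
rewrite /same /norm_of -/(energy a b (f - g)); split=> [h|fg].
  have /H10P[d hd] := hfg.
  move=> x xab; apply/eqP; rewrite -subr_eq0; apply/eqP.
  apply: (energy_eq0 ab hd) => //; apply/eqP; rewrite eq_le en_ge0// andbT.
  by rewrite -sqrtr_eq0 h.
by rewrite energy0 ?sqrtr0// => x /fg fgx; rewrite [LHS]/= -[_ x]/(f x - g x) fgx subrr.
Qed.

(** A form without inverses that can be compared with the relation.  Elements
    at distance zero agree on [[a, b]], and the inverse is obtained by choice. *)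
Lemma pencil_resolventP z : pencil_resolvent_set (H10 a b) (H1_dot a b) L z <->
  (exists2 c, 0 <= c & forall w, H10 a b w -> en w <= c * en (L z w)) /\
  (forall g, H10 a b g -> exists2 w, H10 a b w & forall x, a <= x <= b -> L z w x = g x).
Proof.
split=> [[B [BH AB BA [c Bc]]]|[[c c0 Lc] Ls]].
  split.
    exists (c ^+ 2); first exact: sqr_ge0.
    move=> w hw; have hL := L0_H10 z hw.
    have /(same_H10 (BH _ hL) hw) E := BA w hw.
    rewrite -(eq_energy ab E); apply: le_scale_sqrt; [|exact: en_ge0|exact: Bc].
    by apply: en_ge0; exact: BH.
  move=> g hg; exists (B g); first exact: BH.
  by apply/(same_H10 _ hg)/AB => //; apply: L0_H10; exact: BH.
pose B (g : cfun R) : cfun R := xget 0 [set w | H10 a b w /\ forall x, a <= x <= b -> L z w x = g x].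
have Bs g : H10 a b g -> H10 a b (B g) /\ forall x, a <= x <= b -> L z (B g) x = g x.
  by move=> /Ls[w w1 w2]; apply: (@xgetPex _ 0 [set w | H10 a b w /\ forall x, a <= x <= b -> L z w x = g x]); exists w.
exists B; split.
- by move=> g /Bs[].
- by move=> g hg; have [h1 h2] := Bs _ hg; apply/same_H10 => //; exact: L0_H10.
- move=> f hf; have hL := L0_H10 z hf; have [h1 h2] := Bs _ hL.
  have hd : H10 a b (-1 *: f + B (L z f)) by exact: H10_lin.
  have Ld x : a <= x <= b -> L z (-1 *: f + B (L z f)) x = 0.
    have /H10P[df hf'] := hf; have /H10P[dB hB] := h1.
    move=> /h2 E; have := L0_lin omega upsilon_fin ab z (-1) x hf' hB.
    by rewrite E mulN1r addNr.
  rewrite /same (_ : _ - f = -1 *: f + B (L z f)); last by rewrite scaleN1r addrC.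
  have e0 : en (-1 *: f + B (L z f)) = 0.
    apply/eqP; rewrite eq_le en_ge0// andbT.
    by rewrite (le_trans (Lc _ hd))// energy0 ?mulr0.
  by rewrite /norm_of -/(energy a b _) e0 sqrtr0.
- exists (Num.sqrt c) => g hg; have [h1 h2] := Bs _ hg.
  have Bg : en (B g) <= c * en g by rewrite -(eq_energy ab h2); exact: Lc.
  exact: sqrt_le_scale c0 Bg.
Qed.

Notation H0 := (H0 upsilon a b).
Implicit Types (f g : cfun R * cfun R).

Lemma H0_lin z f g : H0 f -> H0 g -> H0 (z *: f + g).
Proof.
move=> [f1 f2] [g1 g2]; split; first exact: H10_lin.
exact: sqi_lin.
Qed.

Definition en0 f : R := en f.1 + \int[upsilon]_(s in D) sq (f.2 s).

Lemma norm_H0E f : norm_of (H0_dot upsilon a b) f = Num.sqrt (en0 f).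
Proof.
rewrite /norm_of /H0_dot Re_add -/(energy a b f.1) mintE ?ltW// /=.
congr (Num.sqrt (_ + _)); apply: eq_Rintegral => s _.
by rewrite /sq; case: (f.2 s) => p q /=; ring.
Qed.

Lemma int_sq_ge0 K : 0 <= \int[upsilon]_(s in D) sq (K s).
Proof. by apply: Rintegral_ge0 => s _; exact: sq_ge0. Qed.

Lemma en0_ge0 f : H0 f -> 0 <= en0 f.
Proof. by move=> [f1 _]; rewrite addr_ge0 ?en_ge0 ?int_sq_ge0. Qed.

Lemma ae_eq_Upsilon0 u w x : sqi u -> sqi w ->
  {ae upsilon, forall s, a <= s < b -> u s = w s} -> Up u x = Up w x.
Proof.
move=> su sw uw; rewrite /Upsilon0 !mintE ?ltW//; have bk := bml_K0 a b x.
apply: ae_eq_cint.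
- by apply: cmeasurableM; [exact: cmeasurable_itvco|exact: sqi_measurable su].
- by apply: cmeasurableM; [exact: cmeasurable_itvco|exact: sqi_measurable sw].
- by apply: ae_imp uw => s h /h ->.
Qed.

Lemma pair_combE z f g : f + z *: g =
  (fun s => z * g.1 s + f.1 s, fun s => z * g.2 s + f.2 s).
Proof.
by case: f g => [f1 f2] [g1 g2]; congr pair; apply/funext => s; exact: addrC.
Qed.

(** Elimination of the second component [g.2 = f.1 + z * g.1] from the
    resolvent equation of the relation leaves an equation for the pencil with a
    right-hand side that depends on [f] only.  This is where the square of [z]
    comes from. *)
Lemma T0_resolventP z f g : H0 f -> T0 (g, f + z *: g) <->
  [/\ H10 a b g.1, sqi g.2,
    forall x, a <= x <= b -> L z g.1 x = Om f.1 x + Up (fun s => z * f.1 s + f.2 s) x &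
    {ae upsilon, forall s, a <= s < b -> g.2 s = f.1 s + z * g.1 s}].
Proof.
move=> Hf; have [Hf1 sf2] := Hf.
have sqi1 := H10_sqi upsilon_fin ab.
have key : H0 g -> {ae upsilon, forall s, a <= s < b -> g.2 s = f.1 s + z * g.1 s} ->
    forall x, (g.1 x = Om (f + z *: g).1 x + Up (f + z *: g).2 x) <->
      (L z g.1 x = Om f.1 x + Up (fun s => z * f.1 s + f.2 s) x).
  move=> [hg1 sg2] ae_g x; have /H10P[df1 hf1] := Hf1; have /H10P[dg1 hg1'] := hg1.
  have -> : Om (f + z *: g).1 x = z * Om g.1 x + Om f.1 x.
    rewrite -(Omega0_lin omega ab z x hg1' hf1).
    by rewrite pair_combE.
  have -> : Up (f + z *: g).2 x = z * Up g.2 x + Up f.2 x.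
    rewrite -(Upsilon0_lin upsilon_fin ab z x sg2 sf2).
    by rewrite pair_combE.
  have -> : Up g.2 x = z * Up g.1 x + Up f.1 x.
    rewrite -(Upsilon0_lin upsilon_fin ab z x (sqi1 _ hg1) (sqi1 _ Hf1)).
    apply: ae_eq_Upsilon0 => //; first by apply: sqi_lin => //; exact: sqi1.
    by apply: ae_imp ae_g => s h /h ->; rewrite addrC.
  rewrite (Upsilon0_lin upsilon_fin ab z x (sqi1 _ Hf1) sf2) L0E; split=> [E|E].
    by rewrite [X in X - _ - _]E; ring.
  by rewrite -[LHS](subrK (z * Om g.1 x)) -[X in X + _](subrK (z ^+ 2 * Up g.1 x)) E; ring.
split=> [/T0P-/(_ upsilon_fin ab)[Hg _ gE g2E]|[hg1 sg2 gE g2E]].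
  by split=> //; [exact: Hg.1|exact: Hg.2|move=> x xab; apply/key => //; exact: gE].
have Hg : H0 g by [].
apply/T0P => //; split => //.
  by rewrite addrC; exact: H0_lin.
by move=> x xab; apply/key => //; exact: gE.
Qed.

Lemma T0_sub z f f' g g' : H0 f -> H0 f' -> T0 (g, f + z *: g) -> T0 (g', f' + z *: g') ->
  T0 (-1 *: g' + g, (-1 *: f' + f) + z *: (-1 *: g' + g)).
Proof.
move=> Hf Hf'; have Hd : H0 (-1 *: f' + f) by exact: H0_lin.
have sqi1 := H10_sqi upsilon_fin ab.
have sK h : H0 h -> sqi (fun s => z * h.1 s + h.2 s).
  by move=> [h1 h2]; apply: sqi_lin => //; exact: sqi1.
move=> /(T0_resolventP z g Hf)[hg sg gE g2] /(T0_resolventP z g' Hf')[hg' sg' gE' g2'].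
apply/(T0_resolventP z _ Hd); split => [| |x xab|].
- exact: H10_lin.
- exact: sqi_lin.
- have /H10P[dg1 hg1] := hg; have /H10P[dg2 hg2] := hg'.
  have /H10P[df1 hf1] := Hf.1; have /H10P[df2 hf2] := Hf'.1.
  have -> : L z (-1 *: g' + g).1 x = -1 * L z g'.1 x + L z g.1 x.
    exact: (L0_lin omega upsilon_fin ab z (-1) x hg2 hg1).
  have -> : Om (-1 *: f' + f).1 x = -1 * Om f'.1 x + Om f.1 x.
    exact: (Omega0_lin omega ab (-1) x hf2 hf1).
  have -> : Up (fun s => z * (-1 *: f' + f).1 s + (-1 *: f' + f).2 s) x =
      -1 * Up (fun s => z * f'.1 s + f'.2 s) x + Up (fun s => z * f.1 s + f.2 s) x.
    rewrite -(Upsilon0_lin upsilon_fin ab (-1) x (sK _ Hf') (sK _ Hf)).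
    have EK : (fun s => z * (-1 *: f' + f).1 s + (-1 *: f' + f).2 s) =
        (fun s => -1 * (z * f'.1 s + f'.2 s) + (z * f.1 s + f.2 s)).
      apply/funext => s.
      have [-> ->] : (-1 *: f' + f).1 s = -1 * f'.1 s + f.1 s /\
        (-1 *: f' + f).2 s = -1 * f'.2 s + f.2 s by split.
      by ring.
    by rewrite EK.
  by rewrite gE// gE'//; ring.
- apply: ae_imp2 g2 g2' => s h h' sab.
  have [-> [-> ->]] : (-1 *: g' + g).2 s = -1 * g'.2 s + g.2 s /\
    (-1 *: f' + f).1 s = -1 * f'.1 s + f.1 s /\
    (-1 *: g' + g).1 s = -1 * g'.1 s + g.1 s by split.
  by rewrite h// h'//; ring.
Qed.

(** The bookkeeping of constants in [resolvent_subset]: [e1] and [e2] are the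
    two parts of the squared norm of the right-hand side, [g1] and [s1] those of
    the solution. *)
Lemma resolvent_arith (c M m k e1 e2 i r g1 s1 : R) : 0 <= c -> 0 <= M -> 0 <= m -> 0 <= k ->
  0 <= e1 -> 0 <= e2 ->
  g1 <= c * r -> r <= M * (e1 + i) -> i <= 2 * k * (m * e1) + 2 * e2 ->
  s1 <= 2 * k * (m * g1) + 2 * (m * e1) ->
  g1 + s1 <= ((1 + 2 * k * m) * (c * (M * (1 + 2 * k * m + 2))) + 2 * m) * (e1 + e2).
Proof.
move=> c0 M0 m0 k0 e10 e20 h1 h2 h3 h4.
have km : 0 <= k * m by exact: mulr_ge0.
have B : i <= 2 * k * m * e1 + 2 * e2 by rewrite (le_trans h3)// mulrA.
have B1 : e1 + i <= (1 + 2 * k * m + 2) * (e1 + e2).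
  have : 0 <= k * m * e2 by exact: mulr_ge0.
  by move: B; lra.
have B2 : g1 <= c * (M * (1 + 2 * k * m + 2)) * (e1 + e2).
  have -> : c * (M * (1 + 2 * k * m + 2)) * (e1 + e2) =
    c * (M * ((1 + 2 * k * m + 2) * (e1 + e2))) by ring.
  by rewrite (le_trans h1)// ler_wpM2l// (le_trans h2)// ler_wpM2l.
have B3 : (1 + 2 * k * m) * g1 <= (1 + 2 * k * m) * (c * (M * (1 + 2 * k * m + 2)) * (e1 + e2)).
  by rewrite ler_wpM2l//; move: km; lra.
have B4 : 0 <= m * e2 by exact: mulr_ge0.
rewrite (le_trans (lerD (lexx _) h4))//.
have -> : g1 + (2 * k * (m * g1) + 2 * (m * e1)) = (1 + 2 * k * m) * g1 + 2 * (m * e1) by ring.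
rewrite [leRHS]mulrDl -[X in _ <= X + _]mulrA; apply: lerD; first exact: B3.
by move: B4; lra.
Qed.

(** By [T0_resolventP] the resolvent equation of the relation is solved by the
    inverse of the pencil, whose right-hand side is bounded by
    [potential_bounded]. *)
Lemma resolvent_subset z : pencil_resolvent_set (H10 a b) (H1_dot a b) L z ->
  rel_resolvent_set H0 (H0_dot upsilon a b) T0 z.
Proof.
move=> /pencil_resolventP[[c c0 Lc] Ls].
have [m m0 hs] := h10_sqi upsilon_fin ab.
have sqi1 := H10_sqi upsilon_fin ab.
have [M M0 pb] := potential_bounded omega upsilon_fin ab.
have sK f : H0 f -> sqi (fun s => z * f.1 s + f.2 s).
  by move=> [h1 h2]; apply: sqi_lin => //; exact: sqi1.
have S (f g : cfun R * cfun R) : rel_inv (rel_shift T0 z) (f, g) -> H0 f /\ T0 (g, f + z *: g).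
  move=> [[p1 p2] [[q1 q2] Tq [<- <-]] [/= <- <-]]; rewrite subrK; split => //.
  have [Hq1 Hq2] : H0 q1 /\ H0 q2 by case: Tq.
  by rewrite addrC -scaleNr; exact: H0_lin.
have S' f g : T0 (g, f + z *: g) -> rel_inv (rel_shift T0 z) (f, g).
  by move=> Tg; exists (g, f) => //; exists (g, f + z *: g) => //=; rewrite addrK.
pose K := ((1 + 2 * sq z * m) * (c * (M * (1 + 2 * sq z * m + 2))) + 2 * m).
have bound f g : H0 f -> T0 (g, f + z *: g) -> en0 g <= K * en0 f.
  move=> Hf /(T0_resolventP z g Hf)[hg sg gE g2E].
  have [Hf1 sf2] := Hf; have /H10P[df hf] := Hf1; have /H10P[dg hg'] := hg.
  have [_ pE] := pb _ _ _ hf (sK _ Hf).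
  have sg1 : sqi (fun s => z * g.1 s + f.1 s) by apply: sqi_lin => //; exact: sqi1.
  apply: (resolvent_arith c0 M0 m0 (sq_ge0 z) (en_ge0 Hf1) (int_sq_ge0 _)
    _ pE _ (s1 := \int[upsilon]_(s in D) sq (g.2 s))).
  - by rewrite -(eq_energy ab gE); exact: Lc.
  - rewrite (le_trans (int_sq_lin z mD (sqi1 _ Hf1) sf2))// lerD2r ler_wpM2l//.
      by rewrite mulr_ge0 ?sq_ge0.
    exact: (hs _ _ hf).2.
  - have -> : \int[upsilon]_(s in D) sq (g.2 s) =
        \int[upsilon]_(s in D) sq (z * g.1 s + f.1 s).
      rewrite /Rintegral; congr fine; apply: ae_eq_integral => //.
      + by apply/measurable_EFinP; apply: measurable_sq; exact: sqi_measurable sg.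
      + by apply/measurable_EFinP; apply: measurable_sq; exact: sqi_measurable sg1.
      + by apply: ae_imp g2E => s; rewrite /= in_itv /= => h /h ->; rewrite addrC.
    rewrite (le_trans (int_sq_lin z mD (sqi1 _ hg) (sqi1 _ Hf1)))//.
    apply: lerD; apply: ler_wpM2l; rewrite ?mulr_ge0 ?sq_ge0//.
      exact: (hs _ _ hg').2.
    exact: (hs _ _ hf).2.
have K0 : 0 <= K.
  have k1 : 0 <= 1 + 2 * sq z * m by rewrite addr_ge0// mulr_ge0// mulr_ge0// sq_ge0.
  rewrite /K; apply: addr_ge0; last exact: mulr_ge0.
  by apply: mulr_ge0 => //; apply: mulr_ge0 => //; apply: mulr_ge0 => //; exact: addr_ge0.
split.
- move=> f Hf; have [Hf1 sf2] := Hf; have /H10P[df hf] := Hf1.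
  have /H10P hp := (pb _ _ _ hf (sK _ Hf)).1.
  have [w hw Lw] := Ls _ hp.
  exists (w, fun s => z * w s + f.1 s); apply: S'.
  apply/(T0_resolventP z _ Hf); split => //.
    by apply: sqi_lin => //; exact: sqi1.
  by apply: aeW => s _; rewrite addrC.
- move=> f f' g g' /S[Hf Tg] /S[Hf' Tg'] ff'.
  have b0 := bound _ _ (H0_lin (-1) Hf' Hf) (T0_sub Hf Hf' Tg Tg').
  have e0 : en0 (-1 *: f' + f) = 0.
    apply/eqP; rewrite eq_le en0_ge0 ?andbT; last exact: H0_lin.
    by rewrite scaleN1r addrC -sqrtr_eq0 -norm_H0E ff'.
  rewrite /same norm_H0E addrC -scaleN1r; apply/eqP; rewrite sqrtr_eq0.
  by rewrite (le_trans b0)// e0 mulr0.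
- exists (Num.sqrt K) => f g /S[Hf Tg]; rewrite !norm_H0E.
  by apply: sqrt_le_scale => //; exact: bound.
Qed.

(** To solve [L z w = h] by means of the relation, apply its resolvent to the
    pair [(z *: h, 0)]: the first component [u] of the result satisfies
    [L z u = h - L z h], so that [w = u + h]. *)
Lemma resolvent_supset z : rel_resolvent_set H0 (H0_dot upsilon a b) T0 z ->
  pencil_resolvent_set (H10 a b) (H1_dot a b) L z.
Proof.
move=> [ex _ [c Rc]]; apply/pencil_resolventP.
have sqi1 := H10_sqi upsilon_fin ab.
have H10z : H10 a b (fun=> 0 : C) by apply/H10P; exists (fun=> 0); exact: h10_0.
pose src w : cfun R * cfun R := (z *: w, 0).
have Hsrc w : H10 a b w -> H0 (src w).
  move=> hw; split; last exact: sqi0.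
  by rewrite /= -[z *: w]addr0; exact: H10_lin.
have Lh h x : H10 a b h -> Om (src h).1 x + Up (fun s => z * (src h).1 s + (src h).2 s) x =
    h x - L z h x.
  move=> hh; have /H10P[dh hh'] := hh.
  rewrite L0E (_ : (src h).1 = (fun s => z * h s + 0)); last first.
    by apply/funext => s; rewrite addr0.
  rewrite (Omega0_lin omega ab z x hh' (h10_0 ab)) Omega0_0//.
  rewrite (_ : (fun s => _) = (fun s => z ^+ 2 * h s + 0)); last first.
    by apply/funext => s; have -> : (src h).2 s = 0 by []; ring.
  by rewrite (Upsilon0_lin upsilon_fin ab _ x (sqi1 _ hh) (sqi0 upsilon_fin a b)) Upsilon0_0//; ring.
have S f g : T0 (g, f + z *: g) <-> rel_inv (rel_shift T0 z) (f, g).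
  split=> [Tg|]; first by exists (g, f) => //; exists (g, f + z *: g) => //=; rewrite addrK.
  by move=> [[p1 p2] [[q1 q2] Tq [<- <-]] [/= <- <-]]; rewrite subrK.
split.
  exists (2 * (c ^+ 2 * (2 * sq z)) + 2).
    by rewrite addr_ge0// mulr_ge0// mulr_ge0 ?sqr_ge0// mulr_ge0 ?sq_ge0.
  move=> w hw; have hL := L0_H10 z hw; set h := L z w in hL *.
  pose u := -1 *: h + w.
  have hu : H10 a b u by exact: H10_lin.
  pose g : cfun R * cfun R := (u, fun s => z * u s + (src h).1 s).
  (* [u = w - h] solves the equation for the source [z *: h] *)
  have Tg : T0 (g, src h + z *: g).
    apply/(T0_resolventP z _ (Hsrc _ hL)); split => //.
    - by apply: sqi_lin; [exact: mD|exact: sqi1|apply: sqi1; exact: (Hsrc _ hL).1].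
    - move=> x xab; rewrite Lh//.
      have /H10P[dw hw'] := hw; have /H10P[dL hL'] := hL.
      by rewrite (L0_lin omega upsilon_fin ab z (-1) x hL' hw') -/h; ring.
    - by apply: aeW => s _; rewrite addrC.
  have Hg : H0 g by case: Tg.
  have := Rc _ _ ((S _ _).1 Tg); rewrite !norm_H0E.
  move=> /(le_scale_sqrt (en0_ge0 Hg) (en0_ge0 (Hsrc _ hL))) gb.
  have s0 : en0 (src h) <= 2 * sq z * en h.
    rewrite /en0 (_ : \int[upsilon]_(s in D) _ = 0) ?addr0; last first.
      by rewrite (_ : (fun s => _) = cst 0) ?Rintegral_cst ?mul0r//; apply/funext => s; rewrite sq0.
    have -> : (src h).1 = z *: h + 0 by rewrite addr0.
    apply: (le_trans (en_lin z hL (H10z : H10 a b (0 : cfun R)))).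
    by rewrite (@energy0 (0 : cfun R))// mulr0 addr0.
  have -> : en w = en (1 *: u + h) by congr energy; rewrite scale1r /u scaleN1r addrC addrA subrr add0r.
  have e0 := en_ge0 hL.
  apply: (le_trans (en_lin 1 hu hL)); rewrite [leRHS]mulrDl lerD2r.
  rewrite {1}/sq /= expr1n expr0n /= addr0 mulr1.
  rewrite -mulrA ler_wpM2l// -mulrA (le_trans _ (ler_wpM2l (sqr_ge0 c) s0))//.
  by rewrite (le_trans _ gb)// /en0 lerDl int_sq_ge0.
move=> h hh; have Hs := Hsrc _ hh.
have [g /(S _ _).2 /(T0_resolventP z _ Hs)[hg _ gE _]] := ex _ Hs.
exists (1 *: g.1 + h); first exact: H10_lin.
move=> x xab; have /H10P[dg hg'] := hg; have /H10P[dh hh'] := hh.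
by rewrite (L0_lin omega upsilon_fin ab z 1 x hg' hh') gE// Lh//; ring.
Qed.

End resolvents.

(** * Green's function *)

Section green_function.
Context (R : realType) (omega : signed_borel R)
  (upsilon : {measure set (measurableTypeR R) -> \bar R})
  (upsilon_fin : locally_finite upsilon) (a b : R) (ab : a < b) (z : R[i]).
Notation C := R[i].
Notation T := (measurableTypeR R).
Notation leb := (@leb R).
Notation D := (`[a, b[%classic : set T).
Notation L := (L0 omega upsilon a b).
Implicit Types (x y s t c d : R) (f g u w df du dg dw G dG : R -> C) (k : C).

(** Integration against the complex measure [z omega + z ^+ 2 upsilon]. *)
Definition pmeas x y f : C := z * sint omega x y f + z ^+ 2 * mint upsilon x y f.

Lemma mfam_pmeas : mfam pmeas.
Proof.
exact: (mfam_lin z (mfam_sint omega) (mfamZ (z ^+ 2) (mfam_mint1 upsilon_fin))).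
Qed.

(** The second derivative of a solution, as a measure with the solution as a
    density. *)
Definition peq x y f : C := -1 * pmeas x y f + leb4 x y f.

Lemma mfam_peq : mfam peq.
Proof. exact: (mfam_lin (-1) mfam_pmeas (mfam_leb4 R)). Qed.

Lemma solutionP f df : solution omega upsilon z f df <-> left_continuous df /\ solves peq f df.
Proof.
split=> [[h1 h2 h3]|[h2 [h1 h3]]].
  split => //; split; first exact/lacE.
  move=> x y; rewrite /peq /pmeas -h3 /leb4; ring.
split => //; first exact/lacE.
move=> x y; rewrite -/(pmeas x y f).
have -> : - df y + df x = - (df y - df x) by ring.
by rewrite h3 /peq /leb4; ring.
Qed.

Lemma left_continuous_n1 f :
  (forall x (e : R), 0 < e -> exists2 t0, t0 < x &
    forall t, t0 < t -> t < x -> n1 (f x - f t) < e) -> left_continuous f.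
Proof.
move=> h x; split; apply/cvgrPdist_lt => e e0; have [t0 t0x ht] := h x e e0; near=> t.
- rewrite -Re_opp -Re_add; apply: le_lt_trans (n1_Re _) (ht _ _ _); near: t.
    exact: nbhs_left_gt.
  exact: nbhs_left_lt.
- rewrite -Im_opp -Im_add; apply: le_lt_trans (n1_Im _) (ht _ _ _); near: t.
    exact: nbhs_left_gt.
  exact: nbhs_left_lt.
Unshelve. all: by end_near.
Qed.

(** The jump of the derivative at an atom is taken after the atom. *)
Lemma solves_left_continuous u du : solves peq u du -> left_continuous du.
Proof.
move=> [lu duE]; apply: left_continuous_n1 => x e e0.
have [t0 t0x h] := mf_left_cont mfam_peq x (lac_bml lu) e0.
by exists t0 => // t h1 h2; rewrite duE; exact: h.
Qed.

Lemma solution_exists c (al be : C) :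
  exists u du, [/\ solution omega upsilon z u du, u c = al & du c = be].
Proof.
have [u [du [su uc dut]]] := ivp_exists c al be mfam_peq.
exists u, du; split => //; last by rewrite dut (mf_refl _ _ mfam_peq) addr0.
apply/solutionP; split; [exact: solves_left_continuous su|exact: su].
Qed.

(** The derivative is constant on [[a, b]], hence zero, and uniqueness for the
    initial value problem applies. *)
Lemma solves_vanishing u du : solves peq u du -> (forall x, a <= x <= b -> u x = 0) ->
  (forall x, u x = 0) /\ forall x, a <= x <= b -> du x = 0.
Proof.
move=> su u0; have [lu duE] := su.
have aab : a <= a <= b by rewrite lexx ltW.
have bab : a <= b <= b by rewrite lexx ltW.
have dua x : a <= x <= b -> du x = du a.
  move=> /andP[ax xb]; apply/eqP; rewrite -subr_eq0 duE.
  rewrite (mf_ext mfam_peq (g := fun=> 0) ax) ?(mf0 _ _ mfam_peq)// => s /andP[h1 h2].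
  by rewrite u0// h1 (le_trans (ltW h2)).
have := lu.2 a b; rewrite (u0 _ aab) (u0 _ bab) subrr.
rewrite (@eq_mint _ _ _ _ _ (fun=> du a * 1) (ltW ab)); last first.
  by move=> s /andP[h1 h2]; rewrite dua ?mulr1// h1 ltW.
rewrite (mfZ _ _ _ (mfam_leb R)); last exact: bml_cst.
rewrite -(lac_id R).2 -rmorphB => /esym/eqP; rewrite mulf_eq0 => /orP[/eqP da|].
  by split; [exact: (ivp_unique mfam_peq su (u0 _ aab) da)|move=> x /dua ->].
by rewrite fmorph_eq0 subr_eq0 gt_eqF.
Qed.

Definition injective_pencil := forall w, H10 a b w ->
  (forall x, a <= x <= b -> L z w x = 0) -> forall x, a <= x <= b -> w x = 0.

Lemma resolvent_injective : pencil_resolvent_set (H10 a b) (H1_dot a b) L z ->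
  injective_pencil.
Proof.
move=> /(pencil_resolventP omega upsilon_fin ab)[[c c0 Lc] _] w hw Lw0.
have /H10P[dw hw'] := hw; apply: (energy_eq0 ab hw').
apply/eqP; rewrite eq_le (en_ge0 ab hw) andbT.
by rewrite (le_trans (Lc _ hw))// energy0 ?mulr0.
Qed.

Lemma pmeas_K0 w x :
  pmeas a b (fun s => w s * (K0 a b x s)%:C) =
  z * Omega0 omega a b w x + z ^+ 2 * Upsilon0 upsilon a b w x.
Proof.
rewrite /pmeas /Omega0 /Upsilon0.
by under eq_fun do rewrite mulrC.
Qed.

(** A solution with zero boundary values lies in the kernel of the pencil, as
    [K0] represents it by its own source term. *)
Lemma dirichlet_solution_eq0 u du : injective_pencil -> solves peq u du ->
  u a = 0 -> u b = 0 -> forall x, a <= x <= b -> u x = 0.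
Proof.
move=> inj su ua ub; have [lu duE] := su; have bu := lac_bml lu.
have bdu := dist_fun_bml (mfam_mul mfam_peq bu) (solves_dist su).
have [_ [k duk]] := bdu a b.
have [|hu _] := h10_bounded (K := k) ab lu ua ub.
  by move=> x /andP[h1 h2]; apply: duk; rewrite h1 ltW.
apply: inj; first by apply/H10P; exists du.
move=> x xab; rewrite L0E -addrA -opprD -pmeas_K0//.
have dE x' y : du y - du x' = leb4 x' y u - pmeas x' y (fun s => u s * 1).
  by rewrite duE /peq; under [X in _ - pmeas _ _ X]eq_fun do rewrite mulr1; ring.
rewrite [u x](K0_representation ab (mfam_mul mfam_pmeas bu) lu ua ub dE xab).
by rewrite subrr.
Qed.

(** At [b] the Wronskian is [- dpsi b * phi b].  If [dpsi b] vanishes then so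
    does [psi]; if [phi b] vanishes then [phi] is in the kernel of the pencil. *)
Lemma wronskian_neq0 psi dpsi phi dphi c : injective_pencil ->
  boundary_solutions omega upsilon a b z psi dpsi phi dphi ->
  wronskian psi dpsi phi dphi c != 0.
Proof.
move=> inj [/solutionP[_ s1] /solutionP[_ s2] li pb pa]; rewrite /wronskian.
rewrite (wronskian_const mfam_peq s1 s2 c b) pb mul0r sub0r oppr_eq0 mulf_eq0 negb_or.
apply/andP; split; apply/eqP => h0.
  have p0 := ivp_unique mfam_peq s1 pb h0.
  have [] := li 1 0; last by move=> /eqP; rewrite oner_eq0.
  apply/funext => x; have E : 1 * psi x + 0 * phi x = 0 by rewrite p0; ring.
  exact: E.
have [p0 _] := solves_vanishing s2 (dirichlet_solution_eq0 inj s2 pa h0).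
have [] := li 0 1; last by move=> _ /eqP; rewrite oner_eq0.
apply/funext => x; have E : 0 * psi x + 1 * phi x = 0 by rewrite p0; ring.
exact: E.
Qed.

(** Take the solutions with [psi b = 0], [dpsi b = 1] and [phi a = 0],
    [dphi a = 1].  A linear relation between them forces one of them to vanish
    at both ends. *)
Lemma boundary_solutions_exist : injective_pencil -> exists psi dpsi phi dphi : cfun R,
  boundary_solutions omega upsilon a b z psi dpsi phi dphi.
Proof.
move=> inj; have [psi [dpsi [s1 p1 d1]]] := solution_exists b 0 1.
have [phi [dphi [s2 p2 d2]]] := solution_exists a 0 1.
exists psi, dpsi, phi, dphi; split => // al be E.
have Ex x : al * psi x + be * phi x = 0 by have := congr1 (fun f : cfun R => f x) E.
have [_ v1] := (solutionP _ _).1 s1; have [_ v2] := (solutionP _ _).1 s2.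
have al0 : al = 0.
  have := Ex a; rewrite p2 mulr0 addr0 => /eqP; rewrite mulf_eq0 => /orP[/eqP//|/eqP pa].
  have [_ d0] := solves_vanishing v1 (dirichlet_solution_eq0 inj v1 pa p1).
  by move: d1; rewrite d0 ?lexx ?ltW// => /esym/eqP; rewrite oner_eq0.
split => //; apply/eqP; apply/negPn/negP => be0.
have p0 x : phi x = 0.
  by have := Ex x; rewrite al0 mul0r add0r => /eqP; rewrite mulf_eq0 (negbTE be0) => /eqP.
have [_ d0] := solves_vanishing v2 (fun x _ => p0 x).
by move: d2; rewrite d0 ?lexx ?ltW// => /esym/eqP; rewrite oner_eq0.
Qed.


Lemma bml_cut c d f : bml f -> bml (cut c d f).
Proof.
move=> bf x y; have [[f1 f2] [K fK]] := bf x y.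
split; last first.
  exists `|K| => s h; rewrite /cut; case: ifP => _; last by rewrite n1_0.
  by rewrite (le_trans (fK _ h))// ler_norm.
have mc : measurable_fun `[x, y]%classic (fun s : T => (c <= s) && (s < d)).
  apply: measurable_and.
    by apply: measurable_fun_ler => //; exact: measurable_id.
  by apply: measurable_fun_ltr => //; exact: measurable_id.
have sub (h : T -> R) (E : set T) : measurable_fun `[x, y] h -> measurable_fun (`[x, y] `&` E) h.
  by move=> mh; apply: measurable_funS mh => // s [].
have m0 (E : set T) : measurable_fun E (cst 0 : T -> R) by exact: measurable_cst.
split.
  have := measurable_fun_if _ mc (sub _ _ f1) (m0 _).
  by move=> h; apply: eq_measurable_fun (h _) => // s _; rewrite /cut; case: ifP.
have := measurable_fun_if _ mc (sub _ _ f2) (m0 _).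
by move=> h; apply: eq_measurable_fun (h _) => // s _; rewrite /cut; case: ifP.
Qed.

(** The two pieces are extended by constants with [clamp] beyond the gluing
    point and added; the intervals are enlarged by one so that [c] may be an
    endpoint of [[a, b]]. *)
Lemma lac_glue c f df g dg : lac f df -> bml df -> lac g dg -> bml dg -> a <= c <= b ->
  f c = g c -> exists G dG, [/\ lac G dG, bml dG,
    forall s, a <= s <= b -> G s = if s <= c then f s else g s,
    forall s, a <= s < c -> dG s = df s & forall s, c <= s < b -> dG s = dg s].
Proof.
move=> lf bf lg bg /andP[ac cb] fg.
have h1 : a - 1 < c by move: ac; lra.
have h2 : c < b + 1 by move: cb; lra.
exists (fun s => f (clamp (a - 1) c s) + (g (clamp c (b + 1) s) + - g c)).
exists (fun s => cut (a - 1) c df s + (cut c (b + 1) dg s + 0)); split.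
- apply: lacD; first by apply: acw_lac => //; exact: lac_acw.
  by apply: lacD; [apply: acw_lac => //; exact: lac_acw|exact: lac_cst].
- apply: bmlD; first exact: bml_cut.
  by apply: bmlD; [exact: bml_cut|exact: bml_cst].
- move=> s /andP[as_ sb]; case: ifP => [sc|/negbT].
    have -> : clamp (a - 1) c s = s by rewrite clamp_id// sc andbT; move: as_; lra.
    have -> : clamp c (b + 1) s = c by rewrite /clamp max_l// min_l// ltW.
    by rewrite subrr addr0.
  rewrite -ltNge => sc.
  have -> : clamp (a - 1) c s = c.
    by rewrite /clamp max_r ?min_r// ?(ltW sc)// (le_trans _ (ltW sc))// ltW.
  have -> : clamp c (b + 1) s = s by rewrite clamp_id// (ltW sc) /=; move: sb; lra.
  by rewrite fg addrC subrK.
- move=> s /andP[as_ sc]; rewrite /cut sc andbT (le_trans _ as_) ?gerDl ?lerN10//.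
  by rewrite leNgt sc /= !addr0.
- move=> s /andP[cs sb]; rewrite /cut cs /= ltNge cs /= andbF add0r addr0.
  by rewrite (lt_trans sb)// ltrDl.
Qed.

Lemma lac_conj u w : lac u w -> lac (fun s => (u s)^*) (fun s => (w s)^*).
Proof.
move=> [lw uE].
have iN x y : leb.-integrable `[x, y[ (fun s => (- complex.Im (w s))%:E).
  have := integrableN (lw x y).2.
  by apply: eq_integrable.
have ReE s : complex.Re (w s)^* = complex.Re (w s) by case: (w s).
have ImE s : complex.Im (w s)^* = - complex.Im (w s) by case: (w s).
have E x y : cint leb `[x, y[ (fun s => (w s)^*) = (cint leb `[x, y[ w)^*.
  rewrite /cint /=; congr (_ +i* _); first by apply: eq_Rintegral => s _; rewrite ReE.
  rewrite -[RHS]mulN1r -RintegralZl//; last exact: (lw x y).2.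
  by apply: eq_Rintegral => s _; rewrite ImE mulN1r.
split.
  move=> x y; have [i1 _] := lw x y; split.
    by apply: eq_integrable i1 => // s _; rewrite ReE.
  by apply: eq_integrable (iN x y) => // s _; rewrite ImE.
move=> x y; rewrite -rmorphB uE /mint /oriented.
by case: ifP => _; rewrite ?E//; case: ifP => _; rewrite ?E ?rmorphN ?rmorph0.
Qed.

Lemma eq_H1_dot f f' g g' : (forall x, a <= x <= b -> f x = f' x) ->
  (forall x, a <= x <= b -> g x = g' x) -> H1_dot a b f g = H1_dot a b f' g'.
Proof.
move=> ff gg; rewrite /H1_dot (eq_acwE ff) (eq_acwE gg); congr (_ * _ + _).
apply: eq_mint; first exact: ltW.
by move=> s /andP[h1 h2]; rewrite ff ?gg// h1 ltW.
Qed.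

Lemma H1_dot_conj f df G dG : lac f df -> lac G dG ->
  H1_dot a b f (fun s => (G s)^*) =
  leb4 a b (fun s => f s * G s) + mint leb a b (fun s => df s * dG s).
Proof.
move=> lf lG.
rewrite (H1_dotE ab (lac_acw ab lf) (lac_acw ab (lac_conj lG))) /leb4.
congr (_ * mint _ _ _ _ + mint _ _ _ _); apply/funext => s; congr (_ * _).
  exact: conjcK.
exact: conjcK.
Qed.

(** Integration by parts with the distribution function [du]. *)
Lemma weak_solution u du w dw x y : solves peq u du -> lac w dw ->
  leb4 x y (fun s => w s * u s) + mint leb x y (fun s => dw s * du s) =
  w y * du y - w x * du x + pmeas x y (fun s => w s * u s).
Proof.
move=> su lw; have bu := lac_bml su.1.
rewrite (integration_by_parts (mfam_mul mfam_peq bu) lw (solves_dist su)) /peq.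
have -> : (fun s => u s * w s) = (fun s => w s * u s) by apply/funext => s; rewrite mulrC.
by ring.
Qed.

Lemma solves_scale k u du : solves peq u du ->
  solves peq (fun x => k * u x) (fun x => k * du x).
Proof.
move=> [lu duE]; split; first exact: lacZ.
by move=> x y; rewrite -mulrBr duE (mfZ _ _ _ mfam_peq)//; exact: lac_bml lu.
Qed.

(** Pairing with a function that solves the equation on both sides of [c] gives
    the jump of its derivative at [c], besides the boundary terms and the
    measure. *)
Lemma green_pairing f df g dg w dw c : solves peq f df -> solves peq g dg ->
  a <= c <= b -> f c = g c -> lac w dw -> forall G dG, lac G dG -> bml dG ->
  (forall s, a <= s <= b -> G s = if s <= c then f s else g s) ->
  (forall s, a <= s < c -> dG s = df s) -> (forall s, c <= s < b -> dG s = dg s) ->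
  leb4 a b (fun s => w s * G s) + mint leb a b (fun s => dw s * dG s) =
  w b * dg b - w a * df a + w c * (df c - dg c) + pmeas a b (fun s => w s * G s).
Proof.
move=> sf sg /andP[ac cb] fg lw G dG lG bdG GE dG1 dG2.
have bwG : bml (fun s => w s * G s) by apply: bmlM; [exact: lac_bml lw|exact: lac_bml lG].
have left N : mfam N -> N a c (fun s => w s * G s) = N a c (fun s => w s * f s).
  move=> mN; apply: (mf_ext mN) => // s /andP[h1 h2].
  by rewrite GE ?(ltW h2)// h1 (le_trans (ltW h2)).
have right N : mfam N -> N c b (fun s => w s * G s) = N c b (fun s => w s * g s).
  move=> mN; apply: (mf_ext mN) => // s /andP[h1 h2].
  rewrite GE ?(le_trans ac h1) ?(ltW h2)//; case: ifP => // h3.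
  have -> : s = c by apply/eqP; rewrite eq_le h3.
  by rewrite fg.
rewrite (mf_chasles (mfam_leb4 R) bwG a c b) (mf_chasles mfam_pmeas bwG a c b).
rewrite !left ?right //; try exact: mfam_leb4; try exact: mfam_pmeas.
rewrite (mint_chasles (bml_lintM lw.1 bdG) a c b).
have -> : mint leb a c (fun s => dw s * dG s) = mint leb a c (fun s => dw s * df s).
  by apply: eq_mint => // s /dG1 ->.
have -> : mint leb c b (fun s => dw s * dG s) = mint leb c b (fun s => dw s * dg s).
  by apply: eq_mint => // s /dG2 ->.
have E1 := weak_solution a c sf lw; have E2 := weak_solution c b sg lw.
by rewrite addrACA E1 E2; ring.
Qed.

(** Let [F = w - g] be the potential of [w] with respect to the measure
    [z omega + z ^+ 2 upsilon].  The pairing of [w] with the Green function is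
    [w x] plus the integral of their product against this measure, as the
    derivative of the Green function drops by one at [x].  The pairing of [F]
    with the Green function is the same integral, by the weak form of the
    equation for [F].  The difference is the pairing of [g]. *)
Lemma green_formula psi dpsi phi dphi c w g x : injective_pencil ->
  boundary_solutions omega upsilon a b z psi dpsi phi dphi ->
  H10 a b w -> (forall s, a <= s <= b -> L z w s = g s) -> a <= x < b ->
  w x = H1_dot a b g (fun s => (green (wronskian psi dpsi phi dphi c) psi phi x s)^*).
Proof.
move=> inj bs /H10P[dw hw] Lw /andP[ax xb].
have W0 := wronskian_neq0 c inj bs.
have [/solutionP[_ s1] /solutionP[_ s2] _ pb pa] := bs.
pose W := wronskian psi dpsi phi dphi c.
have WE : W = psi x * dphi x - dpsi x * phi x.
  exact: (wronskian_const mfam_peq s1 s2 c x).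
have sf := solves_scale (W^-1 * psi x) s2; have sg := solves_scale (W^-1 * phi x) s1.
set f := fun s => _ in sf; set df := fun s => W^-1 * psi x * _ in sf.
set h := fun s => W^-1 * phi x * psi s in sg; set dh := fun s => _ in sg.
have xab : a <= x <= b by rewrite ax ltW.
have fh : f x = h x by rewrite /f /h; ring.
have bd u du : solves peq u du -> bml du.
  by move=> su; exact: dist_fun_bml (mfam_mul mfam_peq (lac_bml su.1)) (solves_dist su).
have [G [dG [lG bdG GE dG1 dG2]]] := lac_glue sf.1 (bd _ _ sf) sg.1 (bd _ _ sg) xab fh.
have [hw1 _ wa wb] := hw; pose w' s := w (clamp a b s).
have lw : lac w' (cut a b dw) by exact: acw_lac.
have bw := lac_bml lw.
have ww s : a <= s <= b -> w' s = w s by move=> sab; rewrite /w' clamp_id.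
have aab : a <= a <= b by rewrite lexx ltW.
have bab : a <= b <= b by rewrite lexx ltW.
have [F [dF [lF Fa Fb dFE]]] := dirichlet_exists ab (mfam_mul mfam_pmeas bw).
have FE s : a <= s <= b -> F s = w s - g s.
  move=> sab.
  rewrite (K0_representation ab (mfam_mul mfam_pmeas bw) lF Fa Fb dFE sab).
  rewrite (mf_ext mfam_pmeas (g := fun t => w t * (K0 a b s t)%:C) (ltW ab)); last first.
    by move=> t /andP[h1 h2]; rewrite ww// h1 ltW.
  by rewrite pmeas_K0// -Lw// L0E; ring.
have gE s : a <= s <= b -> g s = w' s + -1 * F s by move=> sab; rewrite FE// ww//; ring.
have GG s : a <= s <= b -> (green W psi phi x s)^* = (G s)^*.
  by move=> sab; rewrite GE// /green /f /h; congr (_ ^*); case: ifP => _; ring.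
rewrite (eq_H1_dot gE GG) (H1_dot_conj (lacD lw (lacZ (-1) lF)) lG).
have bF := lac_bml lF; have bG := lac_bml lG.
have -> : leb4 a b (fun s => (w' s + -1 * F s) * G s) =
    leb4 a b (fun s => w' s * G s) - leb4 a b (fun s => F s * G s).
  rewrite -(mfB _ _ (mfam_leb4 R)); [|exact: bmlM|exact: bmlM].
  by congr leb4; apply/funext => s; ring.
have -> : mint leb a b (fun s => (cut a b dw s + -1 * dF s) * dG s) =
    mint leb a b (fun s => cut a b dw s * dG s) - mint leb a b (fun s => dF s * dG s).
  have l1 := bml_lintM lw.1 bdG; have l2 := bml_lintM lF.1 bdG.
  rewrite -[X in _ - X]mul1r -mulNr -mintZ// -mintD//; last exact: lintZ.
  by congr mint; apply/funext => s; ring.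
have Ga : G a = 0 by rewrite GE// ax /f pa mulr0.
have Gb : G b = 0 by rewrite GE// leNgt xb /= /h pb mulr0.
(* weak form of the equation for [F], tested with [G] *)
have pF : leb4 a b (fun s => F s * G s) + mint leb a b (fun s => dF s * dG s) =
    pmeas a b (fun s => w' s * G s).
  have dF_dist : dist_fun dF (fun s t q => -1 * pmeas s t (fun r => w' r * q r) +
      leb4 s t (fun r => F r * q r)).
    move=> s t; rewrite dFE; have -> : (fun r => F r * 1) = F by apply/funext => r; rewrite mulr1.
    by ring.
  have mN := mfam_lin (-1) (mfam_mul mfam_pmeas bw) (mfam_mul (mfam_leb4 R) bF).
  under [X in _ + mint _ _ _ X]eq_fun do rewrite mulrC.
  by rewrite (integration_by_parts mN lG dF_dist) Ga Gb; ring.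
have wp := green_pairing sf sg xab fh lw lG bdG GE dG1 dG2.
rewrite addrACA -opprD pF wp /w' !clamp_id// wa wb.
have -> : df x - dh x = 1.
  rewrite /df /dh (_ : _ - _ = W^-1 * W); last by rewrite WE; ring.
  by rewrite mulVf.
by ring.
Qed.

End green_function.

(* The Wronskian does not depend on the point c at which it is evaluated. *)
Theorem theorem3p6 (R : realType) (omega : signed_borel R)
    (upsilon : {measure set (measurableTypeR R) -> \bar R})
    (upsilon_fin : locally_finite upsilon) (a b : R) (ab : a < b) :
  pencil_spectrum (H10 a b) (H1_dot a b) (L0 omega upsilon a b) =
    rel_spectrum (H0 upsilon a b) (H0_dot upsilon a b) (T0 omega upsilon a b) /\
  forall z : R[i],
    pencil_resolvent_set (H10 a b) (H1_dot a b) (L0 omega upsilon a b) z ->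
    (exists psi dpsi phi dphi : cfun R,
      boundary_solutions omega upsilon a b z psi dpsi phi dphi) /\
    forall psi dpsi phi dphi : cfun R,
      boundary_solutions omega upsilon a b z psi dpsi phi dphi ->
      forall L0inv : cfun R -> cfun R,
        bounded_inverse (H10 a b) (H1_dot a b) (L0 omega upsilon a b z) L0inv ->
        forall (c x : R) (g : cfun R), a <= x < b -> H10 a b g ->
          L0inv g x = H1_dot a b g
            (fun s => (green (wronskian psi dpsi phi dphi c) psi phi x s)^*).
Proof.
split.
  congr setC; apply/seteqP; split => z; first exact: resolvent_subset.
  exact: resolvent_supset.
move=> z zL; have inj := resolvent_injective upsilon_fin ab zL.
split; first exact: boundary_solutions_exist.
move=> psi dpsi phi dphi bs B [BH AB _ _] c x g xab hg.
apply: (green_formula upsilon_fin ab c inj bs (BH _ hg) _ xab).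
by apply/(same_H10 ab _ hg)/AB => //; apply: L0_H10 => //; exact: BH.
Qed.
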